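(* Let $G/H$ be a generalized Wallach space with three intermediate subgroups $K_i$, $i=1,2,3$, with Lie algebras $\mathfrak k_i$, and let $T$ be a positive-definite $G$-invariant symmetric bilinear form field on $G/H$. If two of the quantities $\beta_{\mathfrak k_i}-\alpha_{\mathfrak k_i}$ ($i=1,2,3$) are negative, then the functional $S_{|\mathcal M_T}$ has a critical point with co-index $0$ or $1$.
   Context: Standing assumptions. $G$ is a compact connected Lie group, $H\subset G$ a compact connected subgroup, with Lie algebras $\mathfrak h\subset\mathfrak g$; $G/H$ is almost effective and not covered by a torus. An intermediate subgroup is a Lie subgroup $K$ with $H\subset K\subset G$ and $\dim H<\dim K<\dim G$; all intermediate subgroups are assumed connected and compact. Fix a bi-invariant metric $Q$ on $\mathfrak g$ and let $\mathfrak m=\mathfrak h^\perp$. Metrics. $G$-invariant metrics on $G/H$ are identified with $\mathrm{Ad}_H$-invariant inner products on $\mathfrak m$; $\mathcal M(G/H)$ denotes their set, $S(g)$ the scalar curvature, and $\mathcal M_T=\{g\in\mathcal M(G/H)\mid\mathrm{tr}_gT=1\}$. Similarly $\mathcal M(K/H)$ is identified with the $\mathrm{Ad}_H$-invariant inner products on $\mathfrak k\cap\mathfrak m$ and $\mathcal M(G/K)$ with the $\mathrm{Ad}_K$-invariant inner products on the $Q$-orthogonal complement $\mathfrak k^\perp$ of $\mathfrak k$ in $\mathfrak g$. Invariants. For an intermediate subgroup $K$ with Lie algebra $\mathfrak k$, $$\alpha_{\mathfrak k}=\sup\{S(g)\mid g\in\mathcal M(K/H),\ \mathrm{tr}_gT_{|\mathfrak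 k\cap\mathfrak m}=1\},\qquad \beta_{\mathfrak k}=\sup\{S(g)\mid g\in\mathcal M(G/K),\ \mathrm{tr}_gT_{|\mathfrak k^\perp}=1\}.$$ Generalized Wallach space. $G/H$ is a generalized Wallach space if there is a $Q$-orthogonal decomposition $\mathfrak m=\mathfrak m_1\oplus\mathfrak m_2\oplus\mathfrak m_3$ into $\mathrm{Ad}_H$-irreducible modules such that $[123]$ is, up to permutations, the only non-vanishing structure constant, where $[ijk]=\sum_{\alpha,\beta,\gamma}Q([e_\alpha,e_\beta],e_\gamma)^2$ with $(e_\alpha),(e_\beta),(e_\gamma)$ $Q$-orthonormal bases of $\mathfrak m_i,\mathfrak m_j,\mathfrak m_k$. The modules $\mathfrak m_i$ are assumed pairwise inequivalent as $\mathrm{Ad}_H$-representations. There are then precisely three intermediate subgroups $K_i$, with Lie algebras $\mathfrak k_i=\mathfrak h\oplus\mathfrak m_i$. The co-index of a critical point is the number of positive eigenvalues of the Hessian of $S_{|\mathcal M_T}$ there (so a local maximum has co-index $0$). *)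

(* Defs.v *)
From HB Require Import structures.
From mathcomp Require Import all_boot all_order all_algebra.
From mathcomp Require Import all_classical all_reals all_analysis.

Set Implicit Arguments.
Unset Strict Implicit.
Unset Printing Implicit Defensive.

Import Order.TTheory GRing.Theory Num.Theory.
Import numFieldNormedType.Exports.

Local Open Scope classical_set_scope.
Local Open Scope ring_scope.

(* f is of class C^k on the open set U: iterated directional derivatives exist
   up to order k and are continuous. Both sides are finite-dimensional below. *)
Fixpoint class_C (R : realType) (V W : normedModType R) (k : nat)
    (U : set V) (f : V -> W) : Prop :=
  if k is k'.+1 then
    (forall x, U x -> differentiable f x) /\
    (forall v, class_C k' U (fun x => 'D_v f x))
  else forall x, U x -> {for x, continuous f}.

Definition smooth_on (R : realType) (V W : normedModType R)
    (U : set V) (f : V -> W) : Prop := forall k, class_C k U f.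

(* [pt] is only meaningful on [crd @` dom]. *)
Record chart (R : realType) (n : nat) (X : topologicalType) := Chart {
  dom : set X;
  crd : X -> 'rV[R]_n;
  pt : 'rV[R]_n -> X;
  dom_open : open dom;
  crd_open : open (crd @` dom);
  crd_continuous : forall x, dom x -> {for x, continuous crd};
  pt_continuous : forall u, (crd @` dom) u -> {for u, continuous pt};
  crdK : forall x, dom x -> pt (crd x) = x }.

HB.mixin Record Topological_Group_isLieGroup (R : realType) (n : nat) G
    of Topological G & Group G := {
  lie_hausdorff : hausdorff_space G;
  lie_second_countable : @second_countable G;
  atlas : set (chart R n G);
  atlas_cover : forall x : G, exists c, atlas c /\ dom c x;
  atlas_smooth : forall c d, atlas c -> atlas d ->
    smooth_on (crd c @` (dom c `&` dom d)) (fun u => crd d (pt c u));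
  lie_mul_continuous : continuous (fun x : G * G => (x.1 * x.2)%g);
  lie_mul_smooth : forall c1 c2 d, atlas c1 -> atlas c2 -> atlas d ->
    smooth_on
      [set u : 'rV[R]_n * 'rV[R]_n | [/\ (crd c1 @` dom c1) u.1,
         (crd c2 @` dom c2) u.2 & dom d (pt c1 u.1 * pt c2 u.2)%g]]
      (fun u => crd d (pt c1 u.1 * pt c2 u.2)%g);
  lie_inv_continuous : continuous (fun x : G => x^-1%g);
  lie_inv_smooth : forall c d, atlas c -> atlas d ->
    smooth_on [set u | (crd c @` dom c) u /\ dom d (pt c u)^-1%g]
      (fun u => crd d (pt c u)^-1%g) }.

#[short(type="lieGroupType")]
HB.structure Definition LieGroup (R : realType) (n : nat) :=
  { G of Topological_Group_isLieGroup R n G & Topological G & Group G }.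

Section LieAlgebra.
Context {R : realType} {n : nat} (G : lieGroupType R n).

Definition chart1 : chart R n G := projT1 (cid (atlas_cover (1%g : G))).

(* The Lie algebra of G is 'rV[R]_n, identified with the tangent space at 1
   through the chart [chart1]. *)

(* Ad_a, the differential at 1 of x |-> a x a^-1, acting on row vectors by
   right multiplication: Ad_a X is X *m Ad a. *)
Definition Ad (a : G) : 'M[R]_n :=
  'J (fun u => crd chart1 (a * pt chart1 u * a^-1)%g) (crd chart1 1%g).

(* [X, Y] = ad_X Y, where ad is the differential of Ad at 1. *)
Definition bracket (X Y : 'rV[R]_n) : 'rV[R]_n :=
  'D_X (fun u => Y *m Ad (pt chart1 u)) (crd chart1 1%g).

End LieAlgebra.

Section LieSubgroup.
Context {R : realType} {d n : nat} (L : lieGroupType R d) (G : lieGroupType R n).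

Definition lie_morphism (f : L -> G) : Prop :=
  [/\ forall x y, f (x * y)%g = (f x * f y)%g,
      continuous f
    & forall c e, atlas c -> atlas e ->
        smooth_on [set u | (crd c @` dom c) u /\ dom e (f (pt c u))]
          (fun u => crd e (f (pt c u)))].

Definition lie_diff (f : L -> G) : 'M[R]_(d, n) :=
  'J (fun u => crd (chart1 G) (f (pt (chart1 L) u))) (crd (chart1 L) 1%g).

End LieSubgroup.

Section HomogeneousSpaces.
Context {R : realType} {n : nat} (G : lieGroupType R n).
Implicit Types (H K : set G) (h k p q Q : 'M[R]_n).

(* Linear subspaces of the Lie algebra are given as row spaces of matrices.
   K is a (possibly only immersed) Lie subgroup with Lie algebra k. *)
Definition lie_subgroup K k : Prop :=
  exists d (L : lieGroupType R d) (f : L -> G),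
    [/\ lie_morphism f, injective f, row_free (lie_diff f),
        range f = K & (lie_diff f == k)%MS].

Definition intermediate_subgroup H h K k : Prop :=
  [/\ lie_subgroup K k, H `<=` K, (\rank h < \rank k < n)%N,
      compact K & connected K].

Definition lcoset H (x : G) : set G := [set (x * y)%g | y in H].

Definition same_lcoset H : rel G := fun x y => `[< lcoset H x = lcoset H y >].

Lemma same_lcoset_refl H : reflexive (same_lcoset H).
Proof. by move=> x; apply/asboolP. Qed.

Lemma same_lcoset_sym H : symmetric (same_lcoset H).
Proof. by move=> x y; apply/asboolP/asboolP => ->. Qed.

Lemma same_lcoset_trans H : transitive (same_lcoset H).
Proof. by move=> y x z /asboolP xy /asboolP yz; apply/asboolP; rewrite xy. Qed.

Canonical same_lcoset_equiv H :=
  EquivRel (same_lcoset H) (same_lcoset_refl H) (same_lcoset_sym H)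
    (@same_lcoset_trans H).

Definition homogeneous_space H : topologicalType :=
  quotient_topology {eq_quot (same_lcoset_equiv H)}%qT.

(* The kernel of the action of G on G/H is discrete. *)
Definition almost_effective H : Prop :=
  \forall x \near nbhs (1%g : G), (forall a, H (a^-1 * x * a)%g) -> x = 1%g.

(* Bi-invariant metrics are identified with Ad_G-invariant inner products. *)
Definition biinvariant Q : Prop :=
  [/\ Q^T = Q, forall X : 'rV[R]_n, X != 0 -> 0 < (X *m Q *m X^T) 0 0
    & forall a : G, Ad a *m Q *m (Ad a)^T = Q].

Definition qcompl Q k : 'M[R]_n := kermx (Q *m k^T).

(* Bilinear forms on a subspace p are given by their Gram matrices in the basis
   formed by the rows of [row_base p]. *)
Definition form p (g : 'M[R]_(\rank p)) (X Y : 'rV[R]_n) : R :=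
  (X *m pinvmx (row_base p) *m g *m (Y *m pinvmx (row_base p))^T) 0 0.

Definition bvec p (i : 'I_(\rank p)) : 'rV[R]_n := row i (row_base p).

Definition restr p q (g : 'M[R]_(\rank p)) : 'M[R]_(\rank q) :=
  \matrix_(i, j) form g (bvec i) (bvec j).

Definition invariant_form K p (g : 'M[R]_(\rank p)) : Prop :=
  forall a, K a -> forall X Y, (X <= p)%MS -> (Y <= p)%MS ->
    form g (X *m Ad a) (Y *m Ad a) = form g X Y.

(* Ad_K-invariant inner products on p. *)
Definition metrics K p : set 'M[R]_(\rank p) :=
  [set g | [/\ g^T = g,
      forall X, (X <= p)%MS -> X != 0 -> 0 < form g X X
    & invariant_form K g]].

Definition trace_form p (T g : 'M[R]_(\rank p)) : R := \tr (invmx g *m T).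

(* Curvature of the invariant metric g on a homogeneous space whose isotropy
   algebra is h and whose tangent space is the reductive complement p; only
   brackets of elements of h + p occur. *)
Section Curvature.
Variables (h p : 'M[R]_n) (g : 'M[R]_(\rank p)).

Let br_p (X Y : 'rV[R]_n) : 'rV[R]_n := bracket G X Y *m proj_mx p h.
Let br_h (X Y : 'rV[R]_n) : 'rV[R]_n := bracket G X Y *m proj_mx h p.

(* The vector of p representing the linear form l through g. *)
Definition sharp (l : 'rV[R]_n -> R) : 'rV[R]_n :=
  \sum_i \sum_j (invmx g i j * l (bvec i)) *: bvec j.

(* The Nomizu operator p x p -> p of the Levi-Civita connection, given by the
   Koszul formula. *)
Definition levi_civita (X Y : 'rV[R]_n) : 'rV[R]_n :=
  sharp (fun Z => 2^-1 *
    (form g (br_p X Y) Z - form g (br_p Y Z) X + form g (br_p Z X) Y)).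

(* The curvature tensor at the base point (Kobayashi-Nomizu II, X.2.3). *)
Definition curvature (X Y Z : 'rV[R]_n) : 'rV[R]_n :=
  levi_civita X (levi_civita Y Z) - levi_civita Y (levi_civita X Z)
  - levi_civita (br_p X Y) Z - bracket G (br_h X Y) Z.

Definition scalar_curvature : R :=
  \sum_i \sum_j \sum_k \sum_l invmx g i k * invmx g j l *
    form g (curvature (bvec i) (bvec j) (bvec l)) (bvec k).

End Curvature.

(* sup of S over the Ad_K-invariant metrics on p with tr_g T = 1, for the
   isotropy algebra h. *)
Definition sup_scalar K h p (T : 'M[R]_(\rank p)) : \bar R :=
  ereal_sup [set (scalar_curvature h g)%:E |
    g in @metrics K p `&` [set g | trace_form T g = 1]].

(* T is a form on the Q-orthogonal complement of h. *)
Definition alpha H h Q (T : 'M[R]_(\rank (qcompl Q h))) k : \bar R :=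
  sup_scalar H h (restr (k :&: qcompl Q h)%MS T).

Definition beta K h Q (T : 'M[R]_(\rank (qcompl Q h))) k : \bar R :=
  sup_scalar K k (restr (qcompl Q k) T).

Definition irreducible K p : Prop :=
  [/\ p != 0, forall a, K a -> stablemx p (Ad a)
    & forall q, (q <= p)%MS -> (forall a, K a -> stablemx q (Ad a)) ->
        q = 0 \/ (q == p)%MS].

(* Right multiplication by A induces an Ad_K-equivariant isomorphism p -> q. *)
Definition equivalent K p q : Prop :=
  exists A : 'M[R]_n, [/\ (p *m A == q)%MS, \rank p = \rank q
    & forall a, K a -> p *m Ad a *m A = p *m A *m Ad a].

Definition orthonormal_basis Q p (e : 'M[R]_(\rank p, n)) : Prop :=
  (e == p)%MS /\ e *m Q *m e^T = 1%:M.

Definition structure_constant Q (a b c : nat)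
    (e : 'M[R]_(a, n)) (f : 'M[R]_(b, n)) (f' : 'M[R]_(c, n)) : R :=
  \sum_i \sum_j \sum_l
    ((bracket G (row i e) (row j f) *m Q *m (row l f')^T) 0 0) ^+ 2.

Definition generalized_wallach H Q h (m : 'I_3 -> 'M[R]_n) : Prop :=
  [/\ (\sum_i m i == qcompl Q h)%MS,
      forall i j, i != j -> m i *m Q *m (m j)^T = 0,
      forall i, irreducible H (m i),
      forall i j, i != j -> ~ equivalent H (m i) (m j)
    & exists e : forall i, 'M[R]_(\rank (m i), n),
        (forall i, orthonormal_basis Q (e i)) /\
        (forall i j l, (structure_constant Q (e i) (e j) (e l) != 0)
                       = uniq [:: i; j; l])].

Section Variational.
Variables (H : set G) (h p : 'M[R]_n) (T : 'M[R]_(\rank p)).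

Definition M_T : set 'M[R]_(\rank p) :=
  @metrics H p `&` [set g | trace_form T g = 1].

Definition tangent_M_T (g : 'M[R]_(\rank p)) : set 'M[R]_(\rank p) :=
  [set v | [/\ v^T = v, invariant_form H v & 'D_v (trace_form T) g = 0]].

Definition critical_point (g : 'M[R]_(\rank p)) : Prop :=
  M_T g /\ forall v, tangent_M_T g v -> 'D_v (scalar_curvature h (p := p)) g = 0.

(* As tr_(cg) T = c^-1 tr_g T, this maps metrics to M_T. It is the identity on
   M_T, and v |-> to_M_T (g + v), for v tangent at g, is a local
   parametrization of M_T near g whose differential at 0 is the identity. *)
Definition to_M_T (g : 'M[R]_(\rank p)) : 'M[R]_(\rank p) :=
  trace_form T g *: g.

(* The Hessian at a critical point g of S restricted to M_T, computed in this
   parametrization (at a critical point the choice is immaterial). *)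
Definition hessian (g v w : 'M[R]_(\rank p)) : R :=
  'D_v (fun x => 'D_w (fun y => scalar_curvature h (to_M_T y)) x) g.

(* In a basis b of the tangent space, s lists the eigenvalues of the Hessian
   matrix with multiplicity and c of them are positive; by Sylvester's law of
   inertia, c does not depend on b. *)
Definition coindex (g : 'M[R]_(\rank p)) (c : nat) : Prop :=
  exists (d : nat) (b : d.-tuple 'M[R]_(\rank p)) (s : seq R),
    [/\ free b, forall v, v \in <<b>>%VS <-> tangent_M_T g v,
        char_poly (\matrix_(i < d, j < d) hessian g (tnth b i) (tnth b j))
          = \prod_(a <- s) ('X - a%:P)
      & count (fun a => 0 < a) s = c].

End Variational.

End HomogeneousSpaces.

Definition torus (R : realType) (k : nat) : set ('rV[R]_k * 'rV[R]_k) :=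
  [set z | forall i : 'I_k, (z.1 : 'rV_k) 0 i ^+ 2 + (z.2 : 'rV_k) 0 i ^+ 2 = 1].

Definition covering_map (X Y : topologicalType) (f : X -> Y) : Prop :=
  [/\ continuous f, (forall y, exists x, f x = y) &
    forall y, exists V : set Y, [/\ open V, V y &
      exists (I : Type) (U : I -> set X),
        [/\ f @^-1` V = \bigcup_i U i, trivIset setT U &
          forall i, [/\ open (U i), set_bij (U i) V f &
            forall W, open W -> W `<=` U i -> open (f @` W)]]]].

Definition covered_by_torus (R : realType) (Y : topologicalType) : Prop :=
  exists (k : nat) (f : set_type (@torus R k) -> Y), covering_map f.

(* Main.v *)
Require Import Defs.
From HB Require Import structures.
From mathcomp Require Import all_boot all_order all_algebra.
From mathcomp Require Import all_classical all_reals all_analysis.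
From mathcomp Require Import ring lra.

(** On a generalized Wallach space the Ad_H-invariant metrics are, by Schur's lemma, the
    diagonal ones x1 Q + x2 Q + x3 Q with x_l > 0 ([metric_diagonal]). With A = [123], with
    p_l the sum of the squared norms of the brackets of an orthonormal basis of m_l, and
    with t_l the trace of T on m_l, the scalar curvature and the trace are
    [[
      S(x) = ((p1 + A) x2 x3 + (p2 + A) x1 x3 + (p3 + A) x1 x2
              - A/2 (x1^2 + x2^2 + x3^2)) / (x1 x2 x3),
      tr_x T = t1/x1 + t2/x2 + t3/x3 = (t1 x2 x3 + t2 x1 x3 + t3 x1 x2) / (x1 x2 x3)
    ]]
    ([scal_wallach], [trace_diagonal]). Rescaling a metric to unit trace multiplies S by
    1/(tr_x T), so S restricted to M_T is the quotient q_S / q_T of the two quadratic forms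
    in the numerators. Its critical points of value lam are the positive vectors x in the
    kernel of the quadratic form q_S - lam q_T, the form with diagonal entries -A/2 and with
    the coefficient a_l = p_l + A - lam t_l at the product of the two other variables.

    The co-index is then at most one at every critical point ([diagform_coindex]): the
    Hessian at x is q_S - lam q_T, up to the factor 2 / q_T(x), on the tangent plane of M_T,
    which is a complement of the kernel vector x. A form with negative diagonal entries
    stays negative on the projections of the coordinate vectors to that plane, so it is not
    positive definite there, and the plane has dimension two.

    It remains to find a critical point ([wallach_root]). The fibre K_i/H carries a single
    metric of unit trace, whence alpha_i <= p_i / t_i, and the multiples of Q on G/K_i give
    beta_i >= (p_j + p_k + 2 A) / (t_j + t_k). Let i be the one of the two given indices
    with the smaller ratio p_i / t_i, and j the other one. At lam = p_i / t_i one has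
    a_i = A <= a_j, and beta_i < alpha_i says that a_j + a_k < 0. Therefore
    A a_k + a_i a_j + sqrt ((a_i^2 - A^2) (a_j^2 - A^2)) is negative at lam = p_i / t_i. It
    is positive for lam near -oo, where a_i, a_j and a_k are large, and at a zero in between
    the kernel of q_S - lam q_T contains a positive vector. Geometrically this is the pass
    between the peaks of S at the vertices of M_T that correspond to K_i and K_j.

    The formula for S follows from the Koszul formula in an orthogonal frame
    ([scalar_curvature_formula]), once the bracket is known to be bilinear, alternating,
    skew for Q and compatible with the action of H. The bracket is defined through second
    derivatives of conjugation in a chart. That it is alternating comes from
    c(u, u) = u, where c(u, v) is u v u^-1 in coordinates ([bracketXX]). *)

Set Implicit Arguments.
Unset Strict Implicit.
Unset Printing Implicit Defensive.
Import Order.TTheory GRing.Theory Num.Theory.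
Import numFieldNormedType.Exports.
Local Open Scope classical_set_scope.
Local Open Scope ring_scope.
Local Notation form := Defs.form.

(** * Differentials of locally equal and of composite maps *)

Section NearDiff.
Variables (R : realType) (V W : normedModType R).
Implicit Types (f g : V -> W) (x : V).

Lemma near_eq_diff_locally f g x : {near x, f =1 g} -> differentiable f x ->
  g \o shift x = cst (g x) + 'd f x +o_ 0 id.
Proof.
move=> fg df; have fgx : f x = g x := nbhs_singleton fg.
have /eqaddoP H := diff_locally df.
apply/eqaddoP => e e0.
have := H e e0; apply: filter_app.
have : \forall y \near (0 : V), f (y + x) = g (y + x).
  by have := fg; rewrite (near_shift 0 x) subr0.
apply: filter_app; near=> y => E.
rewrite -fgx; set a := (X in X <= _ -> _); set b := (X in _ -> X <= _).
suff -> : a = b by [].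
congr (`|_|).
exact: (congr1 (fun z => z - (f x + 'd f x y)) E).
Unshelve. all: by end_near. Qed.

Lemma near_eq_diff f g x : {near x, f =1 g} ->
  differentiable f x -> 'd g x = 'd f x :> (V -> W).
Proof.
move=> fg df; apply: diff_unique; first exact: diff_continuous.
exact: near_eq_diff_locally.
Qed.

Lemma near_eq_differentiable f g x : {near x, f =1 g} ->
  differentiable f x -> differentiable g x.
Proof.
move=> fg df; apply/diff_locallyP; rewrite (near_eq_diff fg df); split.
  exact: diff_continuous.
exact: near_eq_diff_locally.
Qed.

Lemma near_eq_diffE f g x v : {near x, f =1 g} ->
  differentiable f x -> 'd g x v = 'd f x v.
Proof. by move=> fg df; rewrite (near_eq_diff fg). Qed.

End NearDiff.

Lemma diff_compE (R : realType) (U V W : normedModType R) (f : U -> V) (g : V -> W)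
    x v : differentiable f x -> differentiable g (f x) ->
  'd (fun y => g (f y)) x v = 'd g (f x) ('d f x v).
Proof. by move=> df dg; rewrite -[LHS]/('d (g \o f) x v) diff_comp. Qed.

Lemma diff_pairE (R : realType) (U V W : normedModType R) (f : U -> V) (g : U -> W)
    x v : differentiable f x -> differentiable g x ->
  'd (fun y => (f y, g y)) x v = ('d f x v, 'd g x v).
Proof. by move=> df dg; rewrite diff_pair. Qed.


Lemma coord_comp_diff (R : realType) (U : normedModType R) (m k : nat)
    (F : U -> 'M[R]_(m, k)) x i j : differentiable F x ->
  differentiable (fun y => F y i j) x.
Proof.
move=> dF; apply: (@differentiable_comp _ _ _ _ F (fun v => v i j)) => //.
exact: differentiable_coord.
Qed.

Lemma ler_coord_norm (R : realType) (m k : nat) (M : 'M[R]_(m, k)) i j :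
  `|M i j| <= `|M|.
Proof. by rewrite [leRHS]/Num.Def.normr /= mx_normrE (le_bigmax _ _ (i, j)). Qed.

(** * The group operations in charts *)

Section ChartCalculus.
Context {R : realType} {n : nat} {G : lieGroupType R n}.
Implicit Types (c d : chart R n G) (x y a : G).
Local Notation V := 'rV[R]_n.

Lemma fst_diff (z : V * V) : differentiable (fst : V * V -> V) z.
Proof. by apply: linear_differentiable => ?; exact: cvg_fst. Qed.

Lemma diff_fstE (z w : V * V) : 'd (fst : V * V -> V) z w = w.1.
Proof. by rewrite diff_lin //= => ?; exact: cvg_fst. Qed.

(** The chain rule for [z |-> m (m z, i z.1)], the shape of u v u^-1 in a chart where m is
    the product and i the inverse. The answer is written in coordinates so that it only
    involves derivatives of m along fixed vectors, which are themselves differentiable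
    when m is twice differentiable. *)
Lemma derive_conj_shape (m C : V * V -> V) (i : V -> V) (z : V * V) (Y : V) :
  differentiable m z -> differentiable i z.1 ->
  differentiable m (m z, i z.1) ->
  {near z, C =1 fun z => m (m z, i z.1)} ->
  'D_((0, Y) : V * V) C z = \sum_i0 \sum_j
    (('D_((0, Y) : V * V) m z) 0 i0 *
     ('D_((delta_mx 0 i0, 0) : V * V) m (m z, i z.1)) 0 j) *: delta_mx 0 j.
Proof.
move=> dm di dmm CE.
have difst : differentiable (fun z : V * V => i z.1) z.
  exact: (differentiable_comp (fst_diff z) di).
have dp := differentiable_pair dm difst.
set a := 'D_(0, Y) m z.
have E1 : 'd (fun z : V * V => i z.1) z (0, Y) = 0.
  apply: (etrans (diff_compE (f := fst) _ (fst_diff z) di)).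
  by rewrite diff_fstE linear0.
have E2 : 'd (fun z : V * V => (m z, i z.1)) z (0, Y) = (a, 0).
  apply: (etrans (diff_pairE _ dm difst)); congr pair => //.
  by rewrite /a deriveE.
have dmc := differentiable_comp dp dmm.
apply: (etrans (near_eq_derive _ CE)).
apply: (etrans (deriveE _ dmc)).
apply: (etrans (diff_compE _ dp dmm)).
apply: (etrans (congr1 _ E2)).
have -> : ((a, 0) : V * V) = \sum_i a 0 i *: ((delta_mx 0 i, 0) : V * V).
  rewrite [RHS]surjective_pairing; congr pair.
    rewrite (big_morph (fst : V * V -> V) (id1 := 0) (op1 := +%R)) //.
    by rewrite [LHS]row_sum_delta.
  rewrite (big_morph (snd : V * V -> V) (id1 := 0) (op1 := +%R)) //.
  by rewrite big1 // => j _; rewrite /= scaler0.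
rewrite linear_sum; apply: eq_bigr => k _.
rewrite linearZ /= -(deriveE _ dmm) {1}['D_(_) m _]row_sum_delta scaler_sumr.
by apply: eq_bigr => j _; rewrite scalerA.
Qed.

Lemma diff_slice1 (F : V * V -> V) u v X : differentiable F (u, v) ->
  differentiable (fun w => F (w, v)) u /\
  'd (fun w => F (w, v)) u X = 'd F (u, v) (X, 0).
Proof.
move=> dF; have dp : differentiable (fun w : V => (w, v)) u.
  by apply: differentiable_pair => //; exact: differentiable_cst.
split; first exact: (differentiable_comp dp dF).
apply: (etrans (diff_compE _ dp dF)); congr ('d F _ _).
have did : differentiable (id : V -> V) u by [].
apply: (etrans (diff_pairE X did (differentiable_cst v u))).
by congr pair; [rewrite (@diff_val _ _ _ _ _ _ _ (is_diff_id u)) | rewrite diff_cst].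
Qed.

Lemma diff_slice2 (F : V * V -> V) u v X : differentiable F (u, v) ->
  differentiable (fun w => F (u, w)) v /\
  'd (fun w => F (u, w)) v X = 'd F (u, v) (0, X).
Proof.
move=> dF; have dp : differentiable (fun w : V => (u, w)) v.
  by apply: differentiable_pair => //; exact: differentiable_cst.
split; first exact: (differentiable_comp dp dF).
apply: (etrans (diff_compE _ dp dF)); congr ('d F _ _).
have did : differentiable (id : V -> V) v by [].
apply: (etrans (diff_pairE X (differentiable_cst u v) did)).
by congr pair; [rewrite diff_cst | rewrite (@diff_val _ _ _ _ _ _ _ (is_diff_id v))].
Qed.

Lemma chart_nearK c x : dom c x ->
  \forall u \near crd c x, dom c (pt c u) /\ crd c (pt c u) = u.
Proof.
move=> cx; have : nbhs (crd c x) (crd c @` dom c).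
  by apply: open_nbhs_nbhs; split; [exact: crd_open | exists x].
by apply: filterS => _ [y cy <-]; rewrite crdK.
Qed.

Lemma pt_cvg c x : dom c x -> pt c u @[u --> crd c x] --> x.
Proof.
move=> cx; rewrite -[X in _ --> X](crdK cx).
by apply: pt_continuous; exists x.
Qed.

Lemma mulg_cvg (T : Type) (F : set_system T) {FF : Filter F} (f g : T -> G) x y :
  f t @[t --> F] --> x -> g t @[t --> F] --> y ->
  (f t * g t)%g @[t --> F] --> (x * y)%g.
Proof.
move=> fx gy; apply: (cvg_comp (fun t => (f t, g t)) (fun z : G * G => z.1 * z.2)%g).
  exact: cvg_pair fx gy.
exact: (@lie_mul_continuous R n G (x, y)).
Qed.

Lemma invg_cvg (T : Type) (F : set_system T) {FF : Filter F} (f : T -> G) x :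
  f t @[t --> F] --> x -> (f t)^-1%g @[t --> F] --> x^-1%g.
Proof.
by move=> fx; apply: cvg_comp fx _; exact: (@lie_inv_continuous R n G x).
Qed.

Lemma near_dom c x : dom c x -> \forall y \near x, dom c y.
Proof. by move=> cx; apply: open_nbhs_nbhs; split=> //; exact: dom_open. Qed.

Definition chart_mul c1 c2 d (u : V * V) : V := crd d (pt c1 u.1 * pt c2 u.2)%g.
Definition chart_inv c d (u : V) : V := crd d (pt c u)^-1%g.

Lemma chart_mul_C2 c1 c2 d x y : atlas c1 -> atlas c2 -> atlas d ->
  dom c1 x -> dom c2 y -> dom d (x * y)%g ->
  differentiable (chart_mul c1 c2 d) (crd c1 x, crd c2 y) /\
  forall w, differentiable ('D_w (chart_mul c1 c2 d)) (crd c1 x, crd c2 y).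
Proof.
move=> a1 a2 ad d1 d2 dd; have [Hd H1] := lie_mul_smooth _ _ _ a1 a2 ad 2%N.
split=> [|w]; [apply: Hd | apply: (proj1 (H1 w))] => /=; split.
- by exists x.
- by exists y.
- by rewrite !crdK.
- by exists x.
- by exists y.
- by rewrite !crdK.
Qed.

Lemma chart_mul_diff c1 c2 d x y : atlas c1 -> atlas c2 -> atlas d ->
  dom c1 x -> dom c2 y -> dom d (x * y)%g ->
  differentiable (chart_mul c1 c2 d) (crd c1 x, crd c2 y).
Proof. by move=> a1 a2 ad d1 d2 dd; exact: (chart_mul_C2 a1 a2 ad d1 d2 dd).1. Qed.

Lemma chart_inv_diff c d x : atlas c -> atlas d -> dom c x -> dom d x^-1%g ->
  differentiable (chart_inv c d) (crd c x).
Proof.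
move=> ac ad dx dd; have [Hd _] := lie_inv_smooth _ _ ac ad 1%N.
by apply: Hd; split; [exists x | rewrite crdK].
Qed.

Lemma atlas_chart1 : atlas (chart1 G).
Proof. by rewrite /chart1; case: cid => c []. Qed.

Lemma dom_chart1 : dom (chart1 G) 1%g.
Proof. by rewrite /chart1; case: cid => c []. Qed.

Local Notation c1 := (chart1 G).
Local Notation e := (crd (chart1 G) 1%g).

(** Far from the identity no single chart carries all the factors: the product a u is read
    in a chart at a, and a^-1 in a chart around a^-1. *)
Lemma conj_diff a : differentiable
  (fun u => crd c1 (a * pt c1 u * a^-1)%g) e.
Proof.
have [pencil_coef [aca da]] := atlas_cover a.
have [cb [acb db]] := atlas_cover (a^-1)%g.
have da1 : dom pencil_coef (a * 1)%g by rewrite mulg1.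
have da2 : dom c1 (a * a^-1)%g by rewrite mulgV; exact: dom_chart1.
pose f (u : V) := chart_mul pencil_coef c1 pencil_coef (crd pencil_coef a, u).
pose g (w : V) := chart_mul pencil_coef cb c1 (w, crd cb (a^-1)%g).
have fE : f e = crd pencil_coef a by rewrite /f /chart_mul /= !crdK ?mulg1 //;
  exact: dom_chart1.
have df : differentiable f e.
  apply: (@differentiable_comp _ _ _ _ (fun u => (crd pencil_coef a, u))).
    exact: differentiable_pair.
  exact: (chart_mul_diff aca atlas_chart1 aca da dom_chart1 da1).
have dg : differentiable g (f e).
  rewrite fE; apply: (@differentiable_comp _ _ _ _ (fun w => (w, crd cb a^-1%g))).
    exact: differentiable_pair.
  exact: (chart_mul_diff aca acb atlas_chart1 da db da2).
apply: near_eq_differentiable (differentiable_comp df dg).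
have cv : (a * pt c1 u)%g @[u --> e] --> (a * 1)%g.
  exact: (mulg_cvg (cvg_cst a) (pt_cvg dom_chart1)).
have : \forall u \near e, dom pencil_coef (a * pt c1 u)%g := cv _ (near_dom da1).
apply: filterS => u ud.
by rewrite /g /f /chart_mul /= !crdK.
Qed.

End ChartCalculus.

(** * Second-order regularity of conjugation *)

Section BracketCalculus.
Context {R : realType} {n : nat} (G : lieGroupType R n).
Implicit Types (x y a : G).
Local Notation V := 'rV[R]_n.
Local Notation c1 := (chart1 G).
Local Notation e := (crd (chart1 G) 1%g).
Local Notation mu := (chart_mul c1 c1 c1).
Local Notation iota := (chart_inv c1 c1).

Definition chart_conj (z : V * V) : V :=
  crd c1 (pt c1 z.1 * pt c1 z.2 * (pt c1 z.1)^-1)%g.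

(** The points at which every product occurring in u v u^-1 stays in the domain of the
    chart at 1, so that conjugation is the composite of [chart_mul] and [chart_inv]. *)
Definition conj_defined (z : V * V) : Prop :=
  [/\ dom c1 (pt c1 z.1) /\ crd c1 (pt c1 z.1) = z.1,
      dom c1 (pt c1 z.2) /\ crd c1 (pt c1 z.2) = z.2,
      dom c1 (pt c1 z.1 * pt c1 z.2)%g, dom c1 (pt c1 z.1)^-1%g
    & dom c1 (pt c1 z.1 * pt c1 z.2 * (pt c1 z.1)^-1)%g].

Lemma pt_chart1 : pt c1 e = 1%g. Proof. by rewrite crdK //; exact: dom_chart1. Qed.

Lemma near_conj_defined : \forall z \near ((e, e) : V * V), conj_defined z.
Proof.
have p1 : pt c1 z.1 @[z --> ((e, e) : V * V)] --> (1%g : G).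
  by apply: cvg_comp; [exact: cvg_fst | exact: pt_cvg dom_chart1].
have p2 : pt c1 z.2 @[z --> ((e, e) : V * V)] --> (1%g : G).
  by apply: cvg_comp; [exact: cvg_snd | exact: pt_cvg dom_chart1].
have p3 := mulg_cvg p1 p2 (FF := nbhs_filter ((e, e) : V * V)).
have p4 := invg_cvg p1 (FF := nbhs_filter ((e, e) : V * V)).
have p5 := mulg_cvg p3 p4 (FF := nbhs_filter ((e, e) : V * V)).
have d1 := @dom_chart1 R n G.
have d3 : dom c1 (1 * 1)%g by rewrite mulg1.
have d4 : dom c1 (1^-1)%g by rewrite invg1.
have d5 : dom c1 (1 * 1 * 1^-1)%g by rewrite mulg1 mulgV.
have H1 : \forall z \near ((e, e) : V * V), dom c1 (pt c1 z.1) /\ crd c1 (pt c1 z.1) = z.1.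
  exact: (@cvg_fst _ _ (nbhs e) (nbhs e) _ _ (chart_nearK d1)).
have H2 : \forall z \near ((e, e) : V * V), dom c1 (pt c1 z.2) /\ crd c1 (pt c1 z.2) = z.2.
  exact: (@cvg_snd _ _ (nbhs e) (nbhs e) _ _ (chart_nearK d1)).
have H3 : \forall z \near ((e, e) : V * V),
  dom c1 (pt c1 z.1 * pt c1 z.2)%g := p3 _ (near_dom d3).
have H4 : \forall z \near ((e, e) : V * V), dom c1 (pt c1 z.1)^-1%g := p4 _ (near_dom d4).
have H5 : \forall z \near ((e, e) : V * V),
  dom c1 (pt c1 z.1 * pt c1 z.2 * (pt c1 z.1)^-1)%g := p5 _ (near_dom d5).
by near do split.
Unshelve. all: by end_near. Qed.

Lemma chart_mul_diff_at z : conj_defined z -> differentiable mu z /\ forall w,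
  differentiable ('D_w mu) z.
Proof.
move=> [[d1 E1] [d2 E2] d3 _ _].
have := chart_mul_C2 (@atlas_chart1 R n G) (@atlas_chart1 R n G) (@atlas_chart1 R n G) d1 d2 d3.
by rewrite E1 E2 -surjective_pairing.
Qed.

Lemma chart_inv_diff_at z : conj_defined z -> differentiable iota z.1.
Proof.
move=> [[d1 E1] _ _ d4 _].
by have := chart_inv_diff (@atlas_chart1 R n G) (@atlas_chart1 R n G) d1 d4; rewrite E1.
Qed.

Lemma chart_mul_conj_diff z : conj_defined z -> differentiable mu (mu z, iota z.1) /\
  forall w, differentiable ('D_w mu) (mu z, iota z.1).
Proof.
move=> [[d1 E1] [d2 E2] d3 d4 d5].
exact: (chart_mul_C2 (@atlas_chart1 R n G) (@atlas_chart1 R n G) (@atlas_chart1 R n G) d3 d4 d5).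
Qed.

Lemma chart_conjE z : conj_defined z -> chart_conj z = mu (mu z, iota z.1).
Proof. by move=> [_ _ d3 d4 _]; rewrite /chart_conj /chart_mul /chart_inv /= !crdK. Qed.

Lemma chart_inv_fst_diff z : conj_defined z -> differentiable (fun z : V * V => iota z.1) z.
Proof.
move=> gz; apply: (@differentiable_comp _ _ _ _ fst iota); first exact: fst_diff.
exact: chart_inv_diff_at.
Qed.

Lemma chart_conj_inner_diff z : conj_defined z ->
  differentiable (fun z => (mu z, iota z.1)) z.
Proof.
by move=> gz; apply: differentiable_pair;
  [have [] := chart_mul_diff_at gz | exact: chart_inv_fst_diff].
Qed.

Lemma chart_conj_diff z : conj_defined z -> (\forall z' \near z, conj_defined z') ->
  differentiable chart_conj z.
Proof.
move=> gz ngz.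
apply: (near_eq_differentiable (f := mu \o (fun z => (mu z, iota z.1)))).
  by apply: filterS ngz => z' /= gz'; rewrite chart_conjE.
apply: differentiable_comp; first exact: chart_conj_inner_diff.
by have [] := chart_mul_conj_diff gz.
Qed.

Lemma chart_conj_derive z Y : conj_defined z -> (\forall z' \near z, conj_defined z') ->
  'D_((0, Y) : V * V) chart_conj z = \sum_i \sum_j
    (('D_((0, Y) : V * V) mu z) 0 i *
     ('D_((delta_mx 0 i, 0) : V * V) mu (mu z, iota z.1)) 0 j) *: delta_mx 0 j.
Proof.
move=> gz ngz;
have [dmu1 _] := chart_mul_diff_at gz; have [dmu2 _] := chart_mul_conj_diff gz.
apply: derive_conj_shape => //; first exact: chart_inv_diff_at.
by apply: filterS ngz => z' gz'; rewrite chart_conjE.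
Qed.

Lemma conj_defined1 : conj_defined (e, e).
Proof. exact: (nbhs_singleton near_conj_defined). Qed.

(** This is the regularity that makes Ad differentiable at 1, hence the bracket linear in
    its first argument. *)
Lemma chart_conj_diff2 Y : differentiable ('D_((0, Y) : V * V) chart_conj) (e, e).
Proof.
have [dmu Dmu] := chart_mul_diff_at conj_defined1.
pose F z := \sum_i \sum_j
    (('D_((0, Y) : V * V) mu z) 0 i *
     ('D_((delta_mx 0 i, 0) : V * V) mu (mu z, iota z.1)) 0 j) *: (delta_mx 0 j : V).
apply: (near_eq_differentiable (f := F)).
  apply: filterS (near_join near_conj_defined) => z H.
  by rewrite chart_conj_derive //; exact: (nbhs_singleton H).
rewrite [F](_ : _ = \sum_i \sum_j fun z => 
    (('D_((0, Y) : V * V) mu z) 0 i *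
     ('D_((delta_mx 0 i, 0) : V * V) mu (mu z, iota z.1)) 0 j) *: (delta_mx 0 j : V)).
  apply: differentiable_sum => i; apply: differentiable_sum => j.
  apply: differentiableZl; apply: differentiableM.
    exact: coord_comp_diff.
  apply: coord_comp_diff.
  have [_ D2] := chart_mul_conj_diff conj_defined1.
  exact: (differentiable_comp (chart_conj_inner_diff conj_defined1) (D2 _)).
apply/funext => z; rewrite fct_sumE; apply: eq_bigr => i _.
by rewrite fct_sumE.
Qed.

Lemma near_conj_defined_l : \forall u \near e, \forall z \near (u, e), conj_defined z.
Proof.
have H := near_join near_conj_defined.
have c : (u, e) @[u --> e] --> ((e, e) : V *
  V) by exact: (@cvg_pair _ _ _ (nbhs e) (nbhs e) (nbhs e) _ _ _ id (cst e) cvg_id (cvg_cst _)).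
exact: (c _ H).
Qed.

Lemma Ad_derive u Y : (\forall z \near ((u, e) : V * V), conj_defined z) ->
  Y *m Ad (pt c1 u) = 'D_((0, Y) : V * V) chart_conj (u, e).
Proof.
move=> H; have gu := nbhs_singleton H.
have dC := chart_conj_diff gu H.
have [ds E] := diff_slice2 Y dC.
apply: (etrans (esym (deriveEjacobian Y ds))).
by rewrite (deriveE _ ds) (deriveE _ dC) E.
Qed.
End BracketCalculus.

(** * The bracket is bilinear and alternating *)

Section Bracket.
Context {R : realType} {n : nat} (G : lieGroupType R n).
Implicit Types (x y a : G) (X Y : 'rV[R]_n).
Local Notation V := 'rV[R]_n.
Local Notation c1 := (chart1 G).
Local Notation e := (crd (chart1 G) 1%g).
Local Notation chart_conj := (chart_conj G).
Local Notation conj_defined := (@conj_defined R n G).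

Lemma Ad_near Y : {near e, 'D_((0, Y) : V * V) chart_conj \o (fun u => (u, e))
  =1 (fun u => Y *m Ad (pt c1 u))}.
Proof. by apply: filterS (near_conj_defined_l G) => u /= H; rewrite Ad_derive. Qed.

Lemma Ad_diff Y : differentiable (fun u => Y *m Ad (pt c1 u)) e.
Proof.
have [ds _] := diff_slice1 0 (chart_conj_diff2 G Y).
exact: (near_eq_differentiable (Ad_near Y) ds).
Qed.

Lemma bracketE X Y : bracket G X Y = 'd (fun u => Y *m Ad (pt c1 u)) e X.
Proof. exact: (deriveE _ (Ad_diff Y)). Qed.

Lemma bracket_chart_conj X Y :
  bracket G X Y = 'd ('D_((0, Y) : V * V) chart_conj) (e, e) (X, 0).
Proof.
have [ds E] := diff_slice1 X (chart_conj_diff2 G Y).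
apply: (etrans (bracketE X Y)).
exact: (etrans (near_eq_diffE X (Ad_near Y) ds) E).
Qed.

Lemma bracketPl k X X' Y :
  bracket G (k *: X + X') Y = k *: bracket G X Y + bracket G X' Y.
Proof. by rewrite !bracketE linearP. Qed.

(** Linearity in the second argument is the linearity of Ad_a for each a. *)
Lemma bracketPr k X Y Y' :
  bracket G X (k *: Y + Y') = k *: bracket G X Y + bracket G X Y'.
Proof.
rewrite {1}/bracket.
rewrite (_ : (fun u => _) = (k \*: (fun u : V => Y *m Ad (pt c1 u))) +
                            (fun u => Y' *m Ad (pt c1 u))); last first.
  by apply/funext => u; rewrite mulmxDl -scalemxAl.
rewrite deriveD; last exact/diff_derivable/Ad_diff.
  by rewrite deriveZ //; exact/diff_derivable/Ad_diff.
exact/derivableZ/diff_derivable/Ad_diff.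
Qed.

(** Near the identity, conjugation by 1 is the identity of the chart. *)
Lemma Ad1 : Ad (1%g : G) = 1%:M.
Proof.
apply/row_matrixP => i; rewrite !rowE mulmx1 /Ad -deriveEjacobian; last exact: conj_diff.
rewrite -[RHS](derive_id e); apply: near_eq_derive.
by apply: filterS (chart_nearK (@dom_chart1 R n G)) => u [_]; rewrite mul1g invg1 mulg1.
Qed.

Lemma chart_conj_diag u : conj_defined (u, u) -> chart_conj (u, u) = u.
Proof. by move=> [[_ E] _ _ _ _]; rewrite /chart_conj /= mulgK. Qed.

Lemma chart_conj_1r u : chart_conj (u, e) = e.
Proof. by rewrite /chart_conj /= pt_chart1 mulg1 mulgV. Qed.

Lemma chart_conj_1l : \forall v \near e, chart_conj (e, v) = v.
Proof.
apply: filterS (chart_nearK (@dom_chart1 R n G)) => u [_].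
by rewrite /chart_conj /= pt_chart1 mul1g invg1 mulg1.
Qed.

Lemma near_conj_defined_r : \forall u \near e, \forall z \near (e, u), conj_defined z.
Proof.
have H := near_join (near_conj_defined G).
have c : (e, u) @[u --> e] --> ((e, e) : V *
  V) by exact: (@cvg_pair _ _ _ (nbhs e) (nbhs e) (nbhs e) _ _ _ (cst e) id (cvg_cst _) cvg_id).
exact: (c _ H).
Qed.

Lemma chart_conj_derive_1l X : \forall v \near e, 'D_((0, X) : V * V) chart_conj (e, v) = X.
Proof.
apply: filterS2 near_conj_defined_r (near_join chart_conj_1l) => v gz cv.
have dC := chart_conj_diff (nbhs_singleton gz) gz.
have [ds E] := diff_slice2 X dC.
rewrite (deriveE _ dC) -E -(deriveE _ ds) -[RHS](derive_id v).
exact: near_eq_derive.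
Qed.

(** Conjugation by the identity is linear in the chart, so that its second derivative in
    the second slot vanishes. *)
Lemma chart_conj_diff2_1l X : 'd ('D_((0, X) : V * V) chart_conj) (e, e) (0, X) = 0.
Proof.
have [ds E] := diff_slice2 X (chart_conj_diff2 G X).
rewrite -E.
have H : {near e, cst X =1 fun w => 'D_((0, X) : V * V) chart_conj (e, w)}.
  by apply: filterS (chart_conj_derive_1l X) => v /= ->.
apply: (etrans (near_eq_diffE X H (differentiable_cst X e))).
by rewrite diff_cst.
Qed.

(** The mean value theorem in the second slot: c(u, e) = e and c(u, u) = u for u = e + t
    X, so that the j-th coordinate of c(u, e + s X) increases by t X_j when s runs from 0
    to t. *)
Lemma chart_conj_MVT X t j : 0 < t ->
  (forall s, 0 <= s <= t -> \forall z \near ((e + t *: X, e + s *: X) : V * V),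
    conj_defined z) ->
  exists2 s, 0 < s < t &
    ('D_((0, X) : V * V) chart_conj (e + t *: X, e + s *: X)) 0 j = X 0 j.
Proof.
move=> t0 H.
pose gam (s : R) : V * V := (e + t *: X, e + s *: X).
pose g2 (s : R) : V := e + s *: X.
have d2 (s : R) : is_diff s g2 ((0 : R -> V) + ( *:%R^~ X : R -> V)).
  exact: (is_diffD (is_diff_cst e s) (is_diff_scalel s X)).
have dg2 (s : R) : differentiable g2 s by apply: (@ex_diff _ _ _ _ _ _ _ (d2 s)).
have dg (s : R) : differentiable gam s.
  exact: (differentiable_pair (differentiable_cst (e + t *: X) s) (dg2 s)).
have Dg (s : R) : 'd gam s 1 = (0, X).
  have E := diff_pairE (1 : R) (differentiable_cst (e + t *: X) s) (dg2 s).
  apply: (etrans E).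
  congr pair; first by rewrite diff_cst.
  by rewrite (@diff_val _ _ _ _ _ _ _ (d2 s)) fctE /= scale1r add0r.
pose f (s : R) : R := chart_conj (gam s) 0 j.
have dC s : 0 <= s <= t -> differentiable chart_conj (gam s).
  by move=> /H gz; exact: (chart_conj_diff (nbhs_singleton gz) gz).
have df s : 0 <= s <= t -> differentiable f s.
  by move=> /dC dCs; exact: (coord_comp_diff 0 j (differentiable_comp (dg s) dCs)).
have df2 s : 0 <= s <= t ->
    is_derive s 1 f (('D_((0, X) : V * V) chart_conj (gam s)) 0 j).
  move=> st; apply: DeriveDef; first exact/diff_derivable/df.
  have dcg := differentiable_comp (dg s) (dC s st).
  have -> : 'D_1 f s = ('D_1 (chart_conj \o gam) s) 0 j.
    by rewrite (derive_mx (diff_derivable dcg)) mxE.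
  apply: (congr1 (fun w : V => w 0 j)).
  rewrite (deriveE _ dcg) (deriveE _ (dC s st)) -(Dg s).
  exact: (diff_compE _ (dg s) (dC s st)).
have [||s st] := MVT t0 (df := fun s => ('D_((0, X) : V *
  V) chart_conj (gam s)) 0 j) (f := f).
- by move=> s; rewrite in_itv /= => /andP[s0 s1]; apply: df2; rewrite !ltW.
- apply: derivable_within_continuous => s; rewrite in_itv /= => st.
  exact/diff_derivable/df.
move=> E; exists s; first by move: st; rewrite in_itv.
have ge : conj_defined (gam t) by apply: nbhs_singleton; apply: H; rewrite lexx ltW.
move: E; rewrite /f /gam scale0r addr0 chart_conj_1r chart_conj_diag // subr0 !mxE addrAC subrr add0r.
by rewrite mulrC => /mulIf -> //; exact: lt0r_neq0.
Qed.

(** By the mean value theorem, the derivative of c in the second slot along X takes the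
    value X in the j-th coordinate at some point (e + t X, e + s X) with 0 < s < t.
    Expanding it to first order at (e, e), its increment is t [X, X] + s d_2 + o(t), where
    d_2 is the second derivative in the second slot, which is zero. Hence t [X, X]_j =
    o(t). *)
Lemma bracketXX X : bracket G X X = 0.
Proof.
apply/rowP => j; rewrite [RHS]mxE; apply/eqP; apply: contraT => B0.
set b := bracket G X X 0 j in B0.
pose N := 'D_((0, X) : V * V) chart_conj.
(* Half of |b| / |X|, with 1 added as X may be zero. *)
pose eps := `|b| / (2 * (`|X| + 1)).
have X1 : 0 < `|X| + 1 by rewrite ltr_wpDl.
have b0 : 0 < `|b| by rewrite normr_gt0.
have eps0 : 0 < eps by rewrite divr_gt0 // mulr_gt0.
have /eqaddoP/(_ _ eps0) := diff_locally (chart_conj_diff2 G X).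
move=> /nbhs_ballP[d1 /= d10 H1].
have /nbhs_ballP[d2 /= d20 H2] := near_join (near_conj_defined G).
pose d := Num.min d1 d2.
have d0 : 0 < d by rewrite lt_min d10 d20.
pose t := d / (2 * (`|X| + 1)).
have t0 : 0 < t by rewrite divr_gt0 // mulr_gt0.
have tX : t * `|X| < d.
  rewrite /t mulrAC ltr_pdivrMr ?mulr_gt0 // ltr_pM2l //; lra.
have sX s : 0 <= s <= t -> `|s *: X| < d.
  move=> /andP[s0 st]; apply: le_lt_trans tX.
  by rewrite normrZ ger0_norm // ler_wpM2r.
have nrm s : 0 <= s <= t -> `|((t *: X, s *: X) : V * V)| < d.
  by move=> st; rewrite prod_normE /= gt_max !sX // lexx ltW.
(* The points (e + t X, e + s X) with 0 <= s <= t are within the radii d1 and d2. *)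
have [] := @chart_conj_MVT X t j t0.
  move=> s st; apply: H2; rewrite -ball_normE /=.
  rewrite (_ : _ - _ = - ((t *: X, s *: X) : V * V)); last first.
    by congr pair; rewrite /= opprD addrA subrr add0r.
  by rewrite normrN; apply: lt_le_trans (nrm _ st) _; rewrite ge_min lexx orbT.
move=> s /andP[s0 st] Es.
have st' : 0 <= s <= t by rewrite !ltW.
have := H1 (t *: X, s *: X).
rewrite -ball_normE /= sub0r normrN => /(_ _)/wrap[].
  by apply: lt_le_trans (nrm _ st') _; rewrite ge_min lexx.
rewrite !fctE /=.
have -> : ((t *: X, s *: X) : V * V) + (e, e) = (e + t *: X, e + s *: X).
  by congr pair; rewrite /= addrC.
rewrite (nbhs_singleton (chart_conj_derive_1l X)).
have E : 'd ('D_((0, X) : V * V) chart_conj) (e, e) (t *: X, s *: X) = t *: bracket G X X.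
  have Exy : ((t *: X, s *: X) : V * V) = t *: ((X, 0) : V * V) + s *: ((0, X) : V * V).
    by congr pair; rewrite /= scaler0 ?addr0 ?add0r.
  apply: (etrans (congr1 _ Exy)).
  apply: (etrans (linearP ('d ('D_((0, X) : V * V) chart_conj) (e, e)) t (X, 0) _)).
  apply: (etrans (congr2 +%R (congr1 _ (esym (bracket_chart_conj X X))) (linearZ _ _))).
  by apply: (etrans (congr2 +%R erefl (congr1 _ (chart_conj_diff2_1l X))));
    rewrite /= scaler0 addr0.
rewrite E => Hle.
have := le_trans (ler_coord_norm _ 0 j) Hle.
rewrite !mxE Es opprD addrA subrr add0r normrN normrM (gtr0_norm t0) -/b.
have ntX : `|((t *: X, s *: X) : V * V)| <= t * `|X|.
  have nX (r : R) : 0 < r -> `|r *: X| = r * `|X| by move=> r0; rewrite normrZ gtr0_norm.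
  by rewrite prod_normE /= ge_max (nX t t0) (nX s s0) lexx ler_wpM2r // ltW.
move=> Hb; have {}Hb := le_trans Hb (ler_wpM2l (ltW eps0) ntX).
move: Hb; rewrite mulrCA ler_pM2l // /eps => Hb.
suff : `|b| / (2 * (`|X| + 1)) * `|X| < `|b| by rewrite ltNge Hb.
rewrite mulrAC ltr_pdivrMr ?mulr_gt0 // ltr_pM2l //.
have := normr_ge0 X; lra.
Qed.

Lemma bracketDl X X' Y : bracket G (X + X') Y = bracket G X Y + bracket G X' Y.
Proof. by have := bracketPl 1 X X' Y; rewrite !scale1r. Qed.

Lemma bracketDr X Y Y' : bracket G X (Y + Y') = bracket G X Y + bracket G X Y'.
Proof. by have := bracketPr 1 X Y Y'; rewrite !scale1r. Qed.

Lemma bracketC X Y : bracket G X Y = - bracket G Y X.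
Proof.
have := bracketXX (X + Y); rewrite bracketDl !bracketDr !bracketXX add0r addr0.
by move=> /eqP; rewrite addr_eq0 => /eqP.
Qed.

End Bracket.

(** * Invariance of the inner product under Ad, differentiated *)

Section InnerProductDerivative.
Variables (R : realType) (U : normedModType R) (n : nat) (Q : 'M[R]_n).
Local Notation V := 'rV[R]_n.

Definition ip (X Y : V) : R := (X *m Q *m Y^T) 0 0.

Lemma ipE X Y : ip X Y = \sum_i \sum_j X 0 i * Q i j * Y 0 j.
Proof.
rewrite /ip mxE exchange_big; apply: eq_bigr => j _.
by rewrite !mxE mulr_suml; apply: eq_bigr.
Qed.

Lemma derive_coord (a : U -> V) x v i : derivable a x v ->
  is_derive x v (fun u => a u 0 i) ('D_v a x 0 i).
Proof.
move=> da; apply: DeriveDef; first exact: ((derivable_mxP a x v).1 da).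
by rewrite (derive_mx da) mxE.
Qed.

Lemma derive_ip (a b : U -> V) x v : derivable a x v -> derivable b x v ->
  'D_v (fun u => ip (a u) (b u)) x = ip ('D_v a x) (b x) + ip (a x) ('D_v b x).
Proof.
move=> da db.
have -> : (fun u => ip (a u) (b u)) =
    \sum_i \sum_j (Q i j \*: ((fun u => a u 0 i) * (fun u => b u 0 j))).
  apply/funext => u; rewrite ipE fct_sumE; apply: eq_bigr => i _.
  rewrite fct_sumE; apply: eq_bigr => j _ /=.
  rewrite -[RHS]/(Q i j * (a u 0 i * b u 0 j)); ring.
have dij i j : is_derive x v (Q i j \*: ((fun u => a u 0 i) * (fun u => b u 0 j)))
   (Q i j * (a x 0 i * 'D_v b x 0 j + b x 0 j * 'D_v a x 0 i)).
  apply: is_deriveZ; apply: is_deriveM; exact: derive_coord.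
have di i := is_derive_sum (dij i).
rewrite (@derive_val _ _ _ _ _ _ _ (is_derive_sum di)).
rewrite !ipE -big_split; apply: eq_bigr => i _ /=.
rewrite -big_split; apply: eq_bigr => j _ /=; ring.
Qed.

Lemma derive_mulmx m (C : 'M[R]_(n, m)) (a : U -> V) x v : derivable a x v ->
  'D_v (fun u => a u *m C) x = 'D_v a x *m C.
Proof.
move=> da.
have dj j : is_derive x v (fun u => (a u *m C) 0 j) (('D_v a x *m C) 0 j).
  have -> : (fun u => (a u *m C) 0 j) = \sum_i (C i j \*: (fun u => a u 0 i)).
    apply/funext => u; rewrite mxE fct_sumE; apply: eq_bigr => i _.
    by rewrite mulrC.
  have di i : is_derive x v (C i j \*: (fun u => a u 0 i)) (C i j *: 'D_v a x 0 i).
    by apply: is_deriveZ; exact: derive_coord.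
  apply: (is_derive_eq (is_derive_sum di)).
  by rewrite mxE; apply: eq_bigr => i _; rewrite [RHS]mulrC.
have dC : derivable (fun u => a u *m C) x v.
  by apply/derivable_mxP => i j; rewrite ord1; apply: (@ex_derive _ _ _ _ _ _ _ (dj j)).
by rewrite (derive_mx dC); apply/rowP => j; rewrite mxE (@derive_val _ _ _ _ _ _ _ (dj j)).
Qed.
End InnerProductDerivative.

Section AdSkew.
Context {R : realType} {n : nat} (G : lieGroupType R n) (Q : 'M[R]_n).
Hypothesis Qbi : biinvariant G Q.
Local Notation c1 := (chart1 G).
Local Notation e := (crd (chart1 G) 1%g).

Lemma ip_Ad a X Y : ip Q (X *m Ad (a : G)) (Y *m Ad a) = ip Q X Y.
Proof.
case: Qbi => _ _ H; rewrite /ip trmx_mul !mulmxA -[in RHS](H a).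
by rewrite !mulmxA.
Qed.

(** The derivative at 1 of the constant function Q(Ad_a X, Ad_a Y). *)
Lemma bracket_skew Z X Y :
  ip Q (bracket G Z X) Y = - ip Q X (bracket G Z Y).
Proof.
have dX := diff_derivable (v := Z) (Ad_diff G X).
have dY := diff_derivable (v := Z) (Ad_diff G Y).
have := derive_ip Q dX dY.
rewrite (_ : (fun u => ip Q _ _) = cst (ip Q X Y)); last first.
  by apply/funext => u; rewrite ip_Ad.
rewrite derive_cst pt_chart1 Ad1 !mulmx1 => /esym/eqP.
by rewrite addr_eq0 => /eqP.
Qed.
End AdSkew.

(** * Homomorphisms of Lie groups and the adjoint action *)

Section SubgroupCalculus.
Context {R : realType} {d n : nat} (L : lieGroupType R d) (G : lieGroupType R n).
Variable f : L -> G.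
Hypothesis fm : lie_morphism f.
Local Notation cL := (chart1 L).
Local Notation c1 := (chart1 G).
Local Notation eL := (crd (chart1 L) 1%g).
Local Notation e := (crd (chart1 G) 1%g).

Lemma morph1 : f 1%g = 1%g.
Proof.
case: fm => fM _ _.
by have := fM 1%g 1%g; rewrite mulg1 => E; have := mulKg (f 1%g) (f 1%g); rewrite -E mulVg.
Qed.

Lemma morphV x : f x^-1%g = (f x)^-1%g.
Proof.
case: fm => fM _ _.
by have := fM x^-1%g x; rewrite mulVg morph1 => E; rewrite -[LHS](mulgK (f x)) -E mul1g.
Qed.

Definition morph_chart (u : 'rV[R]_d) : 'rV[R]_n := crd c1 (f (pt cL u)).

Lemma morph_chart1 : morph_chart eL = e.
Proof. by rewrite /morph_chart pt_chart1 morph1. Qed.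

Lemma morph_chart_diff : differentiable morph_chart eL.
Proof.
case: fm => _ _ H.
have [Hd _] := H cL c1 (@atlas_chart1 _ _ L) (@atlas_chart1 _ _ G) 1%N.
apply: Hd; split; first by exists 1%g => //; exact: dom_chart1.
by rewrite pt_chart1 morph1; exact: dom_chart1.
Qed.

Lemma near_morph_chart : \forall u \near eL, pt c1 (morph_chart u) = f (pt cL u).
Proof.
case: fm => _ fc _.
have c : f (pt cL u) @[u --> eL] --> f 1%g.
  by apply: cvg_comp (pt_cvg (@dom_chart1 _ _ L)) _; exact: fc.
have d1 : dom c1 (f 1%g) by rewrite morph1; exact: dom_chart1.
have H : \forall u \near eL, dom c1 (f (pt cL u)) := c _ (near_dom d1).
by apply: filterS H => u du; rewrite crdK.
Qed.

Lemma lie_diffE Z : Z *m lie_diff f = 'd morph_chart eL Z.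
Proof. by rewrite -(deriveE _ morph_chart_diff) (deriveEjacobian _ morph_chart_diff). Qed.

(** [X, Y] is the derivative of Ad_(f b) Y along a curve b with velocity X. This curve
    stays in p, and a linear subspace contains the derivatives of its curves. *)
Lemma bracket_stable m (p : 'M[R]_(m, n)) X Y :
  (forall b, (p *m Ad (f b) <= p)%MS) -> (X <= lie_diff f)%MS -> (Y <= p)%MS ->
  (bracket G X Y <= p)%MS.
Proof.
move=> ps /submxP[Z ->] Yp; rewrite lie_diffE bracketE.
have dA : differentiable (fun u => Y *m Ad (pt c1 u)) (morph_chart eL).
  by rewrite morph_chart1; exact: Ad_diff.
have E := diff_compE Z morph_chart_diff dA; rewrite -[e in X in (X <= _)%MS]morph_chart1.
have H : {near eL, (fun u => Y *m Ad (pt c1 (morph_chart u))) =1 (fun u => Y *m Ad (f (pt cL u)))}.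
  by apply: filterS near_morph_chart => u ->.
have dAl := differentiable_comp morph_chart_diff dA.
have dA2 := near_eq_differentiable H dAl.
rewrite -E -(near_eq_diffE Z H dAl) -(deriveE _ dA2).
rewrite submxE -(derive_mulmx _ (diff_derivable (v := Z) dA2)).
rewrite (_ : (fun u => _) = cst 0) ?derive_cst //; apply/funext => u /=; apply/eqP.
rewrite -submxE; apply: submx_trans (ps _); exact: submxMr.
Qed.

(** The differential at 1 of the identity f (b v b^-1) = f b (f v) (f b)^-1. *)
Lemma lie_diff_Ad b : lie_diff f *m Ad (f b) = Ad b *m lie_diff f.
Proof.
apply/row_matrixP => i; rewrite !rowE !mulmxA.
set Z := delta_mx 0 i; rewrite !lie_diffE.
pose cL' (u : 'rV[R]_d) := crd cL (b * pt cL u * b^-1)%g.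
pose cG' (u : 'rV[R]_n) := crd c1 (f b * pt c1 u * (f b)^-1)%g.
have dcL : differentiable cL' eL by exact: conj_diff.
have dcG : differentiable cG' (morph_chart eL) by rewrite morph_chart1; exact: conj_diff.
have cLe : cL' eL = eL by rewrite /cL' pt_chart1 mulg1 mulgV.
have dl : differentiable morph_chart (cL' eL) by rewrite cLe; exact: morph_chart_diff.
have E1 : Z *m Ad b = 'd cL' eL Z.
  by rewrite -(deriveE _ dcL) (deriveEjacobian _ dcL).
have E2 : 'd morph_chart eL Z *m Ad (f b) = 'd cG' (morph_chart eL) ('d morph_chart eL Z).
  by rewrite -(deriveE _ dcG) (deriveEjacobian _ dcG) morph_chart1.
rewrite E1 E2; have D1 := diff_compE Z morph_chart_diff dcG.
have D2 := diff_compE Z dcL dl.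
have dd : differentiable (fun u => morph_chart (cL' u)) eL := differentiable_comp dcL dl.
suff H : {near eL, (fun u => morph_chart (cL' u)) =1 (fun u => cG' (morph_chart u))}.
  have D3 := near_eq_diffE Z H dd.
  have D4 := congr1 (fun p => 'd morph_chart p ('d cL' eL Z)) cLe.
  exact: (etrans (esym D1) (etrans D3 (etrans D2 D4))).
have dL1 : dom cL (b * 1 * b^-1)%g by rewrite mulg1 mulgV; exact: dom_chart1.
have c : (b * pt cL u * b^-1)%g @[u --> eL] --> (b * 1 * b^-1)%g.
  have c0 : (b * pt cL u)%g @[u --> eL] --> (b * 1)%g.
    exact: (mulg_cvg (cvg_cst b) (pt_cvg (@dom_chart1 _ _ L))).
  exact: (mulg_cvg c0 (cvg_cst b^-1%g)).
have H : \forall u \near eL, dom cL (b * pt cL u * b^-1)%g := c _ (near_dom dL1).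
apply: filterS2 near_morph_chart H => u lu du; apply/esym.
case: fm => fM _ _.
by rewrite /cG' lu /morph_chart /cL' crdK // !fM morphV.
Qed.

End SubgroupCalculus.

(** * Bilinear forms on a subspace *)

Section InnerProduct.
Variables (R : realType) (n : nat) (Q : 'M[R]_n).
Implicit Types X Y Z : 'rV[R]_n.

Lemma ipDl X X' Y : ip Q (X + X') Y = ip Q X Y + ip Q X' Y.
Proof. by rewrite /ip !mulmxDl mxE. Qed.
Lemma ipZl k X Y : ip Q (k *: X) Y = k * ip Q X Y.
Proof. by rewrite /ip -!scalemxAl mxE. Qed.
Lemma ipDr X Y Y' : ip Q X (Y + Y') = ip Q X Y + ip Q X Y'.
Proof. by rewrite /ip linearD /= mulmxDr mxE. Qed.
Lemma ipZr k X Y : ip Q X (k *: Y) = k * ip Q X Y.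
Proof. by rewrite /ip linearZ /= -scalemxAr mxE. Qed.
Lemma ip0l Y : ip Q 0 Y = 0. Proof. by rewrite /ip !mul0mx mxE. Qed.
Lemma ipNl X Y : ip Q (- X) Y = - ip Q X Y.
Proof. by rewrite -scaleN1r ipZl mulN1r. Qed.
Lemma ipNr X Y : ip Q X (- Y) = - ip Q X Y.
Proof. by rewrite -scaleN1r ipZr mulN1r. Qed.
Lemma ip_suml (I : Type) (r : seq I) (P : pred I) (F : I -> 'rV[R]_n) Y :
  ip Q (\sum_(i <- r | P i) F i) Y = \sum_(i <- r | P i) ip Q (F i) Y.
Proof. by apply: (big_morph (fun X => ip Q X Y)) => [X X'|]; rewrite ?ipDl ?ip0l. Qed.
Lemma ipC : Q^T = Q -> forall X Y, ip Q X Y = ip Q Y X.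
Proof.
move=> QT X Y; rewrite /ip -[in LHS](trmxK (X *m Q *m Y^T)) mxE !trmx_mul trmxK QT.
by rewrite mulmxA.
Qed.
End InnerProduct.

Section Forms.
Context {R : realType} {n : nat} {p : 'M[R]_n}.
Implicit Types (X Y Z : 'rV[R]_n) (g : 'M[R]_(\rank p)).

Definition coords X : 'rV[R]_(\rank p) := X *m pinvmx (row_base p).

Lemma coordsE X : (X <= p)%MS -> X = \sum_i coords X 0 i *: bvec i.
Proof.
by move=> Xp; rewrite -mulmx_sum_row mulmxKpV // eq_row_base.
Qed.

Lemma coords_row (u : 'rV[R]_(\rank p)) : coords (u *m row_base p) = u.
Proof. by rewrite /coords mulmxKp // row_base_free. Qed.

Lemma coords_bvec i : coords (bvec i) = delta_mx 0 i.
Proof. by rewrite /bvec rowE coords_row. Qed.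

Lemma bvec_sub (i : 'I_(\rank p)) : (bvec i <= p)%MS.
Proof. by rewrite /bvec (submx_trans (row_sub _ _)) // eq_row_base. Qed.

Lemma coordsP k X Y : coords (k *: X + Y) = k *: coords X + coords Y.
Proof. by rewrite /coords mulmxDl scalemxAl. Qed.

Lemma form_ip g X Y : form g X Y = ip g (coords X) (coords Y).
Proof. by []. Qed.

Lemma form_bvec g i j : form g (bvec i) (bvec j) = g i j.
Proof. by rewrite form_ip !coords_bvec /ip -rowE trmx_delta -colE !mxE. Qed.

Lemma formDl g X X' Y : form g (X + X') Y = form g X Y + form g X' Y.
Proof. by rewrite !form_ip -[X]scale1r coordsP scale1r ipDl scale1r. Qed.
Lemma formZl g k X Y : form g (k *: X) Y = k * form g X Y.
Proof. by rewrite !form_ip -ipZl /coords -scalemxAl. Qed.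
Lemma formDr g X Y Y' : form g X (Y + Y') = form g X Y + form g X Y'.
Proof. by rewrite !form_ip -[Y]scale1r coordsP scale1r ipDr scale1r. Qed.
Lemma formZr g k X Y : form g X (k *: Y) = k * form g X Y.
Proof. by rewrite !form_ip -ipZr /coords -scalemxAl. Qed.
Lemma form0l g Y : form g 0 Y = 0.
Proof. by rewrite -(scale0r 0) formZl mul0r. Qed.
Lemma form0r g Y : form g Y 0 = 0.
Proof. by rewrite -(scale0r 0) formZr mul0r. Qed.
Lemma formNl g X Y : form g (- X) Y = - form g X Y.
Proof. by rewrite -scaleN1r formZl mulN1r. Qed.
Lemma form_suml g (I : Type) (r : seq I) (P : pred I) (F : I -> 'rV[R]_n) Y :
  form g (\sum_(i <- r | P i) F i) Y = \sum_(i <- r | P i) form g (F i) Y.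
Proof.
by apply: (big_morph (fun X => form g X Y)) => [X X'|]; rewrite ?formDl ?form0l.
Qed.
Lemma form_sumr g (I : Type) (r : seq I) (P : pred I) (F : I -> 'rV[R]_n) Y :
  form g Y (\sum_(i <- r | P i) F i) = \sum_(i <- r | P i) form g Y (F i).
Proof.
by apply: (big_morph (fun X => form g Y X)) => [X X'|]; rewrite ?formDr ?form0r.
Qed.

Lemma form_eq g g' :
  (forall i j : 'I_(\rank p), form g (bvec i) (bvec j) = form g' (bvec i) (bvec j)) -> g =
    g'.
Proof. by move=> H; apply/matrixP => i j; rewrite -!form_bvec. Qed.
End Forms.

(** * Orthogonal frames *)

Section OrthogonalFamily.
Context {R : realType} {n : nat} {p : 'M[R]_n} (Q : 'M[R]_n).
Context {I : finType} (P : pred I) (E : I -> 'rV[R]_n).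
Implicit Types (X Y Z : 'rV[R]_n) (g T : 'M[R]_(\rank p)) (x : I -> R).

(** The predicate P selects the part of the family which is a basis of p, so that one
    family can serve several subspaces. *)
Definition orthonormal_frame : Prop :=
  [/\ forall a, P a -> (E a <= p)%MS,
      forall a b, P a -> P b -> ip Q (E a) (E b) = (a == b)%:R
    & forall X, (X <= p)%MS -> X = \sum_(a | P a) ip Q X (E a) *: E a].

Definition diagonal g x : Prop :=
  forall a b, P a -> P b -> form g (E a) (E b) = x a *+ (a == b).

Hypothesis onb : orthonormal_frame.

Lemma parseval X Y : (X <= p)%MS ->
  ip Q X Y = \sum_(a | P a) ip Q X (E a) * ip Q (E a) Y.
Proof.
case: onb => _ _ sp Xp; rewrite {1}(sp X Xp) ip_suml.
by apply: eq_bigr => a _; rewrite ipZl.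
Qed.

Lemma form_diagonal g x X b : diagonal g x -> P b -> (X <= p)%MS ->
  form g X (E b) = x b * ip Q X (E b).
Proof.
case: onb => _ _ sp dg Pb Xp; rewrite {1}(sp X Xp) form_suml (bigD1 b) //=.
rewrite big1 => [|a /andP[Pa ab]].
  by rewrite addr0 formZl (dg b b Pb Pb) eqxx mulr1n mulrC.
by rewrite formZl (dg a b Pa Pb) (negPf ab) mulr0n mulr0.
Qed.

Lemma form_diagonalE g x X Y : diagonal g x -> (X <= p)%MS -> (Y <= p)%MS ->
  form g X Y = \sum_(a | P a) x a * ip Q X (E a) * ip Q Y (E a).
Proof.
case: onb => _ _ sp dg Xp Yp; rewrite {1}(sp Y Yp) form_sumr.
apply: eq_bigr => a Pa; rewrite formZr (form_diagonal dg Pa Xp); ring.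
Qed.

Section Inverse.
Variables (g : 'M[R]_(\rank p)) (x : I -> R).
Hypotheses (dg : diagonal g x) (x0 : forall a, P a -> x a != 0).

(** The sum on the right is inverse to g, as one sees by expanding the basis vectors of p
    in the frame. *)
Lemma diagonal_invmx i j :
  invmx g i j = \sum_(a | P a) (x a)^-1 *
    (coords (p := p) (E a) 0 i * coords (p := p) (E a) 0 j).
Proof.
pose N : 'M[R]_(\rank p) := \matrix_(i, j)
  \sum_(a | P a) (x a)^-1 * (coords (p := p) (E a) 0 i * coords (p := p) (E a) 0 j).
case: onb => Ep _ sp.
suff NI : N *m g = 1%:M.
  have [_ gU] := mulmx1_unit NI.
  have -> : invmx g = N by rewrite -[LHS]mul1mx -NI -mulmxA mulmxV // mulmx1.
  by rewrite mxE.
apply/matrixP => k l; rewrite !mxE.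
have -> : (k == l)%:R = coords (bvec l) 0 k :> R.
  by rewrite coords_bvec mxE eqxx.
transitivity (\sum_(a | P a) ip Q (bvec l) (E a) * coords (p := p) (E a) 0 k); last first.
  rewrite {2}(sp _ (bvec_sub l)).
  rewrite /coords mulmx_suml summxE; apply: eq_bigr => a _.
  by rewrite -scalemxAl [RHS]mxE.
under eq_bigr do rewrite mxE mulr_suml.
rewrite exchange_big; apply: eq_bigr => a Pa /=.
transitivity ((x a)^-1 * coords (p := p) (E a) 0 k * form g (E a) (bvec l)).
  rewrite form_ip coords_bvec /ip trmx_delta -colE !mxE mulr_sumr.
  by apply: eq_bigr => i1 _; rewrite !mulrA.
have -> : form g (E a) (bvec l) = x a * ip Q (bvec l) (E a).
  rewrite -(form_diagonal dg Pa (bvec_sub l)).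
  rewrite !(form_diagonalE dg) ?bvec_sub ?Ep //.
  by apply: eq_bigr => b _; rewrite mulrAC.
by rewrite mulrA [X in X * _]mulrAC mulVf ?x0 // mul1r mulrC.
Qed.

(** The contraction of a bilinear form with the inverse metric does not depend on the
    basis. *)
Lemma sum_invmx (B : 'rV[R]_n -> 'rV[R]_n -> R) :
  (forall Y, scalar (fun X => B X Y)) -> (forall X, scalar (B X)) ->
  \sum_i \sum_k invmx g i k * B (bvec i) (bvec k) =
  \sum_(a | P a) (x a)^-1 * B (E a) (E a).
Proof.
move=> Bl Br.
have B_sum (F : 'I_(\rank p) -> R) (v : 'I_(\rank p) -> 'rV[R]_n) Y :
    B (\sum_i F i *: v i) Y = \sum_i F i * B (v i) Y.
  have BD X X' : B (X + X') Y = B X Y + B X' Y.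
    by have := Bl Y 1 X X'; rewrite scale1r mul1r.
  have B0 : B 0 Y = 0 by have := BD 0 0; rewrite addr0 => /eqP;
    rewrite eq_sym -subr_eq0 addrK => /eqP.
  have BZ k X : B (k *: X) Y = k * B X Y by have := Bl Y k X 0; rewrite !addr0 B0 addr0.
  by rewrite (big_morph (fun X => B X Y) BD B0); apply: eq_bigr => i _; rewrite BZ.
have B_sumr (F : 'I_(\rank p) -> R) (v : 'I_(\rank p) -> 'rV[R]_n) Y :
    B Y (\sum_i F i *: v i) = \sum_i F i * B Y (v i).
  have BD X X' : B Y (X + X') = B Y X + B Y X'.
    by have := Br Y 1 X X'; rewrite scale1r mul1r.
  have B0 : B Y 0 = 0 by have := BD 0 0; rewrite addr0 => /eqP;
    rewrite eq_sym -subr_eq0 addrK => /eqP.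
  have BZ k X : B Y (k *: X) = k * B Y X by have := Br Y k X 0; rewrite !addr0 B0 addr0.
  by rewrite (big_morph (B Y) BD B0); apply: eq_bigr => i _; rewrite BZ.
case: onb => Ep _ _.
transitivity (\sum_(a | P a) \sum_i \sum_k (x a)^-1 *
   (coords (p := p) (E a) 0 i * coords (p := p) (E a) 0 k) * B (bvec i) (bvec k)).
  rewrite [RHS]exchange_big; apply: eq_bigr => i _ /=.
  rewrite [RHS]exchange_big; apply: eq_bigr => k _ /=.
  by rewrite diagonal_invmx mulr_suml.
apply: eq_bigr => a Pa.
rewrite [in RHS](coordsE (Ep a Pa)) B_sum mulr_sumr; apply: eq_bigr => i _.
rewrite B_sumr !mulr_sumr; apply: eq_bigr => k _; ring.
Qed.

Lemma trace_form_diagonal T :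
  trace_form T g = \sum_(a | P a) (x a)^-1 * form T (E a) (E a).
Proof.
rewrite /trace_form -(sum_invmx (B := fun X Y => form T Y X)).
- by apply: eq_bigr => i _; rewrite mxE; apply: eq_bigr => k _; rewrite form_bvec.
- by move=> Y k X X'; rewrite formDr formZr.
- by move=> Y k X X'; rewrite formDl formZl.
Qed.

Lemma sharp_diagonal (l : 'rV[R]_n -> R) : scalar l ->
  sharp g l = \sum_(a | P a) ((x a)^-1 * l (E a)) *: E a.
Proof.
move=> trace_quad; apply/rowP => j; rewrite [RHS]summxE.
transitivity (\sum_(a | P a) (x a)^-1 * (l (E a) * E a 0 j)); last first.
  by apply: eq_bigr => a _; rewrite mxE mulrA.
rewrite -(sum_invmx (B := fun X Y => l X * Y 0 j)).
- rewrite summxE; apply: eq_bigr => i _; rewrite summxE; apply: eq_bigr => k _.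
  by rewrite mxE mulrA.
- by move=> Y k X X'; rewrite trace_quad; ring.
- by move=> X k Y Y'; rewrite !mxE; ring.
Qed.
End Inverse.
End OrthogonalFamily.


Section RestrictedForm.
Context {R : realType} {n : nat}.

(** A form on p is determined by its Gram matrix, and B is only ever evaluated on p. *)
Lemma form_ext (p : 'M[R]_n) (g : 'M[R]_(\rank p)) (B : 'rV[R]_n -> 'rV[R]_n -> R) :
  (forall i j : 'I_(\rank p), form g (bvec i) (bvec j) = B (bvec i) (bvec j)) ->
  (forall Y, scalar (fun X => B X Y)) -> (forall X, scalar (B X)) ->
  forall X Y, (X <= p)%MS -> (Y <= p)%MS -> form g X Y = B X Y.
Proof.
move=> gB Bl Br X Y Xp Yp.
have B0l Z : B 0 Z = 0.
  by have := Bl Z 1 0 0; rewrite scale1r mul1r addr0 => /eqP;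
    rewrite -subr_eq0 opprD addrA subrr sub0r oppr_eq0 => /eqP.
have B0r Z : B Z 0 = 0.
  by have := Br Z 1 0 0; rewrite scale1r mul1r addr0 => /eqP;
    rewrite -subr_eq0 opprD addrA subrr sub0r oppr_eq0 => /eqP.
have BDl Z X1 X2 : B (X1 + X2) Z = B X1 Z + B X2 Z.
  by have := Bl Z 1 X1 X2; rewrite scale1r mul1r.
have BDr Z X1 X2 : B Z (X1 + X2) = B Z X1 + B Z X2.
  by have := Br Z 1 X1 X2; rewrite scale1r mul1r.
have BZl c Z X1 : B (c *: X1) Z = c * B X1 Z.
  by have := Bl Z c X1 0; rewrite addr0 B0l addr0.
have BZr c Z X1 : B Z (c *: X1) = c * B Z X1.
  by have := Br Z c X1 0; rewrite addr0 B0r addr0.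
rewrite (coordsE Xp) (coordsE Yp) form_suml.
rewrite [RHS](big_morph (fun X => B X _) (BDl _) (B0l _)); apply: eq_bigr => i _.
rewrite form_sumr [RHS](big_morph (B _) (BDr _) (B0r _)); apply: eq_bigr => j _.
by rewrite formZl formZr BZl BZr gB.
Qed.

Lemma form_restr (p q : 'M[R]_n) (T : 'M[R]_(\rank p)) X Y :
  (X <= q)%MS -> (Y <= q)%MS -> form (restr q T) X Y = form T X Y.
Proof.
apply: form_ext => [i j|Z k X1 X2|Z k X1 X2].
- by rewrite form_bvec mxE.
- by rewrite formDl formZl.
- by rewrite formDr formZr.
Qed.

Lemma form_sym (p : 'M[R]_n) (g : 'M[R]_(\rank p)) X Y : g^T = g -> form g X Y = form g Y X.
Proof. by move=> gT; rewrite !form_ip (ipC gT). Qed.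
End RestrictedForm.

(** * Orthogonal complements and Lie subgroups *)

Section QOrthogonal.
Context {R : realType} {n : nat} {G : lieGroupType R n} (Q : 'M[R]_n).
Hypothesis Qbi : biinvariant G Q.

Lemma qcomplP (k : 'M[R]_n) X :
  reflect (forall Z, (Z <= k)%MS -> ip Q X Z = 0) (X <= qcompl Q k)%MS.
Proof.
apply: (iffP sub_kermxP) => [X0 Z /submxP[W ->]|X0].
  by rewrite /ip trmx_mul !mulmxA -(mulmxA X) X0 mul0mx mxE.
apply/rowP => j; rewrite [RHS]mxE -(X0 (row j k) (row_sub j k)).
by rewrite /ip mulmxA !mxE; apply: eq_bigr => l _; rewrite !mxE.
Qed.

Lemma ip_pos X : X != 0 -> 0 < ip Q X X.
Proof. by case: Qbi => _ + _; apply. Qed.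

Lemma ip_sym X Y : ip Q X Y = ip Q Y X.
Proof. by apply: ipC; case: Qbi. Qed.

Lemma orth_cap (k q : 'M[R]_n) :
  (forall X Y, (X <= k)%MS -> (Y <= q)%MS -> ip Q X Y = 0) -> (k :&: q)%MS = 0.
Proof.
move=> kq; apply/eqP; rewrite -submx0; apply/row_subP => i.
set X := row i _; have Xk : (X <= k)%MS by rewrite (submx_trans (row_sub _ _)) ?capmxSl.
have Xq : (X <= q)%MS by rewrite (submx_trans (row_sub _ _)) ?capmxSr.
rewrite submx0; apply: contraT => /ip_pos.
by rewrite kq // ltxx.
Qed.

Lemma qcompl_cap (k : 'M[R]_n) : (k :&: qcompl Q k)%MS = 0.
Proof. by apply: orth_cap => X Y Xk /qcomplP Yq; rewrite ip_sym Yq. Qed.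

Lemma qcompl_full (k : 'M[R]_n) m (X : 'M[R]_(m, n)) : (X <= k + qcompl Q k)%MS.
Proof.
suff : row_full (k + qcompl Q k)%MS by move=> f; exact: submx_full.
have := mxrank_sum_cap k (qcompl Q k); rewrite qcompl_cap mxrank0 addn0 => E.
rewrite /row_full eqn_leq rank_leq_col E /qcompl mxrank_ker.
have := mxrankM_maxr Q k^T; rewrite mxrank_tr.
by move=> le1; rewrite -leq_subLR leq_sub2l.
Qed.

(** Ad_a preserves Q and maps k onto itself. *)
Lemma Ad_stable_qcompl (k : 'M[R]_n) (a : G) :
  stablemx k (Ad a) -> stablemx (qcompl Q k) (Ad a).
Proof.
move=> kst; have [_ _ Qi] := Qbi.
have Au : Ad a \in unitmx.
  have Qu : Q \in unitmx.
    rewrite -row_free_unit -kermx_eq0; apply/rowV0P => v /sub_kermxP vQ.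
    apply/eqP; apply: contraT => /ip_pos; by rewrite /ip vQ mul0mx mxE ltxx.
  have := Qi a => QA; move: Qu; rewrite -QA !unitmx_mul => /andP[/andP[]] //.
have kA : (k <= k *m Ad a)%MS.
  by rewrite -(geq_leqif (mxrank_leqif_sup kst)) mxrankMfree // row_free_unit.
apply/row_subP => i; rewrite row_mul; apply/qcomplP => Z Zk.
have /submxP[W ->] : (Z <= k *m Ad a)%MS := submx_trans Zk kA.
rewrite mulmxA (ip_Ad Qbi).
have /qcomplP -> // : (row i (qcompl Q k) <= qcompl Q k)%MS by exact: row_sub.
exact: submxMl.
Qed.
End QOrthogonal.

Section LieSubgroups.
Context {R : realType} {n : nat} {G : lieGroupType R n} (K : set G) (k : 'M[R]_n).
Hypothesis K_sub : lie_subgroup K k.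

Lemma subgroup_bracket (q : 'M[R]_n) X Y :
  (forall a, K a -> stablemx q (Ad a)) -> (X <= k)%MS -> (Y <= q)%MS ->
  (bracket G X Y <= q)%MS.
Proof.
case: K_sub => d [L [f [fm _ _ fK fk]]] qst Xk Yq.
apply: (bracket_stable fm) => //; last by rewrite (eqmxP fk).
by move=> b; apply: qst; rewrite -fK; exists b.
Qed.

Lemma subgroup_Ad_stable a : K a -> stablemx k (Ad a).
Proof.
case: K_sub => d [L [f [fm _ _ fK fk]]]; rewrite -fK => -[b _ <-].
rewrite -(eqmxP fk) -(eqmxMr _ (eqmxP fk)) (lie_diff_Ad fm).
exact: submxMl.
Qed.
End LieSubgroups.

(** * Scalar curvature in an orthogonal frame *)

Opaque ip bracket levi_civita curvature Defs.form diff derive.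
Lemma koszul_comb (R : realType) (k a a' b b' c c' : R) :
  2^-1 * (k * a + a' - (k * b + b') + (k * c + c')) =
  k * (2^-1 * (a - b + c)) + 2^-1 * (a' - b' + c').
Proof. ring. Qed.

Lemma curv_comb (R : realType) n (k : R) (A A' B B' C C' D D' : 'rV[R]_n) :
  k *: A + A' - (k *: B + B') - (k *: C + C') - (k *: D + D') =
  k *: (A - B - C - D) + (A' - B' - C' - D').
Proof. by apply/rowP => i; rewrite !mxE; ring. Qed.

Section Curvature.
Context {R : realType} {n : nat} (G : lieGroupType R n) (Q : 'M[R]_n).
Context (h p : 'M[R]_n) {I : finType} (P : pred I) (E : I -> 'rV[R]_n).
Variables (g : 'M[R]_(\rank p)) (x : I -> R).
Implicit Types (X Y Z : 'rV[R]_n).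
Local Notation br := (bracket G).
Local Notation lc := (levi_civita G h g).

Definition bracket_form X Y Z : R := form g (br X Y *m proj_mx p h) Z.

Lemma bracket_formE X Y Z : bracket_form X Y Z = form g (br X Y *m proj_mx p h) Z.
Proof. by []. Qed.

Lemma bracket_formP1 k X X' Y Z : bracket_form (k *: X + X') Y Z = k *
  bracket_form X Y Z + bracket_form X' Y Z.
Proof. by rewrite /bracket_form bracketPl mulmxDl -scalemxAl formDl formZl. Qed.
Lemma bracket_formP2 k X X' Y Z : bracket_form Y (k *: X + X') Z = k *
  bracket_form Y X Z + bracket_form Y X' Z.
Proof. by rewrite /bracket_form bracketPr mulmxDl -scalemxAl formDl formZl. Qed.
Lemma bracket_formP3 k X X' Y Z : bracket_form Y Z (k *: X + X') = k *
  bracket_form Y Z X + bracket_form Y Z X'.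
Proof. by rewrite /bracket_form formDr formZr. Qed.

Definition koszul X Y Z : R := 2^-1 *
  (bracket_form X Y Z - bracket_form Y Z X + bracket_form Z X Y).

Lemma koszulPl k X X' Y Z : koszul (k *: X + X') Y Z = k * koszul X Y Z + koszul X' Y Z.
Proof. by rewrite /koszul bracket_formP1 bracket_formP3 bracket_formP2;
  exact: koszul_comb. Qed.
Lemma koszulPm k X X' Y Z : koszul Y (k *: X + X') Z = k * koszul Y X Z + koszul Y X' Z.
Proof. by rewrite /koszul bracket_formP1 bracket_formP3 bracket_formP2;
  exact: koszul_comb. Qed.
Lemma koszulPr k X X' Y Z : koszul Y Z (k *: X + X') = k * koszul Y Z X + koszul Y Z X'.
Proof. by rewrite /koszul bracket_formP1 bracket_formP3 bracket_formP2;
  exact: koszul_comb. Qed.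

Transparent levi_civita.
Lemma levi_civita_koszul X Y : lc X Y =
  \sum_i \sum_j (invmx g i j * koszul X Y (bvec i)) *: bvec j.
Proof. by []. Qed.

Lemma levi_civita_sharp X Y : lc X Y = sharp g (koszul X Y).
Proof. by []. Qed.

Opaque levi_civita bracket_form.
Lemma levi_civitaPl k X X' Y : lc (k *: X + X') Y = k *: lc X Y + lc X' Y.
Proof.
rewrite !levi_civita_koszul scaler_sumr -big_split; apply: eq_bigr => i _ /=.
rewrite scaler_sumr -big_split; apply: eq_bigr => j _ /=.
by rewrite koszulPl mulrDr scalerDl scalerA mulrCA.
Qed.

Lemma levi_civitaPr k X Y Y' : lc X (k *: Y + Y') = k *: lc X Y + lc X Y'.
Proof.
rewrite !levi_civita_koszul scaler_sumr -big_split; apply: eq_bigr => i _ /=.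
rewrite scaler_sumr -big_split; apply: eq_bigr => j _ /=.
by rewrite koszulPm mulrDr scalerDl scalerA mulrCA.
Qed.

Transparent curvature.
Lemma curvatureE X Y Z : curvature G h g X Y Z =
  lc X (lc Y Z) - lc Y (lc X Z) - lc (br X Y *m proj_mx p h) Z
  - br (br X Y *m proj_mx h p) Z.
Proof. by []. Qed.
Opaque curvature.

Lemma bracketPl_mul k X X' Y (M : 'M[R]_n) :
  br (k *: X + X') Y *m M = k *: (br X Y *m M) + br X' Y *m M.
Proof. by rewrite bracketPl mulmxDl scalemxAl. Qed.

Lemma bracketPr_mul k X X' Y (M : 'M[R]_n) :
  br Y (k *: X + X') *m M = k *: (br Y X *m M) + br Y X' *m M.
Proof. by rewrite bracketPr mulmxDl scalemxAl. Qed.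

Lemma curvaturePl k X X' Y Z : curvature G h g (k *: X + X') Y Z =
  k *: curvature G h g X Y Z + curvature G h g X' Y Z.
Proof.
rewrite !curvatureE -curv_comb.
congr (_ - _ - _ - _); first exact: levi_civitaPl.
- by rewrite -levi_civitaPr -levi_civitaPl.
- by rewrite -levi_civitaPl -bracketPl_mul.
- by rewrite -bracketPl -bracketPl_mul.
Qed.

Lemma curvaturePm k X Y Y' Z : curvature G h g X (k *: Y + Y') Z =
  k *: curvature G h g X Y Z + curvature G h g X Y' Z.
Proof.
rewrite !curvatureE -curv_comb.
congr (_ - _ - _ - _); last 3 first.
- exact: levi_civitaPl.
- by rewrite -levi_civitaPl -bracketPr_mul.
- by rewrite -bracketPl -bracketPr_mul.
- by rewrite -levi_civitaPr -levi_civitaPl.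
Qed.

Lemma curvaturePr k X Y Z Z' : curvature G h g X Y (k *: Z + Z') =
  k *: curvature G h g X Y Z + curvature G h g X Y Z'.
Proof.
rewrite !curvatureE -curv_comb.
congr (_ - _ - _ - _).
- by rewrite -levi_civitaPr -levi_civitaPr.
- by rewrite -levi_civitaPr -levi_civitaPr.
- exact: levi_civitaPr.
- exact: bracketPr.
Qed.

Hypotheses (Qbi : biinvariant G Q) (onb : orthonormal_frame (p := p) Q P E).
Hypotheses (dg : diagonal P E g x) (x0 : forall a, P a -> x a != 0).

(** Two contractions with the inverse metric, each computed in the frame. *)
Lemma scalar_curvature_frame : scalar_curvature G h g =
  \sum_(a | P a) \sum_(b | P b) (x a)^-1 * (x b)^-1 *
    form g (curvature G h g (E a) (E b) (E b)) (E a).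
Proof.
rewrite /scalar_curvature.
transitivity (\sum_i \sum_k invmx g i k * (\sum_(b | P b) (x b)^-1 *
   form g (curvature G h g (bvec i) (E b) (E b)) (bvec k))).
  apply: eq_bigr => i _; rewrite exchange_big; apply: eq_bigr => k _ /=.
  rewrite -(sum_invmx onb dg x0
    (B := fun X Y => form g (curvature G h g (bvec i) X Y) (bvec k))).
  - rewrite mulr_sumr; apply: eq_bigr => j _.
    by rewrite mulr_sumr; apply: eq_bigr => l _; rewrite mulrA.
  - by move=> Y c X X'; rewrite curvaturePm formDl formZl.
  - by move=> Y c X X'; rewrite curvaturePr formDl formZl.
rewrite (sum_invmx onb dg x0 (B := fun X Y => \sum_(b | P b) (x b)^-1 *
   form g (curvature G h g X (E b) (E b)) Y)).
- apply: eq_bigr => a _; rewrite mulr_sumr; apply: eq_bigr => b _; exact: mulrA.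
- move=> Y c X X'; rewrite mulr_sumr -big_split; apply: eq_bigr => b _ /=.
  by rewrite curvaturePl formDl formZl mulrDr mulrCA.
- move=> Y c X X'; rewrite mulr_sumr -big_split; apply: eq_bigr => b _ /=.
  by rewrite formDr formZr mulrDr mulrCA.
Qed.

Hypothesis hp0 : forall Z X, (Z <= h)%MS -> (X <= p)%MS -> ip Q Z X = 0.
Hypothesis br_sub : forall a b, P a -> P b -> (br (E a) (E b) <= p + h)%MS.
Hypothesis br_hp : forall Z b, (Z <= h)%MS -> P b -> (br Z (E b) <= p)%MS.

Variable c : I -> I -> I -> R.
Hypothesis cE : forall a b d, ip Q (br (E a) (E b)) (E d) = c a b d.

Lemma frame_isotropy_cap : (p :&: h)%MS = 0.
Proof. by apply: (orth_cap Qbi) => X Y Xp Yh; rewrite (ip_sym Qbi) hp0. Qed.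

(** The isotropy part of a bracket is orthogonal to the frame. *)
Lemma br_projE a b : P a -> P b ->
  br (E a) (E b) *m proj_mx p h = \sum_(d | P d) c a b d *: E d.
Proof.
move=> Pa Pb; case: onb => Ep _ sp.
rewrite {1}(sp _ (proj_mx_sub p h _)); apply: eq_bigr => d Pd; congr (_ *: _).
rewrite -cE -[in RHS](add_proj_mx frame_isotropy_cap (br_sub Pa Pb)) ipDl.
by rewrite [X in _ + X]hp0 ?addr0 ?proj_mx_sub ?Ep.
Qed.

Lemma c_antisym a b d : c a b d = - c b a d.
Proof. by rewrite -(cE a b d) -(cE b a d) bracketC ipNl. Qed.

Lemma c_skew a b d : c a b d = - c a d b.
Proof.
case: (Qbi) => QT _ _; rewrite -(cE a b d) -(cE a d b).
exact: (etrans (bracket_skew Qbi (E a) (E b) (E d)) (congr1 _ (ipC QT _ _))).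
Qed.

(** The structure constants are totally antisymmetric: the bracket is alternating and ad
    is skew. *)
Lemma c_cycle a b d : c b d a = c a b d.
Proof. by rewrite (c_skew b d a) -(c_antisym a b d). Qed.

(** The Koszul formula, with the three structure constants identified by cyclic symmetry. *)
Lemma levi_civitaE a b : P a -> P b ->
  lc (E a) (E b) = \sum_(d | P d) ((x d)^-1 * (2^-1 * (x d - x a + x b) * c a b d)) *: E d.
Proof.
move=> Pa Pb; case: onb => Ep _ sp; rewrite levi_civita_sharp (sharp_diagonal onb dg x0).
  apply: eq_bigr => d Pd; congr (_ *: _); rewrite /koszul.
  have H a1 b1 d1 : P a1 -> P b1 -> P d1 ->
      bracket_form (E a1) (E b1) (E d1) = x d1 * c a1 b1 d1.
    move=> P1 P2 P3; rewrite bracket_formE (form_diagonal onb dg P3 (proj_mx_sub _ _ _)).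
    rewrite -cE -[in RHS](add_proj_mx frame_isotropy_cap (br_sub P1 P2)) ipDl.
    by rewrite [X in _ = _ * (_ + X)]hp0 ?addr0 ?proj_mx_sub ?Ep.
  rewrite (H a b d Pa Pb Pd) (H b d a Pb Pd Pa) (H d a b Pd Pa Pb).
  rewrite (c_cycle a b d) -(c_cycle d a b); ring.
by move=> k Z Z'; exact: koszulPr.
Qed.

Lemma form_levi_civita a b d : P a -> P b -> P d ->
  form g (lc (E a) (E b)) (E d) = 2^-1 * (x d - x a + x b) * c a b d.
Proof.
move=> Pa Pb Pd; rewrite levi_civitaE // form_suml (bigD1 d) //= big1 => [|i /andP[Pi id]].
  rewrite addr0 formZl (dg Pd Pd) eqxx mulr1n [LHS]mulrC !mulrA mulfV ?x0 //.
  by rewrite mul1r.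
by rewrite formZl (dg Pi Pd) (negPf id) mulr0n mulr0.
Qed.

Lemma levi_civita_suml (F : I -> R) Y : lc (\sum_(d | P d) F d *: E d) Y =
  \sum_(d | P d) F d *: lc (E d) Y.
Proof.
have D X X' : lc (X + X') Y = lc X Y + lc X' Y.
  by rewrite -[X]scale1r levi_civitaPl !scale1r.
have D0 : lc 0 Y = 0 by have /eqP := D 0 0; rewrite addr0 eq_sym -subr_eq0 addrK => /eqP.
rewrite (big_morph (lc ^~ Y) D D0); apply: eq_bigr => d _.
by have := levi_civitaPl (F d) (E d) 0 Y; rewrite D0 !addr0.
Qed.

Lemma levi_civita_sumr (F : I -> R) Y : lc Y (\sum_(d | P d) F d *: E d) =
  \sum_(d | P d) F d *: lc Y (E d).
Proof.
have D X X' : lc Y (X + X') = lc Y X + lc Y X'.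
  by rewrite -[X]scale1r levi_civitaPr !scale1r.
have D0 : lc Y 0 = 0 by have /eqP := D 0 0; rewrite addr0 eq_sym -subr_eq0 addrK => /eqP.
rewrite (big_morph (lc Y) D D0); apply: eq_bigr => d _.
by have := levi_civitaPr (F d) Y (E d) 0; rewrite D0 !addr0.
Qed.

(** The factor of c_abd^2 in the sectional curvature of the plane spanned by E_a and E_b:
    the first summand comes from the connection along [E_a, E_b]_p, the second one from
    the product of two connection operators. *)
Definition cubic_coef (xa xb xd : R) : R :=
  (xa + xb - xd) / (2 * xa * xb) -
  (xd - xa + xb) * (xa - xb + xd) / (4 * xa * xb * xd).

(** The term with nabla_b E_b vanishes as c_bbd = 0. The isotropy term is |[E_a, E_b]_h|^2
    by skewness of ad, and this is |[E_a, E_b]|^2 minus the squares of the components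
    along the frame. *)
Lemma form_curvature a b : P a -> P b ->
  (x a)^-1 * (x b)^-1 * form g (curvature G h g (E a) (E b) (E b)) (E a) =
  (x b)^-1 * (ip Q (br (E a) (E b)) (br (E a) (E b)) - \sum_(d | P d) c a b d ^+ 2)
  + \sum_(d | P d) cubic_coef (x a) (x b) (x d) * c a b d ^+ 2.
Proof.
move=> Pa Pb; case: (onb) => Ep _ _; case: (Qbi) => QT _ _.
have cbb d : c b b d = 0 by rewrite -cE bracketXX ip0l.
have lbb : lc (E b) (E b) = 0.
  by rewrite levi_civitaE // big1 // => d _; rewrite cbb !mulr0 scale0r.
have l0 X : lc X 0 = 0.
  have Z0 : \sum_(d | P d) (0 : R) *: E d = 0 by rewrite big1 // => d _; rewrite scale0r.
  by rewrite -Z0 levi_civita_sumr !big1 // => d _; rewrite scale0r.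
rewrite curvatureE lbb l0 sub0r.
set T2 := lc (E b) _; set T3 := lc (_ *m _) _; set T4 := br (_ *m _) _.
have F2 : form g T2 (E a) = \sum_(d | P d) (x d)^-1 * (2^-1 * (x d - x a + x b) * c a b d) *
   (2^-1 * (x a - x b + x d) * c a b d).
  rewrite /T2 levi_civitaE // levi_civita_sumr form_suml; apply: eq_bigr => d Pd.
  by rewrite formZl form_levi_civita // (c_cycle a b d).
have F3 : form g T3 (E a) = - \sum_(d | P d) c a b d * (2^-1 * (x a - x d + x b) * c a b d).
  rewrite /T3 br_projE // levi_civita_suml form_suml -sumrN; apply: eq_bigr => d Pd.
  rewrite formZl form_levi_civita // (c_skew d b a) (c_cycle b d a) (c_cycle a b d).
  by rewrite !mulrN.
set bb := ip Q (br (E a) (E b)) (br (E a) (E b)).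
have F4 : form g T4 (E a) = - (x a * (bb - \sum_(d | P d) c a b d ^+ 2)).
  rewrite /T4; set Z := br _ _ *m proj_mx h p.
  have Zh : (Z <= h)%MS by exact: proj_mx_sub.
  rewrite (form_diagonal onb dg Pa (br_hp Zh Pb)) -mulrN; congr (_ * _).
  rewrite /bb; set W := br (E a) (E b).
  have WE : W = W *m proj_mx p h +
    Z by rewrite (add_proj_mx frame_isotropy_cap (br_sub Pa Pb)).
  have E1 : ip Q (br Z (E b)) (E a) = - ip Q Z W.
    rewrite bracketC ipNl (bracket_skew Qbi (E b) Z (E a)) opprK.
    by rewrite (bracketC G (E b)) ipNr.
  have E2 : ip Q Z W = ip Q W W - ip Q (W *m proj_mx p h) W.
    by rewrite {2}WE ipDl addrAC subrr add0r.
  apply: (etrans E1); apply: congr1; apply: (etrans E2); apply: congr1; apply: congr1.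
  rewrite /W br_projE // ip_suml; apply: eq_bigr => d Pd.
  by rewrite ipZl (ipC QT) cE.
have xa0 := x0 Pa; have xb0 := x0 Pb.
have re (A B C : R) : - A - - B - - C = C + (B - A) by ring.
rewrite !formDl !formNl F2 F3 F4 re mulrDr; congr (_ + _).
  by rewrite mulrACA mulVf // mul1r.
rewrite mulrDr mulrN !mulr_sumr -sumrN -big_split; apply: eq_bigr => d Pd /=.
have xd0 := x0 Pd; rewrite /cubic_coef; field.
by rewrite xd0 xa0 xb0.
Qed.

Lemma scalar_curvature_formula : scalar_curvature G h g =
  \sum_(a | P a) \sum_(b | P b) (x b)^-1 *
    (ip Q (br (E a) (E b)) (br (E a) (E b)) - \sum_(d | P d) c a b d ^+ 2) +
  \sum_(a | P a) \sum_(b | P b) \sum_(d | P d)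
    cubic_coef (x a) (x b) (x d) * c a b d ^+ 2.
Proof.
rewrite scalar_curvature_frame -big_split; apply: eq_bigr => a Pa /=.
by rewrite -big_split; apply: eq_bigr => b Pb /=; exact: form_curvature.
Qed.

End Curvature.

Transparent ip bracket levi_civita curvature Defs.form diff derive.

(** * Schur's lemma over the reals *)

Section SymmetricEigenvector.
Variables (R : realType) (r : nat).
Local Notation V := 'rV[R]_r.

Lemma ip_continuous (S : 'M[R]_r) : continuous (fun u : V => ip S u u).
Proof.
move=> u; apply: differentiable_continuous.
rewrite (_ : (fun _ => _) =
    \sum_i \sum_j (S i j \*: ((fun w : V => w 0 i) * (fun w : V => w 0 j)))).
  apply: differentiable_sum => i; apply: differentiable_sum => j.
  by apply: differentiableZ; apply: differentiableM; exact: differentiable_coord.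
apply/funext => w; rewrite ipE fct_sumE; apply: eq_bigr => i _.
rewrite fct_sumE; apply: eq_bigr => j _.
by rewrite -[RHS]/(S i j * (w 0 i * w 0 j)) mulrA (mulrC (S i j)).
Qed.

Lemma ip1E (u : V) : ip 1%:M u u = \sum_i u 0 i ^+ 2.
Proof. by rewrite /ip mulmx1 mxE; apply: eq_bigr => i _; rewrite mxE expr2. Qed.

Lemma ip1_ge0 (u : V) : 0 <= ip 1%:M u u.
Proof. by rewrite ip1E sumr_ge0 // => i _; rewrite sqr_ge0. Qed.

Lemma ip1_eq0 (u : V) : ip 1%:M u u = 0 -> u = 0.
Proof.
rewrite ip1E => /eqP; rewrite psumr_eq0 => [/allP H|i _]; last exact: sqr_ge0.
apply/rowP => i; rewrite mxE; have := H i (mem_index_enum _).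
by rewrite /= sqrf_eq0 => /eqP.
Qed.

Lemma sphere_compact : compact [set u : V | ip 1%:M u u = 1].
Proof.
apply: bounded_closed_compact.
  exists 1; split => // y y1 u /= u1; apply: (le_trans _ (ltW y1)).
  rewrite [leLHS]/Num.Def.normr /= mx_normrE; apply: bigmax_le => // -[i j] _ /=.
  rewrite ord1; have u2 : u 0 j ^+ 2 <= 1.
    rewrite -u1 ip1E (bigD1 j) //= lerDl sumr_ge0 // => k _; exact: sqr_ge0.
  by rewrite ler_norml; apply/andP; split; nra.
rewrite (_ : [set u | _] = (fun u : V => ip 1%:M u u) @^-1` [set 1]) //.
by apply: preimage_closed; [move=> u _; exact: ip_continuous | exact: closed_eq].
Qed.

(** Let c be the maximum of the quadratic form on the unit sphere, attained at u by
    compactness. The form c |w|^2 - S(w, w) is nonnegative and vanishes at u, so that u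
    lies in its radical. *)
Lemma symmetric_eigenvector (S : 'M[R]_r) : (0 < r)%N -> S^T = S ->
  exists (c : R) (u : V), u != 0 /\ u *m S = c *: u.
Proof.
move=> r0 ST; pose i0 := Ordinal r0.
have ne : [set u : V | ip 1%:M u u = 1] !=set0.
  exists (delta_mx 0 i0) => /=; rewrite ip1E (bigD1 i0) //= mxE !eqxx expr1n big1 ?addr0 //.
  by move=> k /negPf k0; rewrite mxE k0 andbF expr0n.
have [u0 u0K umax] := EVT_max_rV ne sphere_compact
  (continuous_subspaceT (@ip_continuous S)).
have {}u0K : ip 1%:M u0 u0 = 1 by move: u0K; rewrite inE.
pose c := ip S u0 u0; exists c, u0; split.
  by apply: contra_eq_neq u0K => ->; rewrite ip0l eq_sym oner_eq0.
pose M := c%:M - S.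
have ME w z : ip M w z = c * ip 1%:M w z - ip S w z.
  rewrite /ip /M mulmxBr mulmxBl mul_mx_scalar mulmx1 -scalemxAl.
  by rewrite [LHS]mxE mxE [X in _ + X]mxE.
have MT : M^T = M by rewrite /M linearB /= tr_scalar_mx ST.
have Mpos w : 0 <= ip M w w.
  rewrite ME subr_ge0; have [->|w0] := eqVneq w 0; first by rewrite !ip0l mulr0.
  have N0 : 0 < ip 1%:M w w.
    rewrite lt_neqAle ip1_ge0 andbT eq_sym; apply: contra_neq w0; exact: ip1_eq0.
  set N := ip 1%:M w w in N0 *; pose s := (Num.sqrt N)^-1.
  have s2 : s * s = N^-1 by rewrite -expr2 exprVn sqr_sqrtr // ltW.
  have := umax (s *: w); rewrite inE /= !ipZl !ipZr !mulrA s2 mulVf ?lt0r_neq0 //.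
  by move=> /(_ erefl); rewrite -/c ler_pdivrMl // mulrC.
pose z := u0 *m M.
have M00 : ip M u0 u0 = 0 by rewrite ME u0K mulr1 subrr.
have M0z : ip M u0 z = ip 1%:M z z by rewrite /ip mulmx1.
have Mz0 : ip M z u0 = ip 1%:M z z by rewrite ipC.
have a0 : ip 1%:M z z = 0.
  have a0 := ip1_ge0 z; have b0 := Mpos z.
  set a := ip 1%:M z z in M0z Mz0 a0 *; set b := ip M z z in b0 *.
  (* The polynomial 2 t a + t^2 b is nonnegative for all t, which forces a = 0. *)
  have := Mpos (u0 + (- (a / (b + 1))) *: z).
  rewrite ipDl !ipDr !ipZl !ipZr M00 M0z Mz0 -/b.
  have b1 : b + 1 != 0 by rewrite lt0r_neq0 // ltr_wpDl.
  set t := a / (b + 1); have at_ : a = t * (b + 1) by rewrite /t divfK.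
  have t0 : 0 <= t by rewrite divr_ge0 // addr_ge0.
  rewrite at_ => H; have : t = 0 by nra.
  by move=> ->; rewrite mul0r.
have := ip1_eq0 a0; rewrite /z /M mulmxBr mul_mx_scalar => /eqP.
by rewrite subr_eq0 => /eqP.
Qed.
End SymmetricEigenvector.

Section Schur.
Context {R : realType} {n : nat} {G : lieGroupType R n} (H : set G) (Q : 'M[R]_n).
Hypothesis Qbi : biinvariant G Q.
Implicit Types (p : 'M[R]_n) (a : G).

Section OneModule.
Variables (p : 'M[R]_n) (e : 'M[R]_(\rank p, n)).
Hypotheses (e_on1 : orthonormal_basis Q e) (irr : irreducible H p).

(** The matrix of Ad_a on p in the orthonormal basis e. *)
Definition Ad_mx (a : G) : 'M[R]_(\rank p) := e *m Ad a *m Q *m e^T.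

Lemma basis_eqmx : (e :=: p)%MS. Proof. by apply/eqmxP; case: e_on1. Qed.

Lemma Ad_mxE a : H a -> e *m Ad a = Ad_mx a *m e.
Proof.
case: irr => _ st _ /st pst; have /submxP[W WE] : (e *m Ad a <= e)%MS.
  by rewrite (submx_trans (submxMr _ _) (submx_trans pst _)) ?basis_eqmx.
by case: e_on1 => _ eQ; rewrite /Ad_mx WE -(mulmxA W e Q) -(mulmxA W) eQ mulmx1.
Qed.

Lemma Ad_mx_orthogonal a : H a -> Ad_mx a *m (Ad_mx a)^T = 1%:M.
Proof.
move=> Ha; case: Qbi => QT _ Qi; case: e_on1 => _ eQ.
have : (e *m Ad a) *m Q *m (e *m Ad a)^T = 1%:M.
  by rewrite trmx_mul -eQ -[in RHS](Qi a) !mulmxA.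
rewrite Ad_mxE // trmx_mul => <-.
by rewrite [in RHS]mulmxA -(mulmxA (Ad_mx a) e Q) -(mulmxA (Ad_mx a) (e *m Q)) eQ mulmx1.
Qed.

Lemma Ad_mx_orthogonal_tr a : H a -> (Ad_mx a)^T *m Ad_mx a = 1%:M.
Proof. by move=> Ha; apply: mulmx1C; exact: Ad_mx_orthogonal. Qed.

Lemma basis_free : row_free e.
Proof. by rewrite /row_free basis_eqmx. Qed.

(** Invariant subspaces of p, in the coordinates of the basis e. *)
Lemma irreducible_coord k (N : 'M[R]_(k, \rank p)) :
  (forall a, H a -> (N *m Ad_mx a <= N)%MS) -> N = 0 \/ (N *m e :=: p)%MS.
Proof.
move=> st; case: irr => _ _ ir; have [||N0|Np] := ir <<N *m e>>%MS.
- by rewrite genmxE (submx_trans (submxMl _ _)) // basis_eqmx.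
- move=> a Ha; rewrite genmxE (eqmxMr _ (genmxE _)).
  by rewrite -mulmxA Ad_mxE // mulmxA submxMr // st.
- left; apply: (row_free_inj basis_free); apply/eqP.
  by rewrite mul0mx -submx0 -(genmxE (N *m e)) N0.
- by right; apply: eqmx_trans (eqmx_sym (genmxE _)) (eqmxP Np).
Qed.

(** The eigenspace of M for an eigenvalue c is invariant and not zero, so it is
    everything. *)
Lemma schur_scalar (M : 'M[R]_(\rank p)) : M^T = M ->
  (forall a, H a -> Ad_mx a *m M *m (Ad_mx a)^T = M) -> exists c, M = c%:M.
Proof.
move=> MT Mi; have r0 : (0 < \rank p)%N.
  by case: irr => p0 _ _; rewrite lt0n mxrank_eq0.
have [c [u [u0 uM]]] := symmetric_eigenvector r0 MT.
exists c; pose N := kermx (M - c%:M).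
have comm a : H a -> Ad_mx a *m M = M *m Ad_mx a.
  by move=> Ha; rewrite -[in RHS](Mi a Ha) -[RHS]mulmxA Ad_mx_orthogonal_tr // mulmx1.
have [a Ha|N0|Np] := irreducible_coord (N := N).
- apply/sub_kermxP; rewrite -mulmxA mulmxBr comm // scalar_mxC -mulmxBl mulmxA.
  by rewrite mulmx_ker mul0mx.
- have : (u <= N)%MS.
    by apply/sub_kermxP; rewrite mulmxBr uM mul_mx_scalar subrr.
  by rewrite N0 submx0 (negPf u0).
- have rN : row_full N.
    by rewrite /row_full -(mxrankMfree N basis_free) Np.
  apply/eqP; rewrite -subr_eq0 -submx0 -(mul1mx (M - _)).
  by rewrite submx0; apply/eqP/sub_kermxP; rewrite submx_full.
Qed.
End OneModule.

(** An intertwining operator has an invariant kernel and an invariant image. If it is not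
    zero it is therefore an isomorphism of p1 onto p2. *)
Lemma schur_zero p1 p2 (e1 : 'M[R]_(\rank p1, n)) (e2 : 'M[R]_(\rank p2, n))
    (M : 'M[R]_(\rank p1, \rank p2)) :
  orthonormal_basis Q e1 -> irreducible H p1 ->
  orthonormal_basis Q e2 -> irreducible H p2 -> ~ equivalent H p1 p2 ->
  (forall a, H a -> Ad_mx e1 a *m M *m (Ad_mx e2 a)^T = M) -> M = 0.
Proof.
move=> o1 i1 o2 i2 neq Mi.
have comm a : H a -> Ad_mx e1 a *m M = M *m Ad_mx e2 a.
  by move=> Ha; rewrite -[in RHS](Mi a Ha) -[RHS]mulmxA (Ad_mx_orthogonal_tr o2 i2) // mulmx1.
have [a Ha|N0|Np] := irreducible_coord o1 i1 (N := kermx M).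
- by apply/sub_kermxP; rewrite -mulmxA comm // mulmxA mulmx_ker mul0mx.
- have [a Ha|//|Mp] := irreducible_coord o2 i2 (N := M).
    by rewrite -comm // submxMl.
  have fM : row_free M by rewrite -kermx_eq0 N0.
  case: neq; exists (Q *m e1^T *m M *m e2).
  have eA : e1 *m (Q *m e1^T *m M *m e2) = M *m e2.
    by rewrite !mulmxA; case: o1 => _ ->; rewrite mul1mx.
  have /submxP[D DE] : (p1 <= e1)%MS by rewrite (basis_eqmx o1).
  split.
  + by apply/eqmxP; apply: eqmx_trans (eqmxMr _ (eqmx_sym (basis_eqmx o1))) _; rewrite eA.
  + by rewrite -[in RHS]Mp (mxrankMfree M (basis_free o2)); apply/esym/eqP.
  + move=> a Ha; set A := Q *m e1^T *m M *m e2.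
    have E1 : e1 *m Ad a *m A = e1 *m A *m Ad a.
      rewrite (Ad_mxE o1 i1 Ha) -mulmxA eA mulmxA (comm a Ha).
      by rewrite -(mulmxA M) -(Ad_mxE o2 i2 Ha) mulmxA.
    apply: (etrans (congr1 (fun X => X *m Ad a *m A) DE)).
    apply: (etrans _ (congr1 (fun X => X *m A *m Ad a) (esym DE))).
    by rewrite -!(mulmxA D) E1.
- have rN : row_full (kermx M) by rewrite /row_full -(mxrankMfree _ (basis_free o1)) Np.
  by rewrite -[M]mul1mx; apply/sub_kermxP; rewrite submx_full.
Qed.
End Schur.

(** * The real analysis of the reduced problem *)

Section RealLemmas.
Variable R : realType.

(** The determinant of the system vanishes when A a3 + a1 a2 is a square root of (a1^2 -
    A^2) (a2^2 - A^2), where a_l = p_l + A - lam t_l. The negative root is reached by the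
    intermediate value theorem at some lam < p1 / t1, where both factors are positive; it
    makes the solution positive. *)
Lemma wallach_root (p1 p2 p3 t1 t2 t3 A : R) :
  0 < A -> 0 < t1 -> 0 < t2 -> 0 < t3 -> p1 / t1 <= p2 / t2 ->
  (p2 + p3 + 2 * A) / (t2 + t3) < p1 / t1 ->
  exists lam x1 x2 x3 : R,
    [/\ 0 < x1, 0 < x2, 0 < x3 &
     [/\ A * x1 = (p3 + A - lam * t3) * x2 + (p2 + A - lam * t2) * x3,
         A * x2 = (p3 + A - lam * t3) * x1 + (p1 + A - lam * t1) * x3
       & A * x3 = (p2 + A - lam * t2) * x1 + (p1 + A - lam * t1) * x2]].
Proof.
move=> A0 t10 t20 t30 a12 b1.
set al := p1 / t1 in a12 b1.
have p1E : p1 = al * t1 by rewrite /al divfK // gt_eqF.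
have p2E : al * t2 <= p2 by rewrite -ler_pdivlMr.
have b1E : p2 + p3 + 2 * A < al * (t2 + t3) by rewrite -ltr_pdivrMr // addr_gt0.
pose a1 lam := p1 + A - lam * t1.
pose a2 lam := p2 + A - lam * t2.
pose a3 lam := p3 + A - lam * t3.
pose P : {poly R} := A%:P * ((p3 + A)%:P - t3%:P * 'X) +
  ((p1 + A)%:P - t1%:P * 'X) * ((p2 + A)%:P - t2%:P * 'X).
pose S : {poly R} := (((p1 + A)%:P - t1%:P * 'X) ^+ 2 - (A ^+ 2)%:P) *
  (((p2 + A)%:P - t2%:P * 'X) ^+ 2 - (A ^+ 2)%:P).
have PE lam : P.[lam] = A * a3 lam + a1 lam * a2 lam.
  by rewrite /P !hornerE /a1 /a2 /a3; ring.
have SE lam : S.[lam] = (a1 lam ^+ 2 - A ^+ 2) * (a2 lam ^+ 2 - A ^+ 2).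
  by rewrite /S !hornerE /a1 /a2; ring.
pose f lam := P.[lam] + Num.sqrt S.[lam].
have fc : continuous f.
  move=> lam; apply: cvgD; first exact: continuous_horner.
  apply: (@continuous_comp _ _ _ (horner S) Num.sqrt); first exact: continuous_horner.
  exact: sqrt_continuous.
(* Left of al both a1 and a2 exceed A, and left of (p3 + A) / t3 also a3 is positive. *)
pose l0 := Num.min al ((p3 + A) / t3) - 1.
have l0al : l0 < al.
  by rewrite /l0 ltrBlDr (le_lt_trans (y := al)) ?ge_min ?lexx // ltrDl.
have a30 : 0 < a3 l0.
  rewrite /a3 subr_gt0 -ltr_pdivlMr // /l0 ltrBlDr.
  by rewrite (le_lt_trans (y := (p3 + A) / t3)) ?ge_min ?lexx ?orbT // ltrDl.
have a1A lam : lam < al -> A < a1 lam by move=> H; rewrite /a1 p1E; nra.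
have a2A lam : lam < al -> A < a2 lam by move=> H; rewrite /a2; nra.
have f0 : 0 < f l0.
  rewrite /f PE ltr_wpDr ?sqrtr_ge0 //.
  have := a1A _ l0al; have := a2A _ l0al; nra.
have f1 : f al < 0.
  have a1al : a1 al = A by rewrite /a1 p1E; ring.
  rewrite /f PE SE a1al subrr mul0r sqrtr0 addr0 /a2 /a3; nra.
have [|||lam] := @IVT R f l0 al 0; first exact: ltW.
- exact: continuous_subspaceT.
- by rewrite ge_min le_max (ltW f0) (ltW f1) orbT.
rewrite in_itv /= => /andP[l0l lal] fl.
have {}lal : lam < al.
  by rewrite lt_neqAle lal andbT; apply: contraTneq f1 => <-; rewrite fl ltxx.
have A1 := a1A _ lal; have A2 := a2A _ lal.
set s := Num.sqrt S.[lam].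
have s0 : 0 < s by rewrite sqrtr_gt0 SE; apply: mulr_gt0; nra.
have s2 : s * s = (a1 lam ^+ 2 - A ^+ 2) * (a2 lam ^+ 2 - A ^+ 2).
  by rewrite -expr2 sqr_sqrtr // SE; apply: mulr_ge0; nra.
have ps : A * a3 lam + a1 lam * a2 lam = - s.
  by apply/eqP; rewrite -addr_eq0 -PE; apply/eqP.
rewrite -/(a1 _) -/(a2 _) -/(a3 _) in A1 A2 *.
pose x2 := a2 lam ^+ 2 - A ^+ 2.
have x20 : 0 < x2 by rewrite /x2; nra.
(* With x1 = s, the third equation defines x3; the others follow from s * s. *)
pose x3 := (a2 lam * s + a1 lam * x2) / A.
have Ax3 : A * x3 = a2 lam * s + a1 lam * x2 by rewrite /x3 mulrCA mulfV ?mulr1 // gt_eqF.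
exists lam, s, x2, x3; split => //.
  by rewrite divr_gt0 // addr_gt0 // mulr_gt0 // (lt_trans A0).
rewrite -/(a1 lam) -/(a2 lam) -/(a3 lam).
have An : A != 0 by rewrite gt_eqF.
split; last exact: Ax3.
- apply: (mulfI An).
  have -> : A * (a3 lam * x2 + a2 lam * x3) = x2 * (A * a3 lam) + a2 lam * (A * x3) by ring.
  rewrite Ax3.
  have -> : x2 * (A * a3 lam) + a2 lam * (a2 lam * s + a1 lam * x2) =
    x2 * (A * a3 lam + a1 lam * a2 lam) + a2 lam ^+ 2 * s by ring.
  by rewrite ps /x2; ring.
- apply: (mulfI An).
  have -> : A * (a3 lam * s + a1 lam * x3) = s * (A * a3 lam) + a1 lam * (A * x3) by ring.
  rewrite Ax3.
  have -> : s * (A * a3 lam) + a1 lam * (a2 lam * s + a1 lam * x2) =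
    s * (A * a3 lam + a1 lam * a2 lam) + a1 lam ^+ 2 * x2 by ring.
  by rewrite ps mulrN s2 /x2; ring.
Qed.

(** If s divides the increment of f along v, the derivative is the value of the quotient
    at s = 0. *)
Lemma derive_increment (V : normedModType R) (f : V -> R) (a v : V) (p q : {poly R}) :
  (\forall s \near (0 : R), f (a + s *: v) = f a + s * (p.[s] / q.[s])) ->
  q.[0] != 0 -> 'D_v f a = p.[0] / q.[0].
Proof.
move=> fE q0; rewrite /derive; apply: cvg_lim => //.
have c : p.[s] / q.[s] @[s --> (0 : R)] --> p.[0] / q.[0].
  apply: cvgM; first exact: continuous_horner.
  by apply: cvgV => //; exact: continuous_horner.
apply: cvg_trans (cvg_within_filter _ c).
apply: near_eq_cvg; rewrite near_withinE.
apply: filterS fE => s E s0; rewrite /= [s *: v + a]addrC E addrAC subrr add0r.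
by rewrite /GRing.scale /= mulrA mulVf // mul1r.
Qed.

Lemma char_poly2 (M : 'M[R]_2) (u v : R) : M ord0 ord0 = u -> M ord_max ord_max = u ->
  M ord0 ord_max = v -> M ord_max ord0 = v ->
  char_poly M = \prod_(a <- [:: u + v; u - v]) ('X - a%:P).
Proof.
move=> M00 M11 M01 M10; rewrite !big_cons big_nil mulr1 /char_poly.
rewrite (expand_det_row _ ord0) big_ord_recl big_ord1 /cofactor !det_mx11 !mxE /=.
have l1 : lift ord0 (0 : 'I_1) = ord_max :> 'I_2 by exact: val_inj.
have l2 : lift (lift ord0 (ord0 : 'I_1)) (0 : 'I_1) = ord0 :> 'I_2 by exact: val_inj.
rewrite l2 l1 M00 M11 M01 M10 /bump /=.
by rewrite mulr1n mulr0n polyCB polyCD; ring.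
Qed.

Let horner_rules := (@hornerD, @hornerN, @hornerM, @hornerX, @hornerC, @horner_exp).

Lemma near_pos (x w : R) : 0 < x -> \forall s \near (0 : R), 0 < x + s * w.
Proof.
move=> x0; pose P : {poly R} := x%:P + w%:P * 'X.
have c : P.[s] @[s --> (0 : R)] --> P.[0] by exact: continuous_horner.
have P0 : 0 < P.[0] by rewrite /P !horner_rules !mulr0 !addr0.
near=> s.
have : 0 < P.[s] by near: s; exact: (cvgr_gt _ c _ P0).
by rewrite /P !horner_rules (mulrC w).
Unshelve. all: by end_near. Qed.

(** The derivative of a multiple of the trace; a second-order perturbation does not
    contribute. *)
Lemma wallach_derive (V : normedModType R) (f : V -> R) (a v : V)
    (lam r t1 t2 t3 x1 x2 x3 w1 w2 w3 : R) :
  0 < x1 -> 0 < x2 -> 0 < x3 ->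
  (\forall s \near (0 : R), f (a + s *: v) =
     lam * (t1 / (x1 + s * w1) + t2 / (x2 + s * w2) + t3 / (x3 + s * w3)) +
     s ^+ 2 * r / ((x1 + s * w1) * (x2 + s * w2) * (x3 + s * w3))) ->
  'D_v f a = - lam * (t1 * w1 / x1 ^+ 2 + t2 * w2 / x2 ^+ 2 + t3 * w3 / x3 ^+ 2).
Proof.
move=> x10 x20 x30 fE.
have y1 := near_pos w1 x10; have y2 := near_pos w2 x20; have y3 := near_pos w3 x30.
pose u (x w : R) : {poly R} := x%:P * (x%:P + w%:P * 'X).
pose p : {poly R} := - lam%:P * ((t1 * w1)%:P * u x2 w2 * u x3 w3 +
  (t2 * w2)%:P * u x1 w1 * u x3 w3 + (t3 * w3)%:P * u x1 w1 * u x2 w2) +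
  'X * (r * (x1 * x2 * x3))%:P.
pose q : {poly R} := u x1 w1 * u x2 w2 * u x3 w3.
have n1 := lt0r_neq0 x10; have n2 := lt0r_neq0 x20; have n3 := lt0r_neq0 x30.
have q0 : q.[0] != 0 by rewrite /q /u !horner_rules !mulr0 !addr0 !mulf_neq0.
rewrite (derive_increment (p := p) (q := q)) //.
  rewrite /p /q /u !horner_rules; field.
  by rewrite n1 n2 n3.
have fa : f a = lam * (t1 / x1 + t2 / x2 + t3 / x3).
  have := nbhs_singleton fE; rewrite scale0r addr0 !mul0r !addr0 => ->.
  by rewrite expr0n /= !mul0r addr0.
near=> s.
have -> : f (a + s *: v) =
     lam * (t1 / (x1 + s * w1) + t2 / (x2 + s * w2) + t3 / (x3 + s * w3)) +
     s ^+ 2 * r / ((x1 + s * w1) * (x2 + s * w2) * (x3 + s * w3)).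
  by near: s.
have m1 : x1 + s * w1 != 0 by rewrite lt0r_neq0 //; near: s.
have m2 : x2 + s * w2 != 0 by rewrite lt0r_neq0 //; near: s.
have m3 : x3 + s * w3 != 0 by rewrite lt0r_neq0 //; near: s.
rewrite fa /p /q /u !horner_rules; field.
by rewrite n1 n2 n3 ![_ * s]mulrC m1 m2 m3.
Unshelve. all: by end_near. Qed.

Lemma quotient_derive (V : normedModType R) (f : V -> R) (a v : V)
    (c r0 r1 r2 l0 l1 l2 : R) : l0 != 0 ->
  (\forall s \near (0 : R), l0 + l1 * s + l2 * s ^+ 2 != 0 /\ f (a + s *: v) =
     c + (r0 + r1 * s + r2 * s ^+ 2) / (l0 + l1 * s + l2 * s ^+ 2)) ->
  'D_v f a = (r1 * l0 - r0 * l1) / l0 ^+ 2.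
Proof.
move=> n0 fE.
pose p : {poly R} := (r1 * l0 - r0 * l1)%:P + 'X * (r2 * l0 - r0 * l2)%:P.
pose q : {poly R} := l0%:P * (l0%:P + l1%:P * 'X + l2%:P * 'X ^+ 2).
have q0 : q.[0] != 0 by rewrite /q !horner_rules ?expr0n /= ?mulr0 ?addr0 mulf_neq0.
rewrite (derive_increment (p := p) (q := q)) //.
  by rewrite /p /q !horner_rules; field.
have fa : f a = c + r0 / l0.
  have [_] := nbhs_singleton fE; rewrite scale0r addr0 => ->.
  by rewrite expr0n /= !mulr0 !addr0.
near=> s.
have [m0 ->] : l0 + l1 * s + l2 * s ^+ 2 != 0 /\ f (a + s *: v) =
    c + (r0 + r1 * s + r2 * s ^+ 2) / (l0 + l1 * s + l2 * s ^+ 2).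
  by near: s; exact: fE.
rewrite fa /p /q !horner_rules; field.
by rewrite n0 m0.
Unshelve. all: by end_near. Qed.

(** The derivative of a quotient whose numerator vanishes at the base point; the term in
    t^2 does not contribute. *)
Lemma hessian_derive (V : normedModType R) (f : V -> R) (a v : V)
    (rvw rv l0 l1 l2 k0 k1 : R) : l0 != 0 ->
  (\forall t \near (0 : R), l0 + l1 * t + l2 * t ^+ 2 != 0 /\ f (a + t *: v) =
     (t * rvw * (l0 + l1 * t + l2 * t ^+ 2) - t ^+ 2 * rv * (k0 + k1 * t)) /
     (l0 + l1 * t + l2 * t ^+ 2) ^+ 2) ->
  'D_v f a = rvw / l0.
Proof.
move=> n0 fE.
pose L : {poly R} := l0%:P + l1%:P * 'X + l2%:P * 'X ^+ 2.
pose p : {poly R} := rvw%:P * L - 'X * rv%:P * (k0%:P + k1%:P * 'X).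
pose q : {poly R} := L ^+ 2.
have q0 : q.[0] != 0.
  by rewrite /q /L !horner_rules ?expr0n /= ?mulr0 ?addr0 mulf_neq0.
rewrite (derive_increment (p := p) (q := q)) //.
  by rewrite /p /q /L !horner_rules; field.
have fa : f a = 0.
  have [_] := nbhs_singleton fE; rewrite scale0r addr0 => ->.
  by rewrite expr0n /= !mul0r subrr mul0r.
near=> s.
have [m0 ->] : l0 + l1 * s + l2 * s ^+ 2 != 0 /\ f (a + s *: v) =
    (s * rvw * (l0 + l1 * s + l2 * s ^+ 2) - s ^+ 2 * rv * (k0 + k1 * s)) /
    (l0 + l1 * s + l2 * s ^+ 2) ^+ 2.
  by near: s; exact: fE.
by rewrite fa /p /q /L !horner_rules; field.
Unshelve. all: by end_near. Qed.
End RealLemmas.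

Opaque bracket levi_civita curvature Defs.form diff derive scalar_curvature.

Section ThreeIndices.
Variables (V : nmodType) (i j k : 'I_3).
Hypothesis ijk : uniq [:: i; j; k].

Lemma index_cases l : [\/ l = i, l = j | l = k].
Proof.
have [li|li] := eqVneq l i; first by constructor 1.
have [lj|lj] := eqVneq l j; first by constructor 2.
have [lk|lk] := eqVneq l k; first by constructor 3.
have u : uniq [:: l; i; j; k] by rewrite cons_uniq ijk !inE !negb_or li lj lk.
by have := max_card (mem [:: l; i; j; k]); rewrite (card_uniqP u) card_ord.
Qed.

Lemma sum_ord3 (F : 'I_3 -> V) : \sum_l F l = F i + F j + F k.
Proof.
have /and4P[] := ijk; rewrite !inE negb_or => /andP[ij ik] jk _ _.
rewrite (bigD1 i) //= (bigD1 j) ?(eq_sym j) //= (bigD1 k) /=; last first.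
  by rewrite eq_sym ik eq_sym jk.
rewrite big1 ?addr0 ?addrA // => l /andP[/andP[li lj] lk].
by case: (index_cases l) => frame; rewrite frame eqxx in li lj lk.
Qed.
End ThreeIndices.

(** * The frame of a generalized Wallach space *)

Section WallachFamily.
Context {R : realType} {n : nat} {G : lieGroupType R n} (H : set G) (h Q : 'M[R]_n).
Variables (m : 'I_3 -> 'M[R]_n) (e : forall i, 'M[R]_(\rank (m i), n)).
Hypotheses (Qbi : biinvariant G Q)
  (m_sum : (\sum_i m i :=: qcompl Q h)%MS)
  (m_orth : forall i j, i != j -> m i *m Q *m (m j)^T = 0)
  (m_irr : forall i, irreducible H (m i))
  (m_neq : forall i j, i != j -> ~ equivalent H (m i) (m j))
  (e_on : forall i, orthonormal_basis Q (e i))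
  (e_triple : forall i j l, (structure_constant G Q (e i) (e j) (e l) != 0)
                       = uniq [:: i; j; l]).
Implicit Types (X Y Z : 'rV[R]_n) (S : pred 'I_3).
Local Notation br := (bracket G).
Local Notation p := (qcompl Q h).

Definition frame_index := {i : 'I_3 & 'I_(\rank (m i))}.
HB.instance Definition _ := Finite.on frame_index.

Definition frame (a : frame_index) : 'rV[R]_n := row (tagged a) (e (tag a)).
Definition label (a : frame_index) : 'I_3 := tag a.
Definition mkindex i (al : 'I_(\rank (m i))) : frame_index := existT _ i al.

Lemma big_frame_index (V : nmodType) S (F : frame_index -> V) :
  \sum_(a | S (label a)) F a = \sum_(i | S i) \sum_al F (@mkindex i al).
Proof.
rewrite (sig_big_dep S (fun i => predT) (fun i al => F (@mkindex i al))) /=.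
by apply: eq_big => [a|[]] //; rewrite andbT.
Qed.

Lemma frame_sub a : (frame a <= m (label a))%MS.
Proof. by rewrite (submx_trans (row_sub _ _)) // (basis_eqmx (e_on _)). Qed.

Lemma ip_orth i j X Y : i != j -> (X <= m i)%MS -> (Y <= m j)%MS -> ip Q X Y = 0.
Proof.
move=> ij /submxP[A ->] /submxP[B ->].
by rewrite /ip trmx_mul !mulmxA -(mulmxA A) -(mulmxA A) m_orth // mulmx0 mul0mx mxE.
Qed.

Lemma ip_frame i al X : ip Q X (frame (@mkindex i al)) = (X *m Q *m (e i)^T) 0 al.
Proof. by rewrite /ip /frame /= !mxE; apply: eq_bigr => l _; rewrite !mxE. Qed.

Lemma frame_ip a b : ip Q (frame a) (frame b) = (a == b)%:R.
Proof.
have [ab|ab] := eqVneq (label a) (label b); last first.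
  rewrite (ip_orth ab (frame_sub a) (frame_sub b)) (_ : a == b = false) //.
  by apply: contraNF ab => /eqP ->.
case: a b ab => [i al] [j be] /= ij; rewrite /label /= in ij; case: j / ij be => be.
rewrite (ip_frame be) /frame /= -!row_mul !mxE /=.
have [_ eQ] := e_on i.
have -> : (\sum_j (e i *m Q) al j * (e i)^T j be) = (e i *m Q *m (e i)^T) al be.
  by rewrite [RHS]mxE.
by rewrite eQ mxE eq_Tagged.
Qed.

Lemma m_expand i X : (X <= m i)%MS -> X =
  \sum_al ip Q X (frame (@mkindex i al)) *: frame (@mkindex i al).
Proof.
move=> Xm; have /submxP[W WE] : (X <= e i)%MS by rewrite (basis_eqmx (e_on i)).
have [_ eQ] := e_on i.
have WE2 : X *m Q *m (e i)^T = W by rewrite WE -(mulmxA W) -(mulmxA W) eQ mulmx1.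
rewrite {1}WE mulmx_sum_row; apply: eq_bigr => al _.
by rewrite ip_frame WE2.
Qed.

Lemma frame_span S (p' : 'M[R]_n) : (p' :=: \sum_(i | S i) m i)%MS ->
  orthonormal_frame (p := p') Q (fun a : frame_index => S (label a)) frame.
Proof.
move=> p'E; split.
- by move=> a Sa; rewrite p'E (sumsmx_sup (label a)) // frame_sub.
- by move=> a b _ _; exact: frame_ip.
move=> X; rewrite p'E => /sub_sumsmxP[u XE].
have XE2 : X = \sum_(a | S (label a)) ip Q (u (label a) *m m (label a)) (frame a) *: frame a.
  rewrite big_frame_index XE; apply: eq_bigr => i _.
  by rewrite {1}(m_expand (submxMl (u i) (m i))).
rewrite {1}XE2; apply: eq_bigr => a Sa; congr (_ *: _).
rewrite [in RHS]XE2 ip_suml (bigD1 a) //= ipZl frame_ip eqxx mulr1 big1 ?addr0 //.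
by move=> b /andP[_ ba]; rewrite ipZl frame_ip (negPf ba) mulr0.
Qed.


Hypothesis H_sub : lie_subgroup H h.

Definition brconst (a b d : frame_index) : R := ip Q (br (frame a) (frame b)) (frame d).

Lemma brconstC a b d : brconst a b d = - brconst b a d.
Proof. by rewrite /brconst bracketC ipNl. Qed.

Lemma brconst_skew a b d : brconst a b d = - brconst a d b.
Proof.
exact: (etrans (bracket_skew Qbi (frame a) (frame b) (frame d)) (congr1 _ (ip_sym Qbi _ _))).
Qed.

Definition triple i j l : R := structure_constant G Q (e i) (e j) (e l).

Lemma tripleE i j l : triple i j l =
  \sum_al \sum_be \sum_ga brconst (@mkindex i al) (@mkindex j be) (@mkindex l ga) ^+ 2.
Proof. by []. Qed.

Lemma triple_swap12 i j l : triple i j l = triple j i l.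
Proof.
rewrite !tripleE exchange_big; apply: eq_bigr => al _; apply: eq_bigr => be _.
by apply: eq_bigr => ga _; rewrite brconstC sqrrN.
Qed.

Lemma triple_swap23 i j l : triple i j l = triple i l j.
Proof.
rewrite !tripleE; apply: eq_bigr => al _; rewrite exchange_big; apply: eq_bigr => ga _.
by apply: eq_bigr => be _; rewrite brconst_skew sqrrN.
Qed.

(** [ijl] is a sum of squares, so it only vanishes with all its terms. *)
Lemma brconst0 a b d : ~~ uniq [:: label a; label b; label d] -> brconst a b d = 0.
Proof.
case: a b d => [i al] [j be] [l ga]; rewrite /label /= => nu.
have : triple i j l = 0 by apply/eqP/negbNE; rewrite e_triple.
rewrite tripleE => /eqP; rewrite psumr_eq0 => [/allP H1|al1 _]; last first.
  by do 2! (apply: sumr_ge0 => ? _); exact: sqr_ge0.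
have := H1 al (mem_index_enum _); rewrite /= psumr_eq0 => [/allP H2|be1 _]; last first.
  by apply: sumr_ge0 => ? _; exact: sqr_ge0.
have := H2 be (mem_index_enum _); rewrite /= psumr_eq0 => [/allP H3|ga1 _]; last first.
  exact: sqr_ge0.
by have := H3 ga (mem_index_enum _); rewrite /= sqrf_eq0 => /eqP.
Qed.

Lemma m_sub i : (m i <= p)%MS.
Proof. by rewrite -m_sum (sumsmx_sup i). Qed.

Lemma isotropy_stable i Z X : (Z <= h)%MS -> (X <= m i)%MS -> (br Z X <= m i)%MS.
Proof. by move=> Zh Xm; apply: (subgroup_bracket H_sub) => //; case: (m_irr i). Qed.

(** Since [h, m_j] is in m_j, which is orthogonal to m_i, skewness of ad shows that [m_i,
    m_j] has no component in h. *)
Lemma br_mixed a b : label a != label b -> (br (frame a) (frame b) <= p)%MS.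
Proof.
move=> ab; apply/(qcomplP Q) => Z Zh.
rewrite bracketC ipNl (bracket_skew Qbi (frame b) (frame a) Z) opprK (bracketC G (frame b) Z) ipNr.
by rewrite (ip_orth ab (frame_sub a) (isotropy_stable Zh (frame_sub b))) oppr0.
Qed.

(** All components of [m_i, m_i] along m vanish, because [iil] = 0 for every l. *)
Lemma br_same a b : label a = label b -> (br (frame a) (frame b) <= h)%MS.
Proof.
move=> ab; have := add_proj_mx (qcompl_cap Qbi h) (qcompl_full Qbi h (br (frame a) (frame b))).
set W := br _ _; set Wh := W *m _; set Wp := W *m _ => WE.
have on := frame_span (S := predT) (p' := p) (eqmx_sym m_sum).
suff Wp0 : Wp = 0 by rewrite -WE Wp0 addr0 proj_mx_sub.
have [_ _ sp] := on; have Wpp : (Wp <= p)%MS by exact: proj_mx_sub.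
rewrite (sp _ Wpp); apply: big1 => d _.
suff -> : ip Q Wp (frame d) = 0 by rewrite scale0r.
have : ip Q W (frame d) = 0 by apply: brconst0; rewrite ab /= !inE eqxx.
rewrite -WE ipDl (ip_sym Qbi Wh).
have /(qcomplP Q) -> : (frame d <= p)%MS by rewrite (submx_trans (frame_sub d)) ?m_sub.
  by rewrite add0r.
exact: proj_mx_sub.
Qed.

Definition brnorm2 a b : R := ip Q (br (frame a) (frame b)) (br (frame a) (frame b)).

Lemma brnorm2_mixed a b : label a != label b -> brnorm2 a b = \sum_d brconst a b d ^+ 2.
Proof.
move=> ab; have on := frame_span (S := predT) (p' := p) (eqmx_sym m_sum).
rewrite /brnorm2 (parseval on _ (br_mixed ab)); apply: eq_bigr => d _.
by rewrite (ip_sym Qbi (frame d)) expr2.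
Qed.

(** This is p_i, the contribution of the isotropy algebra to the curvature of m_i, as
    [m_i, m_i] is contained in h. *)
Definition isotropy_part i : R := \sum_al \sum_be brnorm2 (@mkindex i al) (@mkindex i be).

Lemma sum_triple S1 S2 S3 (F : 'I_3 -> 'I_3 -> 'I_3 -> R) :
  \sum_(a | S1 (label a)) \sum_(b | S2 (label b)) \sum_(d | S3 (label d))
    F (label a) (label b) (label d) * brconst a b d ^+ 2 =
  \sum_(i | S1 i) \sum_(j | S2 j) \sum_(l | S3 l) F i j l * triple i j l.
Proof.
rewrite big_frame_index; apply: eq_bigr => i _.
under eq_bigr do rewrite big_frame_index.
rewrite exchange_big; apply: eq_bigr => j _ /=.
under eq_bigr do under eq_bigr do rewrite big_frame_index.
under eq_bigr do rewrite exchange_big.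
rewrite exchange_big; apply: eq_bigr => l _ /=.
rewrite tripleE mulr_sumr; apply: eq_bigr => al _.
rewrite mulr_sumr; apply: eq_bigr => be _.
by rewrite mulr_sumr; apply: eq_bigr => ga _.
Qed.

(** Parseval: [m_i, m_j] lies in m_l. *)
Lemma sum_brnorm2_mixed i j l : uniq [:: i; j; l] ->
  \sum_al \sum_be brnorm2 (@mkindex i al) (@mkindex j be) = triple i j l.
Proof.
move=> ijl; have /andP[ij _] := ijl.
have ij' : i != j by move: ij; rewrite !inE negb_or => /andP[].
have sc0 l' : ~~ uniq [:: i; j; l'] -> triple i j l' = 0.
  by move=> nu; apply/eqP/negbNE; rewrite e_triple.
transitivity (\sum_l' triple i j l'); last first.
  have n1 : ~~ uniq [:: i; j; i] by rewrite /= !inE eqxx orbT.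
  have n2 : ~~ uniq [:: i; j; j] by rewrite /= !inE eqxx andbF.
  by rewrite (sum_ord3 ijl) (sc0 i n1) (sc0 j n2) !add0r.
have := sum_triple (pred1 i) (pred1 j) predT (fun _ _ _ => 1).
rewrite [in RHS]big_pred1_eq [in RHS]big_pred1_eq.
under [RHS]eq_bigr do rewrite mul1r.
move=> <-; rewrite big_frame_index big_pred1_eq; apply: eq_bigr => al _.
rewrite big_frame_index big_pred1_eq; apply: eq_bigr => be _.
by rewrite brnorm2_mixed //; apply: eq_bigr => d _; rewrite mul1r.
Qed.

(** * Scalar curvature of G/H, K/H and G/K *)

(** For a pair in different modules the isotropy term is zero by Parseval. *)
Lemma scal_diagonal (x : 'I_3 -> R) (g : 'M[R]_(\rank p)) : (forall i, x i != 0) ->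
  diagonal (fun a => predT (label a)) frame g (fun a => x (label a)) ->
  scalar_curvature G h g = \sum_i (x i)^-1 * isotropy_part i +
    \sum_i \sum_j \sum_l cubic_coef (x i) (x j) (x l) * triple i j l.
Proof.
move=> x0 dg; have on := frame_span (S := predT) (p' := p) (eqmx_sym m_sum).
rewrite (scalar_curvature_formula Qbi on dg _ _ _ _ (c := brconst)) //.
- congr (_ + _); last exact: (sum_triple predT predT predT (fun i j l => cubic_coef (x i) (x j) (x l))).
  pose U a b := brnorm2 a b - \sum_d brconst a b d ^+ 2.
  transitivity (\sum_(a | predT (label a)) \sum_(b | predT (label b)) (x (label b))^-1 *
    U a b) => //.
  rewrite big_frame_index; apply: eq_bigr => i _; rewrite mulr_sumr; apply: eq_bigr => al _.
  rewrite big_frame_index (bigD1 i) //= [X in _ + X]big1 ?addr0 => [|j ji].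
    rewrite mulr_sumr; apply: eq_bigr => be _; congr (_ * _).
    rewrite /U big1 ?subr0 // => d _; rewrite brconst0 ?expr0n //.
    by rewrite /label /= !inE eqxx.
  apply: big1 => be _; rewrite /U brnorm2_mixed ?subrr ?mulr0 //.
  by rewrite /label /= eq_sym.
- by move=> Z X Zh /(qcomplP Q) Xp; rewrite (ip_sym Qbi) Xp.
- by move=> a b _ _; rewrite addsmxC; exact: (qcompl_full Qbi).
- move=> Z b Zh _; apply: (submx_trans (isotropy_stable Zh (frame_sub b))); exact: m_sub.
Qed.

Lemma scal_wallach (x : 'I_3 -> R) (g : 'M[R]_(\rank p)) i j k : uniq [:: i; j; k] ->
  (forall i, x i != 0) ->
  diagonal (fun a => predT (label a)) frame g (fun a => x (label a)) ->
  scalar_curvature G h g =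
  ((isotropy_part i + triple i j k) * (x j * x k) + (isotropy_part j + triple i j k) *
    (x i * x k) +
   (isotropy_part k + triple i j k) * (x i * x j) -
   triple i j k / 2 * (x i ^+ 2 + x j ^+ 2 + x k ^+ 2)) / (x i * x j * x k).
Proof.
move=> ijk x0 dg; rewrite (scal_diagonal x0 dg).
have sc0 l1 l2 l3 : ~~ uniq [:: l1; l2; l3] -> triple l1 l2 l3 = 0.
  by move=> nu; apply/eqP/negbNE; rewrite e_triple.
have d1 l l' : triple l l l' = 0 by apply: sc0; rewrite /= !inE eqxx.
have d2 l l' : triple l l' l = 0 by apply: sc0; rewrite /= !inE eqxx orbT.
have d3 l l' : triple l' l l = 0 by apply: sc0; rewrite /= !inE eqxx andbF.
rewrite !(sum_ord3 ijk) !d1 !d2 !d3 !mulr0 !addr0 !add0r.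
rewrite (triple_swap23 i k j) (triple_swap12 j i k) (triple_swap23 j k i) (triple_swap12 j i k).
rewrite (triple_swap12 k i j) (triple_swap23 i k j) (triple_swap23 k j i) (triple_swap12 k i j) (triple_swap23 i k j).
have xi := x0 i; have xj := x0 j; have xk := x0 k.
rewrite /cubic_coef; field.
by rewrite xi xj xk.
Qed.

Section Intermediate.
Variables (i : 'I_3) (K : set G) (ki : 'M[R]_n).
Hypotheses (kiE : (ki :=: h + m i)%MS) (K_sub : lie_subgroup K ki).

(** The modular law for h and m_i, as h meets m trivially. *)
Lemma intermediate_cap : (ki :&: p :=: \sum_(l | pred1 i l) m l)%MS.
Proof.
rewrite big_pred1_eq; apply/eqmxP/andP; split; last first.
  by rewrite sub_capmx m_sub kiE addsmxSr.
apply/row_subP => r; set X := row r _.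
have : (X <= ki :&: p)%MS by exact: row_sub.
rewrite sub_capmx kiE => /andP[/sub_addsmxP[[u v] /= XE] Xp].
have uh : u *m h = X - v *m m i by rewrite XE addrK.
have : (u *m h <= h :&: p)%MS.
  rewrite sub_capmx submxMl uh addmx_sub // eqmx_opp.
  by rewrite (submx_trans (submxMl _ _)) ?m_sub.
by rewrite (qcompl_cap Qbi) submx0 => /eqP u0; rewrite XE u0 add0r submxMl.
Qed.

Lemma intermediate_qcompl : (qcompl Q ki :=: \sum_(l | predC1 i l) m l)%MS.
Proof.
apply/eqmxP/andP; split; last first.
  apply/sumsmx_subP => l li; apply/row_subP => r; apply/(qcomplP Q) => Z.
  rewrite kiE => /sub_addsmxP[[u v] /= ->]; rewrite ipDr.
  have rl : (row r (m l) <= m l)%MS by exact: row_sub.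
  rewrite (ip_orth li rl (submxMl _ _)) addr0.
  have /(qcomplP Q) -> // : (row r (m l) <= p)%MS := submx_trans rl (m_sub l).
  exact: submxMl.
apply/row_subP => r; set X := row r _.
have /(qcomplP Q) Xk : (X <= qcompl Q ki)%MS by exact: row_sub.
have Xp : (X <= p)%MS.
  by apply/(qcomplP Q) => Z Zh; rewrite Xk // kiE (submx_trans Zh) // addsmxSl.
have [_ _ sp] := frame_span (S := predT) (p' := p) (eqmx_sym m_sum).
rewrite (sp X Xp); apply: summx_sub => d _; have [di|di] := eqVneq (label d) i.
  rewrite Xk ?scale0r ?sub0mx // kiE (submx_trans _ (addsmxSr _ _)) //.
  by rewrite -di frame_sub.
by apply: scalemx_sub; rewrite (sumsmx_sup (label d)) // frame_sub.
Qed.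

(** All brackets of m_i lie in h, so that only the isotropy terms remain. *)
Lemma scal_fibre (x : R) (g : 'M[R]_(\rank (ki :&: p))) : x != 0 ->
  diagonal (fun a => pred1 i (label a)) frame g (fun=> x) ->
  scalar_curvature G h g = isotropy_part i / x.
Proof.
move=> x0 dg; have on := frame_span intermediate_cap.
have c0 a b d : label a == i -> label b == i -> brconst a b d = 0.
  by move=> /eqP ai /eqP bi; apply: brconst0; rewrite ai bi /= !inE eqxx.
rewrite (scalar_curvature_formula Qbi on dg _ _ _ _ (c := brconst)) //.
- rewrite [X in _ + X]big1 ?addr0 => [|a ai]; last first.
    apply: big1 => b bi; apply: big1 => d _.
    by rewrite c0 // expr0n mulr0.
  rewrite big_frame_index big_pred1_eq /isotropy_part mulr_suml; apply: eq_bigr => al _.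
  rewrite big_frame_index big_pred1_eq mulr_suml; apply: eq_bigr => be _.
  rewrite big1 ?subr0 1?mulrC // => d _; by rewrite c0 ?expr0n ?/label /=.
- by move=> Z X Zh; rewrite sub_capmx => /andP[_ /(qcomplP Q) Xp]; rewrite (ip_sym Qbi) Xp.
- move=> a b /eqP ai /eqP bi; apply: (submx_trans _ (addsmxSr _ _)).
  by apply: br_same; rewrite ai bi.
- move=> Z b Zh /eqP bi; rewrite intermediate_cap big_pred1_eq -bi.
  exact: (isotropy_stable Zh (frame_sub b)).
Qed.

Lemma qcompl_K_stable a : K a -> stablemx (qcompl Q ki) (Ad a).
Proof.
by move=> Ka; apply: (Ad_stable_qcompl Qbi); exact: (subgroup_Ad_stable K_sub).
Qed.

(** G/K_i is locally symmetric: [m_j + m_k, m_j + m_k] lies in k_i. For the isotropy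
    algebra k_i, the mixed brackets contribute [jki] and [kji] to the isotropy terms. *)
Lemma scal_base (x : R) (g : 'M[R]_(\rank (qcompl Q ki))) j k : x != 0 ->
  uniq [:: i; j; k] ->
  diagonal (fun a => predC1 i (label a)) frame g (fun=> x) ->
  scalar_curvature G ki g = (isotropy_part j + isotropy_part k + 2 * triple i j k) / x.
Proof.
move=> x0 ijk dg; have on := frame_span intermediate_qcompl.
have ij : j != i by have := ijk; rewrite /= !inE !negb_or eq_sym => /andP[/andP[]].
have ik : k != i by have := ijk; rewrite /= !inE !negb_or (eq_sym k) => /andP[/andP[]].
have c0 a b d : label a != i -> label b != i -> label d != i -> brconst a b d = 0.
  move=> ai bi di; apply: brconst0; apply: contraT => /negPn u.
  have u' : uniq [:: i; label a; label b; label d].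
    by rewrite cons_uniq u !inE !negb_or !(eq_sym i) ai bi di.
  by have := max_card (mem [:: i; label a; label b; label d]);
    rewrite (card_uniqP u') card_ord.
rewrite (scalar_curvature_formula Qbi on dg _ _ _ _ (c := brconst)) //.
- rewrite [X in _ + X]big1 ?addr0 => [|a ai]; last first.
    apply: big1 => b bi; apply: big1 => d di.
    by rewrite c0 // expr0n mulr0.
  have sumC (F : 'I_3 -> R) : \sum_(l | predC1 i l) F l = F j + F k.
    by rewrite big_mkcond (sum_ord3 ijk) /= eqxx ij ik add0r.
  transitivity (\sum_(a | predC1 i (label a)) \sum_(b | predC1 i (label b)) x^-1 *
    brnorm2 a b).
    apply: eq_bigr => a ai; apply: eq_bigr => b bi.
    by rewrite big1 ?subr0 // => d di; rewrite c0 // expr0n.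
  transitivity (\sum_(l | predC1 i l) \sum_(l' | predC1 i l')
     \sum_al \sum_be x^-1 * brnorm2 (@mkindex l al) (@mkindex l' be)).
    rewrite big_frame_index; apply: eq_bigr => l _.
    by under eq_bigr do rewrite big_frame_index; rewrite exchange_big.
  have xN l l' : \sum_al \sum_be x^-1 * brnorm2 (@mkindex l al) (@mkindex l' be) =
      x^-1 * \sum_al \sum_be brnorm2 (@mkindex l al) (@mkindex l' be).
    by rewrite mulr_sumr; apply: eq_bigr => al _; rewrite mulr_sumr.
  have jki : uniq [:: j; k; i] by have := ijk; rewrite -(rot_uniq 1).
  have kji : uniq [:: k; j; i] by have := jki;
    rewrite -(rev_uniq [:: k; j; i]) -(rot_uniq 1).
  rewrite !sumC !xN (sum_brnorm2_mixed jki) (sum_brnorm2_mixed kji) -/(isotropy_part j) -/(isotropy_part k).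
  have -> : triple j k i = triple i j k by rewrite triple_swap23 triple_swap12.
  have -> : triple k j i =
    triple i j k by rewrite triple_swap12 triple_swap23 triple_swap12.
  by rewrite mulrC; ring.
- by move=> Z X Zk /(qcomplP Q) Xp; rewrite (ip_sym Qbi) Xp.
- by move=> a b _ _; rewrite addsmxC; exact: (qcompl_full Qbi).
- move=> Z b Zk bi; apply: (subgroup_bracket K_sub) => //; first exact: qcompl_K_stable.
  by rewrite intermediate_qcompl (sumsmx_sup (label b)) // frame_sub.
Qed.
End Intermediate.

(** * Invariant forms are diagonal *)

Section InvariantForms.
Variables (S : pred 'I_3) (p' : 'M[R]_n).
Hypothesis p'E : (p' :=: \sum_(i | S i) m i)%MS.
Implicit Types (v : 'M[R]_(\rank p')) (x : 'I_3 -> R).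
Local Notation diag v x := (diagonal (fun a :
  frame_index => S (label a)) frame v (fun a => x (label a))).

Let on := frame_span p'E.

Lemma frame_in_span a : S (label a) -> (frame a <= p')%MS.
Proof. by case: on => + _ _; apply. Qed.

Lemma frame_Ad i al a : H a ->
  frame (@mkindex i al) *m Ad a = \sum_be Ad_mx Q (e i) a al be *: frame (@mkindex i be).
Proof.
move=> Ha; rewrite /frame /= -row_mul (Ad_mxE (e_on i) (m_irr i) Ha) row_mul.
by rewrite mulmx_sum_row; apply: eq_bigr => be _; rewrite mxE.
Qed.

(** Ad_a acts on the frame through [Ad_mx], so invariance of v becomes an intertwining
    relation. *)
Lemma invariant_gram v i j a : S i -> S j -> H a -> invariant_form H v ->
  let M := \matrix_(al, be) form v (frame (@mkindex i al)) (frame (@mkindex j be)) in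
  Ad_mx Q (e i) a *m M *m (Ad_mx Q (e j) a)^T = M.
Proof.
move=> Si Sj Ha vi M; apply/matrixP => al be; rewrite [RHS]mxE.
rewrite -(vi a Ha) ?frame_in_span // !frame_Ad // form_sumr mxE; apply: eq_bigr => be' _.
rewrite formZr form_suml mulrC !mxE; congr (_ * _).
by apply: eq_bigr => al' _; rewrite formZl !mxE.
Qed.

(** Schur's lemma, applied within each module and between inequivalent ones. *)
Lemma invariant_diagonal v : v^T = v -> invariant_form H v -> exists x, diag v x.
Proof.
move=> vT vi.
have /choice[x xE] : forall i, exists c, S i -> forall al be,
    form v (frame (@mkindex i al)) (frame (@mkindex i be)) = c *+ (al == be).
  move=> i; case Si: (S i); last by exists 0.
  pose M := \matrix_(al, be) form v (frame (@mkindex i al)) (frame (@mkindex i be)).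
  have MT : M^T = M by apply/matrixP => al be; rewrite !mxE form_sym.
  have [a Ha|c Mc] := schur_scalar Qbi (e_on i) (m_irr i) MT.
    exact: invariant_gram.
  exists c => _ al be; have /matrixP/(_ al be) := Mc.
  by rewrite !mxE.
exists x => a b Sa Sb; have [ab|ab] := eqVneq (label a) (label b).
  case: a b ab Sa Sb => [i al] [j be] /= ij; rewrite /label /= in ij *.
  case: j / ij be => be Si _; rewrite -/(mkindex al) -/(mkindex be) xE //.
  by rewrite eq_Tagged.
rewrite (_ : a == b = false); last by apply: contraNF ab => /eqP ->.
case: a b ab Sa Sb => [i al] [j be]; rewrite /label /= => ij Si Sj.
pose M := \matrix_(al, be) form v (frame (@mkindex i al)) (frame (@mkindex j be)).
have M0 : M = 0.
  apply: (schur_zero Qbi (e_on i) (m_irr i) (e_on j) (m_irr j) (m_neq ij)) => a Ha.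
  exact: invariant_gram.
by have /matrixP/(_ al be) := M0; rewrite !mxE.
Qed.

Definition diagform x : 'M[R]_(\rank p') := \matrix_(u, w)
  \sum_(a : frame_index | S (label a)) x (label a) *
    (ip Q (bvec u) (frame a) * ip Q (bvec w) (frame a)).

Lemma form_diagform x X Y : (X <= p')%MS -> (Y <= p')%MS ->
  form (diagform x) X Y =
  \sum_(a : frame_index | S (label a)) x (label a) * (ip Q X (frame a) * ip Q Y (frame a)).
Proof.
apply: (form_ext (B := fun X Y =>
  \sum_(a : frame_index | S (label a)) x (label a) *
    (ip Q X (frame a) * ip Q Y (frame a)))).
- by move=> u w; rewrite form_bvec mxE.
- move=> Z c X1 X2; rewrite mulr_sumr -big_split; apply: eq_bigr => a _ /=.
  by rewrite ipDl ipZl; ring.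
- move=> Z c X1 X2; rewrite mulr_sumr -big_split; apply: eq_bigr => a _ /=.
  by rewrite ipDl ipZl; ring.
Qed.

Lemma diagform_diagonal x : diag (diagform x) x.
Proof.
move=> a b Sa Sb; rewrite form_diagform ?frame_in_span // (bigD1 a) //= !frame_ip eqxx mul1r eq_sym.
rewrite big1 ?addr0 ?mulr_natr // => d /andP[_ da].
by rewrite !frame_ip (eq_sym a d) (negPf da) mul0r mulr0.
Qed.

Lemma diagonal_eq v x : diag v x -> v = diagform x.
Proof.
move=> dv; apply: form_eq => i j.
rewrite (form_diagonalE on dv (bvec_sub i) (bvec_sub j)).
by rewrite form_diagform ?bvec_sub //; apply: eq_bigr => a _; rewrite mulrA.
Qed.

Lemma diagform_tr x : (diagform x)^T = diagform x.
Proof.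
by apply/matrixP => u w; rewrite !mxE; apply: eq_bigr => a _; rewrite (mulrC (ip _ _ _)).
Qed.

Lemma diagform_pos x X : (forall i, S i -> 0 < x i) -> (X <= p')%MS -> X != 0 ->
  0 < form (diagform x) X X.
Proof.
move=> xp Xp X0; rewrite form_diagform // lt_neqAle eq_sym.
have pos (a : frame_index) : S (label a) -> 0 <= x (label a) *
  (ip Q X (frame a) * ip Q X (frame a)).
  by move=> Sa; rewrite mulr_ge0 ?(ltW (xp _ Sa)) // -expr2 sqr_ge0.
rewrite sumr_ge0 ?andbT //; apply: contra X0; rewrite psumr_eq0 // => /allP H0.
case: on => _ _ sp; rewrite (sp X Xp) big1 // => a Sa.
have := H0 a (mem_index_enum _); rewrite Sa /= !mulf_eq0 gt_eqF ?xp //= orbb.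
by move=> /eqP ->; rewrite scale0r.
Qed.

Lemma frame_span_Ad X a : H a -> (X <= p')%MS -> (X *m Ad a <= p')%MS.
Proof.
move=> Ha; rewrite !p'E => /sub_sumsmxP[u ->]; rewrite mulmx_suml; apply: summx_sub => i Si.
rewrite -mulmxA (sumsmx_sup i) // (submx_trans (submxMl _ _)) //.
by case: (m_irr i) => _ + _; apply.
Qed.

(** Ad_a rotates the frame of each module by an orthogonal matrix. *)
Lemma diagform_invariant x : invariant_form H (diagform x).
Proof.
move=> a Ha X Y Xp Yp; rewrite !form_diagform ?frame_span_Ad // !big_frame_index.
apply: eq_bigr => i _.
transitivity (x i * \sum_al ip Q (X *m Ad a) (frame (@mkindex i al)) *
  ip Q (Y *m Ad a) (frame (@mkindex i al))).
  by rewrite mulr_sumr.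
transitivity (x i * \sum_al ip Q X (frame (@mkindex i al)) *
  ip Q Y (frame (@mkindex i al))); last first.
  by rewrite mulr_sumr.
congr (_ * _).
have sumE Z W : \sum_al ip Q Z (frame (@mkindex i al)) * ip Q W (frame (@mkindex i al)) =
    ((Z *m Q *m (e i)^T) *m (W *m Q *m (e i)^T)^T) 0 0.
  rewrite [RHS]mxE; apply: eq_bigr => al _; rewrite !ip_frame; congr (_ * _).
  by rewrite [RHS]mxE.
rewrite !sumE.
have key Z : Z *m Ad a *m Q *m (e i)^T = Z *m Q *m (e i)^T *m Ad_mx Q (e i) a.
  case: (Qbi) => _ _ Qi.
  have ro' := Ad_mx_orthogonal_tr Qbi (e_on i) (m_irr i) Ha.
  have eE : e i = (Ad_mx Q (e i) a)^T *m (e i *m Ad a).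
    by rewrite (Ad_mxE (e_on i) (m_irr i) Ha) mulmxA ro' mul1mx.
  move: (Ad_mx Q (e i) a) eE => r eE.
  have eET : (e i)^T = (Ad a)^T *m (e i)^T *m r.
    by have := congr1 trmx eE; rewrite trmx_mul (trmx_mul (e i) (Ad a)) trmxK.
  by rewrite {1}eET !mulmxA -(mulmxA Z) -(mulmxA Z) Qi.
have ro := Ad_mx_orthogonal Qbi (e_on i) (m_irr i) Ha.
rewrite !key; move: (Ad_mx Q (e i) a) ro => r ro.
move: (X *m Q *m (e i)^T) (Y *m Q *m (e i)^T) => A B.
by rewrite trmx_mul mulmxA -(mulmxA A) ro mulmx1.
Qed.

Lemma diagform_metric x : (forall i, S i -> 0 < x i) -> metrics H (diagform x).
Proof.
move=> xp; split; first exact: diagform_tr.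
- by move=> X; exact: diagform_pos.
- exact: diagform_invariant.
Qed.

Lemma metric_diagonal v : metrics H v ->
  exists2 x, diag v x & forall i, S i -> 0 < x i.
Proof.
case=> vT vp vi; have [x dx] := invariant_diagonal vT vi; exists x => // i Si.
have r0 : (0 < \rank (m i))%N by case: (m_irr i) => m0 _ _; rewrite lt0n mxrank_eq0.
pose a := mkindex (Ordinal r0); have := dx a a Si Si; rewrite eqxx mulr1n => <-.
apply: vp; first exact: frame_in_span.
by apply/eqP => Ea; have := frame_ip a a; rewrite Ea ip0l eqxx => /eqP;
  rewrite eq_sym oner_eq0.
Qed.

Lemma trace_diagonal (T v : 'M[R]_(\rank p')) x tau : diag v x -> diag T tau ->
  (forall i, S i -> x i != 0) ->
  trace_form T v = \sum_(i | S i) (\rank (m i))%:R * tau i / x i.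
Proof.
move=> dv dT x0; rewrite (trace_form_diagonal on dv); last by move=> a Sa; exact: x0.
rewrite big_frame_index; apply: eq_bigr => i Si.
rewrite (eq_bigr (fun=> tau i / x i)); last first.
  by move=> al _; rewrite dT // eqxx mulr1n mulrC.
by rewrite sumr_const card_ord -mulrA mulr_natl.
Qed.
End InvariantForms.

(** * Bounds for alpha and beta *)

Section AlphaBeta.
Variables (T : 'M[R]_(\rank p)) (tau : 'I_3 -> R).
Hypotheses (dT : diagonal (fun a :
  frame_index => predT (label a)) frame T (fun a => tau (label a)))
  (tau0 : forall i, 0 < tau i).

Definition trace_weight i : R := (\rank (m i))%:R * tau i.

Lemma trace_weight_gt0 i : 0 < trace_weight i.
Proof.
by case: (m_irr i) => m0 _ _; rewrite mulr_gt0 // ltr0n lt0n mxrank_eq0.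
Qed.

Lemma restr_diagonal S p' : (p' :=: \sum_(i | S i) m i)%MS ->
  diagonal (fun a : frame_index => S (label a)) frame (restr p' T) (fun a => tau (label a)).
Proof.
by move=> p'E a b Sa Sb; rewrite form_restr ?(frame_in_span p'E) // dT.
Qed.

(** By irreducibility K_i/H has, up to scaling, only one invariant metric, and the trace
    condition fixes the scale. *)
Lemma alpha_le i ki : (ki :=: h + m i)%MS ->
  (alpha H T ki <= (isotropy_part i / trace_weight i)%:E)%E.
Proof.
move=> kiE; have kc := intermediate_cap kiE.
apply: ge_ereal_sup => _ [g [gm /= tr] <-]; rewrite lee_fin.
have [x dg x0] := metric_diagonal kc gm.
have x0' l : pred1 i l -> x l != 0 by move=> li; rewrite gt_eqF ?x0.
have ii : pred1 i i by rewrite /= eqxx.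
move: tr; rewrite (trace_diagonal kc dg (restr_diagonal kc) x0') big_pred1_eq => tr.
have {tr} xt : x i = trace_weight i.
  by rewrite -[LHS]mul1r -tr divfK // x0'.
have dgi : diagonal (fun a : frame_index => pred1 i (label a)) frame g (fun=> x i).
  by move=> a b ai bi; rewrite (dg a b ai bi) (eqP ai).
by rewrite (scal_fibre kiE (x0' i ii) dgi) xt.
Qed.

(** The multiples of Q are Ad_K-invariant; the one of unit trace is a competitor for the
    supremum. *)
Lemma beta_ge i j k (K : set G) ki : uniq [:: i; j; k] -> (ki :=: h + m i)%MS ->
  lie_subgroup K ki ->
  (((isotropy_part j + isotropy_part k + 2 * triple i j k) / (trace_weight j +
    trace_weight k))%:E <= beta K T ki)%E.
Proof.
move=> ijk kiE Ksub; have kq := intermediate_qcompl kiE.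
have tjk : 0 < trace_weight j + trace_weight k by rewrite addr_gt0 ?trace_weight_gt0.
pose x (_ : 'I_3) : R := trace_weight j + trace_weight k.
pose g := diagform (predC1 i) (qcompl Q ki) x.
have dg : diagonal (fun a :
  frame_index => predC1 i (label a)) frame g (fun a => x (label a)).
  exact: diagform_diagonal.
apply: ereal_sup_ubound; exists g; last first.
  by congr (_%:E); rewrite (scal_base kiE Ksub _ ijk dg) // gt_eqF.
split; [split|].
- exact: diagform_tr.
- by move=> X; apply: diagform_pos.
- move=> a Ka X Y Xq Yq.
  have on := frame_span kq.
  have st Z : (Z <= qcompl Q ki)%MS -> (Z *m Ad a <= qcompl Q ki)%MS.
    by move=> Zq; rewrite (submx_trans (submxMr _ Zq)) // (qcompl_K_stable Ksub).
  have gE Z W : (Z <= qcompl Q ki)%MS -> (W <= qcompl Q ki)%MS ->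
      form g Z W = (trace_weight j + trace_weight k) * ip Q Z W.
    move=> Zq Wq; rewrite form_diagform // (parseval on _ Zq) mulr_sumr.
    by apply: eq_bigr => d _; rewrite (ip_sym Qbi W).
  by rewrite !gE ?st // (ip_Ad Qbi).
- rewrite /= (trace_diagonal kq dg (restr_diagonal kq)); last by move=> l _; rewrite gt_eqF.
  rewrite big_mkcond (sum_ord3 ijk) /= eqxx add0r.
  have ij : j != i by have := ijk; rewrite /= !inE !negb_or eq_sym => /andP[/andP[]].
  have ik : k != i by have := ijk; rewrite /= !inE !negb_or (eq_sym k) => /andP[/andP[]].
  by rewrite ij ik /x -mulrDl divff // gt_eqF.
Qed.

Lemma beta_lt_alpha i j k (K : set G) ki : uniq [:: i; j; k] -> (ki :=: h + m i)%MS ->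
  lie_subgroup K ki -> (beta K T ki - alpha H T ki < 0)%E ->
  (isotropy_part j + isotropy_part k + 2 * triple i j k) / (trace_weight j +
    trace_weight k) < isotropy_part i / trace_weight i.
Proof.
move=> ijk kiE Ksub neg; rewrite -subr_lt0 -lte_fin EFinB.
by apply: le_lt_trans neg; apply: leeB; [exact: beta_ge | exact: alpha_le].
Qed.
End AlphaBeta.

(** * Critical points and their co-index *)

Section Critical.
Variables (T : 'M[R]_(\rank p)) (tau : 'I_3 -> R).
Hypotheses (dT : diagonal (fun a :
  frame_index => predT (label a)) frame T (fun a => tau (label a)))
  (tau0 : forall i, 0 < tau i).
Variables (i j k : 'I_3) (ijk : uniq [:: i; j; k]).
Variables (lam : R) (x : 'I_3 -> R).
Local Notation A := (triple i j k).
Local Notation t := (trace_weight tau).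
Local Notation gx := (diagform predT p).
(** The off-diagonal coefficients a_l of q_S - lam q_T. *)
Definition pencil_coef l : R := isotropy_part l + A - lam * t l.
Hypotheses (x_gt0 : forall l, 0 < x l)
  (x_norm : t i / x i + t j / x j + t k / x k = 1)
  (eq_i : A * x i = pencil_coef k * x j + pencil_coef j * x k)
  (eq_j : A * x j = pencil_coef k * x i + pencil_coef i * x k)
  (eq_k : A * x k = pencil_coef j * x i + pencil_coef i * x j).

Lemma triple_gt0 : 0 < A.
Proof.
rewrite lt_neqAle eq_sym e_triple ijk /= tripleE.
by do 3! (apply: sumr_ge0 => ? _); exact: sqr_ge0.
Qed.

Lemma diagform_line y s w : gx (fun l => y l + s * w l) = gx y + s *: gx w.
Proof.
apply/matrixP => u v; rewrite !mxE mulr_sumr -big_split; apply: eq_bigr => a _ /=.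
by rewrite mulrDl -mulrA.
Qed.

Lemma diagformZ s w : gx (fun l => s * w l) = s *: gx w.
Proof. by apply/matrixP => u v; rewrite !mxE mulr_sumr; apply: eq_bigr => a _;
  rewrite -mulrA. Qed.

(** The quadratic form q_S - lam q_T. *)
Definition pencil (y : 'I_3 -> R) : R :=
  pencil_coef i * (y j * y k) + pencil_coef j * (y i * y k) + pencil_coef k * (y i * y j) -
  A / 2 * (y i ^+ 2 + y j ^+ 2 + y k ^+ 2).
Definition pencil_polar (y w : 'I_3 -> R) : R :=
  pencil_coef i * (y j * w k + w j * y k) + pencil_coef j * (y i * w k + w i * y k) +
  pencil_coef k * (y i * w j + w i * y j) - A * (y i * w i + y j * w j + y k * w k).
(** The quadratic form q_T. *)
Definition trace_quad (y : 'I_3 -> R) : R :=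
  t i * (y j * y k) + t j * (y i * y k) + t k * (y i * y j).
Definition trace_quad_polar (y w : 'I_3 -> R) : R :=
  t i * (y j * w k + w j * y k) + t j * (y i * w k + w i * y k) +
  t k * (y i * w j + w i * y j).

Lemma pencil_line y w s : pencil (fun l => y l + s * w l) = pencil y + pencil_polar y w *
  s + pencil w * s ^+ 2.
Proof. by rewrite /pencil /pencil_polar; field. Qed.

Lemma trace_quad_line y w s : trace_quad (fun l => y l + s * w l) = trace_quad y +
  trace_quad_polar y w * s + trace_quad w * s ^+ 2.
Proof. by rewrite /trace_quad /trace_quad_polar; ring. Qed.

(** The three equations say that x is in the kernel of the pencil. *)
Lemma pencil_polar_x w : pencil_polar x w = 0.
Proof.
have -> : pencil_polar x w = w i * (pencil_coef k * x j + pencil_coef j * x k - A * x i) +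
  w j * (pencil_coef k * x i + pencil_coef i * x k - A * x j) + w k *
    (pencil_coef j * x i + pencil_coef i * x j - A * x k).
  by rewrite /pencil_polar; ring.
by rewrite -eq_i -eq_j -eq_k !subrr !mulr0 !addr0.
Qed.

Lemma pencil_x : pencil x = 0.
Proof.
have -> : pencil x = pencil_polar x x / 2 by rewrite /pencil /pencil_polar; field.
by rewrite pencil_polar_x mul0r.
Qed.

Lemma pencil_polar_line y w v s : pencil_polar (fun l => y l + s * v l) w =
  pencil_polar y w + s * pencil_polar v w.
Proof. by rewrite /pencil_polar; ring. Qed.

Lemma trace_quad_polar_line y w v s : trace_quad_polar (fun l => y l + s * v l) w =
  trace_quad_polar y w + s * trace_quad_polar v w.
Proof. by rewrite /trace_quad_polar; ring. Qed.

Let t0 l : 0 < t l := trace_weight_gt0 tau0 l.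

Lemma trace_quad_gt0 y : (forall l, 0 < y l) -> 0 < trace_quad y.
Proof.
move=> y0; have pos l l1 l2 : 0 < t l * (y l1 * y l2).
  by apply: mulr_gt0 (t0 l) _; exact: mulr_gt0.
by rewrite /trace_quad; apply: addr_gt0 => //; apply: addr_gt0.
Qed.

Let psum : (p :=: \sum_(l | predT l) m l)%MS := eqmx_sym m_sum.

Lemma trace_diagform y : (forall l, y l != 0) ->
  trace_form T (gx y) = t i / y i + t j / y j + t k / y k.
Proof.
move=> y0; have dy := diagform_diagonal psum y.
by rewrite (trace_diagonal psum dy dT) // (sum_ord3 ijk).
Qed.

Lemma scal_diagform y : (forall l, y l != 0) ->
  scalar_curvature G h (gx y) = lam * (t i / y i + t j / y j + t k / y k) +
    pencil y / (y i * y j * y k).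
Proof.
move=> y0; rewrite (scal_wallach ijk y0 (diagform_diagonal psum y)) /pencil /pencil_coef.
have yi := y0 i; have yj := y0 j; have yk := y0 k.
by field; rewrite yi yj yk.
Qed.

(** S and the trace are homogeneous of degree -1, so that rescaling to unit trace divides
    S by the trace. *)
Lemma scal_to_M_T y : (forall l, 0 < y l) ->
  scalar_curvature G h (to_M_T T (gx y)) = lam + pencil y / trace_quad y.
Proof.
move=> y0; have yn l : y l != 0 by rewrite gt_eqF.
have yi := yn i; have yj := yn j; have yk := yn k.
have lln : trace_quad y != 0 by rewrite gt_eqF ?trace_quad_gt0.
rewrite /to_M_T -diagformZ trace_diagform //; set c := _ + _ / y k.
have cE : c = trace_quad y / (y i * y j * y k).
  by rewrite /c /trace_quad; field; rewrite yi yj yk.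
have cn : c != 0 by rewrite cE mulf_neq0 ?invr_neq0 ?mulf_neq0.
rewrite scal_diagform => [|l]; last by rewrite mulf_neq0.
have -> : pencil (fun l => c * y l) = c ^+ 2 * pencil y by rewrite /pencil; field.
have -> : lam * (t i / (c * y i) + t j / (c * y j) + t k / (c * y k)) = lam * (c / c).
  by congr (_ * _); rewrite {4}/c; field; rewrite cn yi yj yk.
rewrite divff // mulr1; congr (_ + _).
have -> : c ^+ 2 * pencil y / (c * y i * (c * y j) * (c * y k)) =
   pencil y / (c * (y i * y j * y k)) by field; rewrite cn yi yj yk.
by rewrite cE divfK ?mulf_neq0.
Qed.

Lemma near_line (y w : 'I_3 -> R) : (forall l, 0 < y l) ->
  \forall s \near (0 : R), forall l, 0 < y l + s * w l.
Proof.
move=> y0; have np l : \forall s \near (0 : R), 0 < y l + s * w l by exact: near_pos.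
near=> s; move=> l.
have hi : 0 < y i + s * w i by near: s; exact: np.
have hj : 0 < y j + s * w j by near: s; exact: np.
have hk : 0 < y k + s * w k by near: s; exact: np.
by case: (index_cases ijk l) => ->.
Unshelve. all: by end_near. Qed.

Definition trace_slope w : R := t i * w i / x i ^+ 2 + t j * w j / x j ^+ 2 + t k *
  w k / x k ^+ 2.

Lemma derive_trace_diagform w : 'D_(gx w) (trace_form T) (gx x) = - trace_slope w.
Proof.
rewrite (wallach_derive (f := trace_form T) (lam := 1) (r := 0) (t1 := t i) (t2 := t j)
  (t3 := t k) (w1 := w i) (w2 := w j) (w3 := w k) (x_gt0 i) (x_gt0 j) (x_gt0 k)).
  by rewrite mulN1r.
have np := near_line w x_gt0; near=> s.
have y0 : forall l, 0 < x l + s * w l by near: s; exact: np.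
rewrite -diagform_line trace_diagform => [|l]; last by rewrite gt_eqF.
by rewrite mul1r mulr0 mul0r addr0.
Unshelve. all: by end_near. Qed.

(** S is lam times the trace plus pencil / (x_i x_j x_k), and the pencil vanishes to
    second order at x. *)
Lemma derive_scal_diagform w : 'D_(gx w) (scalar_curvature G h (p := p)) (gx x) = - lam *
  trace_slope w.
Proof.
apply: (wallach_derive (r := pencil w) (x_gt0 i) (x_gt0 j) (x_gt0 k)).
have np := near_line w x_gt0; near=> s.
have y0 : forall l, 0 < x l + s * w l by near: s; exact: np.
rewrite -diagform_line scal_diagform => [|l]; last by rewrite gt_eqF.
by rewrite pencil_line pencil_x pencil_polar_x mul0r !add0r (mulrC (pencil w)).
Unshelve. all: by end_near. Qed.

Lemma tangentP v : tangent_M_T H T (gx x) v <-> exists2 w, v = gx w & trace_slope w = 0.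
Proof.
split=> [[vT vi]|[w -> w0]].
  have [w dw] := invariant_diagonal psum vT vi.
  have -> := diagonal_eq psum dw; rewrite derive_trace_diagform => /eqP;
    rewrite oppr_eq0 => /eqP w0.
  by exists w.
split; [exact: diagform_tr | exact: (diagform_invariant psum) |].
by rewrite derive_trace_diagform w0 oppr0.
Qed.

Lemma diagform_critical : critical_point H h T (gx x).
Proof.
split; first split.
- by apply: (diagform_metric psum) => l _.
- by rewrite /= trace_diagform // => l; rewrite gt_eqF.
- by move=> v /tangentP[w -> w0]; rewrite derive_scal_diagform w0 mulr0.
Qed.

Lemma derive_scal_to_M_T y w : (forall l, 0 < y l) ->
  'D_(gx w) (fun z => scalar_curvature G h (to_M_T T z)) (gx y) =
  (pencil_polar y w * trace_quad y - pencil y * trace_quad_polar y w) / trace_quad y ^+ 2.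
Proof.
move=> y0; have ln : trace_quad y != 0 by rewrite gt_eqF ?trace_quad_gt0.
apply: (quotient_derive (c := lam) (r2 := pencil w) (l2 := trace_quad w) ln).
have np := near_line w y0; near=> s.
have y0' : forall l, 0 < y l + s * w l by near: s; exact: np.
rewrite -diagform_line scal_to_M_T // -pencil_line -trace_quad_line; split => //.
by rewrite gt_eqF ?trace_quad_gt0.
Unshelve. all: by end_near. Qed.

(** With rescaling, S is lam plus the quotient of the pencil by q_T, and the pencil
    vanishes to second order at x. *)
Lemma hessian_diagform v w : hessian G h T (gx x) (gx v) (gx w) =
  pencil_polar v w / trace_quad x.
Proof.
have ln : trace_quad x != 0 by rewrite gt_eqF ?trace_quad_gt0.
rewrite /hessian.
apply: (hessian_derive (rv := pencil v) (l1 := trace_quad_polar x v) (l2 := trace_quad v)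
  (k0 := trace_quad_polar x w) (k1 := trace_quad_polar v w) ln).
have np := near_line v x_gt0; near=> s.
have y0 : forall l, 0 < x l + s * v l by near: s; exact: np.
rewrite -diagform_line derive_scal_to_M_T // pencil_polar_line pencil_polar_x add0r pencil_line pencil_x pencil_polar_x.
rewrite mul0r !add0r trace_quad_polar_line trace_quad_line (mulrC (pencil v)) (mulrC s (trace_quad_polar v w)); split => //.
by rewrite -trace_quad_line gt_eqF ?trace_quad_gt0.
Unshelve. all: by end_near. Qed.

Lemma diagform_inj y : gx y = 0 -> forall l, y l = 0.
Proof.
move=> y0 l; have r0 : (0 < \rank (m l))%N.
  by case: (m_irr l) => m0 _ _; rewrite lt0n mxrank_eq0.
pose a := mkindex (Ordinal r0).
have := diagform_diagonal psum y (a := a) (b := a) isT isT.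
rewrite y0 eqxx mulr1n => <-.
by rewrite form_ip /ip mulmx0 mul0mx mxE.
Qed.

(** The l-th coordinate vector, projected to the tangent plane of M_T along x. *)
Definition tangent_vec (l l' : 'I_3) : R := (l' == l)%:R - t l / x l ^+ 2 * x l'.

Let ij : (i == j) = false.
Proof. by apply: negbTE; have := ijk; rewrite /= !inE !negb_or => /andP[/andP[]]. Qed.
Let ik : (i == k) = false.
Proof. by apply: negbTE; have := ijk; rewrite /= !inE !negb_or => /andP[/andP[]]. Qed.
Let jk : (j == k) = false.
Proof. by apply: negbTE; have := ijk; rewrite /= !inE !negb_or => /and3P[]. Qed.

(** The projection is along the kernel of the pencil. *)
Lemma pencil_polar_tangent_vec l l' : pencil_polar (tangent_vec l) (tangent_vec l') =
  pencil_polar (fun l1 => (l1 == l)%:R) (fun l1 => (l1 == l')%:R).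
Proof.
pose d l (l1 : 'I_3) : R := (l1 == l)%:R.
have rrpC y w : pencil_polar y w = pencil_polar w y by rewrite /pencil_polar; ring.
have lin c d1 w : pencil_polar (fun l1 => d1 l1 - c * x l1) w = pencil_polar d1 w.
  have -> : (fun l1 => d1 l1 - c * x l1) = (fun l1 => d1 l1 + (- c) * x l1).
    by apply/funext => l1; rewrite mulNr.
  by rewrite pencil_polar_line pencil_polar_x mulr0 addr0.
by rewrite /tangent_vec (lin _ (d l)) rrpC (lin _ (d l')) rrpC.
Qed.

Lemma hess_same l : l = i \/ l = j ->
  hessian G h T (gx x) (gx (tangent_vec l)) (gx (tangent_vec l)) = - (A / trace_quad x).
Proof.
move=> lE; rewrite hessian_diagform pencil_polar_tangent_vec -mulNr; congr (_ / _).
by case: lE => ->; rewrite /pencil_polar !eqxx ?ij ?ik ?jk ?(eq_sym j i) ?(eq_sym k i) ?(eq_sym k j)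
  ?ij ?ik ?jk /=; ring.
Qed.

Lemma hess_mixed l l' : (l = i /\ l' = j) \/ (l = j /\ l' = i) ->
  hessian G h T (gx x) (gx (tangent_vec l)) (gx (tangent_vec l')) =
    pencil_coef k / trace_quad x.
Proof.
move=> lE; rewrite hessian_diagform pencil_polar_tangent_vec; congr (_ / _).
by case: lE => -[-> ->];
  rewrite /pencil_polar !eqxx ?ij ?ik ?jk ?(eq_sym j i) ?(eq_sym k i) ?(eq_sym k j)
  ?ij ?ik ?jk /=; ring.
Qed.

Lemma trace_slope_tangent_vec l : trace_slope (tangent_vec l) = 0.
Proof.
have xi := lt0r_neq0 (x_gt0 i); have xj := lt0r_neq0 (x_gt0 j);
  have xk := lt0r_neq0 (x_gt0 k).
have -> : trace_slope (tangent_vec l) = trace_slope (fun l1 => (l1 == l)%:R) -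
    t l / x l ^+ 2 * (t i / x i + t j / x j + t k / x k).
  by rewrite /trace_slope /tangent_vec; field; rewrite xi xj xk lt0r_neq0.
rewrite x_norm mulr1 /trace_slope.
by case: (index_cases ijk l) => ->; rewrite !eqxx ?ij ?ik ?jk ?(eq_sym j i) ?(eq_sym k i)
  ?(eq_sym k j) ?ij ?ik ?jk /= ?mulr0 ?mul0r ?mulr1 ?addr0 ?add0r subrr.
Qed.

(** The trace condition gives the relation x_i v_i + x_j v_j + x_k v_k = 0 between the
    projected coordinate vectors, which eliminates v_k. *)
Lemma tangent_span w : trace_slope w = 0 ->
  gx w = (w i - w k * (x i / x k)) *: gx (tangent_vec i) +
    (w j - w k * (x j / x k)) *: gx (tangent_vec j).
Proof.
have xi := lt0r_neq0 (x_gt0 i); have xj := lt0r_neq0 (x_gt0 j);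
  have xk := lt0r_neq0 (x_gt0 k).
move=> w0.
pose al := w i - w k * (x i / x k); pose be := w j - w k * (x j / x k).
rewrite -/al -/be.
have key : al * (t i / x i ^+ 2) + be * (t j / x j ^+ 2) = - (w k / x k).
  have -> : al * (t i / x i ^+ 2) + be * (t j / x j ^+ 2) =
    trace_slope w - w k / x k * (t i / x i + t j / x j + t k / x k).
    by rewrite /al /be /trace_slope; field; rewrite xi xj xk.
  by rewrite w0 x_norm mulr1 sub0r.
rewrite -diagformZ -diagform_line; congr (gx _); apply/funext => l.
have -> : al * tangent_vec i l + be * tangent_vec j l = al * (l == i)%:R + be *
  (l == j)%:R -
  (al * (t i / x i ^+ 2) + be * (t j / x j ^+ 2)) * x l by rewrite /tangent_vec; ring.
rewrite key /al /be.
case: (index_cases ijk l) => ->; rewrite ?eqxx ?ij ?ik ?jk ?(eq_sym j i) ?(eq_sym k i)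
  ?(eq_sym k j) ?ij ?ik ?jk /=; field => //.
Qed.

(** In the basis of the projected coordinate vectors v_i, v_j the Hessian has the diagonal
    entries - A / q_T(x) and equal off-diagonal entries a_k / q_T(x). Its eigenvalues have
    a negative sum. *)
Lemma diagform_coindex : coindex H h T (gx x) 0 \/ coindex H h T (gx x) 1.
Proof.
pose b : 2.-tuple 'M[R]_(\rank p) := [tuple gx (tangent_vec i); gx (tangent_vec j)].
pose s := [:: - (A / trace_quad x) + pencil_coef k / trace_quad x; - (A / trace_quad x) -
  pencil_coef k / trace_quad x].
have xk := lt0r_neq0 (x_gt0 k).
have b0 : tnth b ord0 = gx (tangent_vec i) by rewrite (tnth_nth 0).
have b1 : tnth b ord_max = gx (tangent_vec j) by rewrite (tnth_nth 0).
have bfree : free b.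
  apply/freeP => c; rewrite big_ord_recl big_ord1 /= -diagformZ -diagform_line => /diagform_inj c0.
  set c1 := c ord0 in c0 *; set c2 := c (lift ord0 0) in c0 *.
  have ek : c1 * (t i / x i ^+ 2) + c2 * (t j / x j ^+ 2) = 0.
    apply: (mulIf xk); rewrite mul0r.
    have -> : (c1 * (t i / x i ^+ 2) + c2 * (t j / x j ^+ 2)) * x k =
        - (c1 * tangent_vec i k + c2 * tangent_vec j k).
      by rewrite /tangent_vec (eq_sym k i) ik (eq_sym k j) jk /=; ring.
    by rewrite c0 oppr0.
  have f1 l : c1 * (l == i)%:R + c2 * (l == j)%:R = 0.
    rewrite -(c0 l) -[LHS]subr0 -(mul0r (x l)) -ek /tangent_vec; ring.
  have c10 : c1 = 0 by have := f1 i; rewrite eqxx ij mulr1 mulr0 addr0.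
  have c20 : c2 = 0 by have := f1 j; rewrite eqxx (eq_sym j i) ij mulr1 mulr0 add0r.
  move=> l; case: l => [[|[|//]] ll0]; [rewrite -[RHS]c10 | rewrite -[RHS]c20];
    by congr c; apply: val_inj.
have bspan v : v \in <<b>>%VS <-> tangent_M_T H T (gx x) v.
  split=> [vb|/tangentP[w -> w0]].
    apply/tangentP; rewrite (coord_span vb) big_ord_recl big_ord1 /=.
    set c1 := coord _ _ _; set c2 := coord _ _ _.
    exists (fun l => c1 * tangent_vec i l + c2 * tangent_vec j l);
      first by rewrite diagform_line diagformZ.
    have -> : trace_slope (fun l => c1 * tangent_vec i l + c2 * tangent_vec j l) =
      c1 * trace_slope (tangent_vec i) + c2 *
        trace_slope (tangent_vec j) by rewrite /trace_slope; ring.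
    by rewrite !trace_slope_tangent_vec !mulr0 addr0.
  rewrite (tangent_span w0) memvD // memvZ // memv_span // !inE eqxx ?orbT //.
have bpoly : char_poly (\matrix_(l < 2, l' < 2)
    hessian G h T (gx x) (tnth b l) (tnth b l')) = \prod_(a <- s) ('X - a%:P).
  apply: char_poly2; rewrite mxE ?b0 ?b1.
  - by rewrite hess_same //; left.
  - by rewrite hess_same //; right.
  - by rewrite hess_mixed //; left.
  - by rewrite hess_mixed //; right.
have cnt : (count (fun a => (0 < a)%R) s <= 1)%N.
  have u0 : 0 < A / trace_quad x by rewrite divr_gt0 ?triple_gt0 ?trace_quad_gt0.
  rewrite /s /=; set u := A / trace_quad x in u0 *; set v := pencil_coef k / trace_quad x.
  case: (ltrP 0 (- u + v)) => h1; case: (ltrP 0 (- u - v)) => h2 //.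
  have := addr_gt0 h1 h2; have -> : - u + v + (- u - v) = - (u + u) by ring.
  rewrite oppr_gt0.
  by rewrite ltNge ltW // addr_gt0.
have : count (fun a => (0 < a)%R) s = 0%N \/ count (fun a => (0 < a)%R) s = 1%N.
  by case: (count _ s) cnt => [|[|]] //; [left|right].
by case=> cE; [left|right]; exists 2%N, b, s; split.
Qed.

End Critical.
End WallachFamily.

(** * Existence of the critical point *)

Lemma third_index (i j : 'I_3) : i != j -> exists k, uniq [:: i; j; k].
Proof.
move=> ij; case: (pickP (fun k => uniq [:: i; j; k])) => [k ijk|none]; first by exists k.
have : (#|'I_3| <= #|pred2 i j|)%N.
  apply: subset_leq_card; apply/fintype.subsetP => k _; have := none k.
  rewrite /= !inE (negPf ij) (eq_sym k i) (eq_sym k j).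
  by case: (i == k); case: (j == k).
by rewrite card_ord card2 ij.
Qed.

Theorem theoremB (R : realType) (n : nat) (G : lieGroupType R n)
  (H : set G) (h : 'M[R]_n) (Q : 'M[R]_n)
  (m : 'I_3 -> 'M[R]_n) (K : 'I_3 -> set G) (k : 'I_3 -> 'M[R]_n)
  (T : 'M[R]_(\rank (qcompl Q h)))
  (G_compact : compact [set: G]) (G_connected : connected [set: G])
  (H_subgroup : lie_subgroup H h)
  (H_compact : compact H) (H_connected : connected H)
  (GH_effective : almost_effective H)
  (GH_not_torus : ~ covered_by_torus R (homogeneous_space H))
  (Q_biinvariant : biinvariant G Q)
  (GH_wallach : generalized_wallach H Q h m)
  (K_intermediate : forall i, intermediate_subgroup H h (K i) (k i))
  (k_def : forall i, (k i == h + m i)%MS)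
  (T_metric : metrics H T)
  (two_negative : exists i j : 'I_3, [/\ i != j,
     (beta (K i) T (k i) - alpha H T (k i) < 0)%E &
     (beta (K j) T (k j) - alpha H T (k j) < 0)%E]) :
  exists g : 'M[R]_(\rank (qcompl Q h)),
    critical_point H h T g /\ (coindex H h T g 0 \/ coindex H h T g 1).
Proof.
case: GH_wallach => m_sum m_orth m_irr m_neq [e [e_on e_triple]].
have {}m_sum := eqmxP m_sum.
have psum : (qcompl Q h :=: \sum_(l | predT l) m l)%MS := eqmx_sym m_sum.
have [tau dT tau0] := metric_diagonal Q_biinvariant m_orth m_irr m_neq e_on psum T_metric.
have {}tau0 l : 0 < tau l by exact: tau0.
have kE l := eqmxP (k_def l).
have Ksub l : lie_subgroup (K l) (k l) by case: (K_intermediate l).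
pose t := trace_weight m tau; pose w := isotropy_part (G := G) Q e.
have t0 l : 0 < t l := trace_weight_gt0 m_irr tau0 l.
suff main i j : i != j -> w i / t i <= w j / t j ->
    (beta (K i) T (k i) - alpha H T (k i) < 0)%E ->
    exists g : 'M[R]_(\rank (qcompl Q h)),
      critical_point H h T g /\ (coindex H h T g 0 \/ coindex H h T g 1).
  case: two_negative => i [j [ij negi negj]].
  (* The construction starts from the lower of the two ratios p_i / t_i. *)
  case: (lerP (w i / t i) (w j / t j)) => [le|/ltW le]; first exact: main le negi.
  by apply: main le negj; rewrite eq_sym.
move=> ij le neg; have [l ijl] := third_index ij.
pose A := triple (G := G) Q e i j l.
have A0 : 0 < A := triple_gt0 e_triple ijl.
have bound : (w j + w l + 2 * A) / (t j + t l) < w i / t i :=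
  beta_lt_alpha Q_biinvariant m_sum m_orth m_irr m_neq e_on e_triple H_subgroup dT tau0
    ijl (kE i) (Ksub i) neg.
have [lam [x1 [x2 [x3 [x10 x20 x30 [e1 e2 e3]]]]]] :=
  wallach_root A0 (t0 i) (t0 j) (t0 l) le bound.
have ij' : (j == i) = false by rewrite eq_sym (negPf ij).
have [li lj] : (l == i) = false /\ (l == j) = false.
  move: ijl; rewrite /= !inE negb_or => /andP[/andP[_ il] /andP[jl _]].
  by rewrite (eq_sym l i) (eq_sym l j) (negPf il) (negPf jl).
(* The equations are homogeneous: rescaling by c reaches unit trace. *)
pose c := t i / x1 + t j / x2 + t l / x3.
have c0 : 0 < c by rewrite /c !addr_gt0 ?divr_gt0.
pose x (r : 'I_3) : R := c * (if r == i then x1 else if r == j then x2 else x3).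
have xi : x i = c * x1 by rewrite /x eqxx.
have xj : x j = c * x2 by rewrite /x ij' eqxx.
have xl : x l = c * x3 by rewrite /x li lj.
have x_gt0 r : 0 < x r by rewrite /x mulr_gt0 //; case: ifP => // _; case: ifP.
have n1 := lt0r_neq0 x10; have n2 := lt0r_neq0 x20; have n3 := lt0r_neq0 x30.
have nc := lt0r_neq0 c0.
have x_norm : t i / x i + t j / x j + t l / x l = 1.
  rewrite xi xj xl -[RHS](divff nc) {4}/c.
  by field; rewrite nc n1 n2 n3.
have eqs u1 u2 u3 b1 b2 : A * u1 = b1 * u2 + b2 * u3 ->
    A * (c * u1) = b1 * (c * u2) + b2 * (c * u3).
  by move=> E1; rewrite mulrCA E1 mulrDr !(mulrCA c).
have eq_i := eqs _ _ _ _ _ e1; have eq_j := eqs _ _ _ _ _ e2; have eq_l := eqs _ _ _ _ _ e3.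
rewrite -?xi -?xj -?xl in eq_i eq_j eq_l.
exists (diagform Q e predT (qcompl Q h) x); split.
- exact: (diagform_critical Q_biinvariant m_sum m_orth m_irr m_neq e_on e_triple H_subgroup dT
    ijl x_gt0 x_norm eq_i eq_j eq_l).
- exact: (diagform_coindex Q_biinvariant m_sum m_orth m_irr m_neq e_on e_triple H_subgroup dT tau0
    ijl x_gt0 x_norm eq_i eq_j eq_l).
Qed.
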